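(* The fourth power $\vartheta^4(\tau,z)$ of the Jacobi theta series, regarded as a function of weight $2$ and index $2$, satisfies the modular differential equation of degree $3$ $$H_6H_4H_2(\vartheta^4)-\tfrac{23}{4}E_4H_2(\vartheta^4)+\tfrac{81}{4}E_6\vartheta^4=0.$$
   Context: Let $\tau$ lie in the upper half-plane, $z\in\mathbb{C}$, $q=e^{2\pi i\tau}$, $\zeta=e^{2\pi iz}$, $\vartheta(\tau,z)=q^{1/8}\zeta^{1/2}\sum_{n\in\mathbb{Z}}(-1)^nq^{n(n+1)/2}\zeta^n$. $E_2=1-24\sum\sigma_1(n)q^n$, $E_4=1+240\sum\sigma_3(n)q^n$, $E_6=1-504\sum\sigma_5(n)q^n$. For index $m=2$: $H^{(2)}=12q\frac{\partial}{\partial q}-\frac32(\zeta\frac{\partial}{\partial\zeta})^2$, and for a function $\varphi$ of weight $k$ (and index $2$), $H_k(\varphi)=H^{(2)}(\varphi)-\frac{2k-1}{2}E_2\varphi$, of weight $k+2$; $H_6H_4H_2(\varphi)=H_6(H_4(H_2(\varphi)))$. *)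

(* Defs.v *)
From Stdlib Require Import Reals ZArith List.
From Coquelicot Require Import Coquelicot.
Open Scope R_scope.

Definition cexp (w : C) : C :=
  (exp (Re w) * cos (Im w), exp (Re w) * sin (Im w)).

Definition e2pi (x : C) : C := cexp (Cmult (RtoC (2 * PI) * Ci) x).

Definition CSeries (f : nat -> C) : C :=
  (Series (fun n => Re (f n)), Series (fun n => Im (f n))).

Definition CSeriesZ (f : Z -> C) : C :=
  Cplus (CSeries (fun n => f (Z.of_nat n)))
        (CSeries (fun n => f (- Z.of_nat n - 1)%Z)).

(* q = e(tau), zeta = e(z); q^(1/8) := e(tau/8), zeta^(1/2) := e(z/2) *)
Definition jtheta (tau z : C) : C :=
  Cmult (Cmult (e2pi (Cdiv tau 8)) (e2pi (Cdiv z 2)))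
    (CSeriesZ (fun n : Z =>
       Cmult (RtoC (powerRZ (-1) n))
         (Cmult (e2pi (Cmult (RtoC (IZR (n * (n + 1) / 2))) tau))
                (e2pi (Cmult (RtoC (IZR n)) z))))).

Definition sigma (k n : nat) : nat :=
  fold_right Nat.add 0%nat
    (map (fun d => if Nat.eqb (n mod d) 0 then (d ^ k)%nat else 0%nat)
         (seq 1 n)).

Definition eis (c : R) (k : nat) (tau : C) : C :=
  Cplus 1 (Cmult (RtoC c)
    (CSeries (fun n => Cmult (RtoC (INR (sigma k (S n))))
                             (e2pi (Cmult (RtoC (INR (S n))) tau))))).

Definition E2 := eis (-24) 1.
Definition E4 := eis 240 3.
Definition E6 := eis (-504) 5.

(* q d/dq = (1/(2 pi i)) d/dtau ;  zeta d/dzeta = (1/(2 pi i)) d/dz *)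
Definition twopii : C := Cmult (RtoC (2 * PI)) Ci.

Definition qDq (phi : C -> C -> C) (tau z : C) : C :=
  Cdiv (C_derive (fun t => phi t z) tau) twopii.

Definition zDz (phi : C -> C -> C) (tau z : C) : C :=
  Cdiv (C_derive (fun w => phi tau w) z) twopii.

Definition Hop2 (phi : C -> C -> C) (tau z : C) : C :=
  Cminus (Cmult 12 (qDq phi tau z))
         (Cmult (RtoC (3/2)) (zDz (zDz phi) tau z)).

Definition Hk (k : nat) (phi : C -> C -> C) (tau z : C) : C :=
  Cminus (Hop2 phi tau z)
         (Cmult (RtoC ((2 * INR k - 1) / 2)) (Cmult (E2 tau) (phi tau z))).

Definition theta4 (tau z : C) : C := Cpow (jtheta tau z) 4.

(* Main.v *)
Require Import Defs.
From Stdlib Require Import Reals ZArith Lra Lia Psatz List.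
From Coquelicot Require Import Coquelicot.
Open Scope R_scope.

(** Let D = q d/dq, let ' = zeta d/dzeta, and let p be the Weierstrass function, so that
    (log theta)'' = - p + E_2 / 12. By the heat equation D theta = theta'' / 2 one finds
    H_2 (theta^4) = - 18 p theta^4; with p'' = 6 p^2 - E_4 / 24 one more step gives
    H_4 H_2 (theta^4) = (54 p^2 + (39/8) E_4) theta^4, and the theorem is the next step, where
    p'^2 = 4 p^3 - E_4 p / 12 + E_6 / 216 enters as a consequence of applying D to the
    equation for p''.

    The equation for p'' is kept in the polynomial form
      theta theta'''' - 4 theta' theta''' + 3 theta''^2
        = E_2 (theta theta'' - theta'^2) - (E_2^2 - E_4) / 24 theta^2,
    so that zeros of theta need no separate treatment. It holds because
    theta(z+w) theta(z-w) = f(z) g(w) - g(z) f(w): the Taylor coefficients in w of order 0, 2, 4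
    lie in the plane spanned by f and g, hence are linearly dependent, and the coefficients of the
    dependency are read off at z = 0.

    The Taylor coefficients of theta at z = 0 are expressed by E_2, E_4, E_6 through finite Jacobi
    products: prod (1 - q^n zeta)(1 - q^n / zeta) is, up to a constant, prod (1 - y_n s^2) with
    s = zeta^(1/2) - zeta^(-1/2) and y_n = q^n / (1 - q^n)^2, and the power sums of the y_n are
    Lambert series. Since D shifts these Taylor coefficients, Ramanujan's formulas for D E_2 and
    D E_4 follow. *)

(** * Series of complex numbers *)

(** The obstacle is to reach the Taylor coefficients of theta at 0 without differentiating an
    infinite product. A polynomial weight w pairs with a Laurent polynomial in zeta^(1/2) by summing
    w(x) times the coefficient of zeta^x, that is, by w(zeta d/dzeta) at zeta = 1. Multiplication by
    s^2 = zeta - 2 + 1/zeta is then adjoint to the second difference of the weight. The weights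
    [W0], ..., [W3] are proportional to second differences of one another, and all but [W0] vanish
    at 1/2 and -1/2, so [W_k] sees only the coefficient of s^(2k+1); on the finite product this is
    an elementary symmetric function of the y_n. Only sequences of numbers pass to the limit, under
    a bound uniform in the number of factors. The powers y_n, y_n^2, y_n^3 expand with coefficients
    that are odd polynomials of degree at most 5 in the summation index, which is why exactly E_2,
    E_4, E_6 appear. The weight [W0] moreover gives theta'(0) as a nonzero product, the divisor in
    all later formulas. *)

Fixpoint csum (f : nat -> C) (N : nat) : C :=
  match N with
  | O => 0
  | S n => Cplus (csum f n) (f n)
  end.

Lemma csum_ext (f g : nat -> C) (N : nat) :
  (forall n, (n < N)%nat -> f n = g n) -> csum f N = csum g N.
Proof.
  induction N as [|N IH]; intros H; simpl; [reflexivity|].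
  rewrite IH by (intros; apply H; lia). rewrite H by lia. reflexivity.
Qed.

Lemma csum_plus (f g : nat -> C) (N : nat) :
  csum (fun n => Cplus (f n) (g n)) N = Cplus (csum f N) (csum g N).
Proof. induction N as [|N IH]; simpl; [|rewrite IH]; ring. Qed.

Lemma csum_scal (c : C) (f : nat -> C) (N : nat) :
  csum (fun n => Cmult c (f n)) N = Cmult c (csum f N).
Proof. induction N as [|N IH]; simpl; [|rewrite IH]; ring. Qed.

Fixpoint rsum (f : nat -> R) (N : nat) : R :=
  match N with
  | O => 0
  | S n => rsum f n + f n
  end.

Lemma Cmod_csum (f : nat -> C) (b : nat -> R) (N : nat) :
  (forall n, Cmod (f n) <= b n) -> Cmod (csum f N) <= rsum b N.
Proof.
  intros H; induction N as [|N IH]; simpl.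
  - rewrite Cmod_0; lra.
  - eapply Rle_trans; [apply Cmod_triangle|]. specialize (H N). lra.
Qed.

Lemma rsum_sum_n (f : nat -> R) (N : nat) : rsum f (S N) = sum_n f N.
Proof.
  induction N as [|N IH].
  - simpl. rewrite sum_O. ring.
  - rewrite sum_Sn. rewrite <- IH. reflexivity.
Qed.

Lemma csum_Re_Im (f : nat -> C) (N : nat) :
  csum f N = (rsum (fun n => Re (f n)) N, rsum (fun n => Im (f n)) N).
Proof. induction N as [|N IH]; simpl; [|rewrite IH]; reflexivity. Qed.

(** * Limits of complex sequences *)

Definition climit (u : nat -> C) (l : C) : Prop :=
  forall eps, 0 < eps -> exists N, forall n, (N <= n)%nat -> Cmod (Cminus (u n) l) < eps.

Lemma climit_unique (u : nat -> C) (l l' : C) :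
  climit u l -> climit u l' -> l = l'.
Proof.
  intros H H'.
  assert (Cminus l l' = 0) as E.
  { apply Cmod_eq_0. apply Rle_antisym; [|apply Cmod_ge_0].
    apply Rnot_lt_le. intros Hp.
    destruct (H (Cmod (Cminus l l') / 2)) as [N HN]; [lra|].
    destruct (H' (Cmod (Cminus l l') / 2)) as [N' HN']; [lra|].
    specialize (HN (N + N')%nat ltac:(lia)). specialize (HN' (N + N')%nat ltac:(lia)).
    assert (Cmod (Cminus l l') <= Cmod (Cminus (u (N+N')%nat) l') + Cmod (Cminus (u (N+N')%nat) l)).
    { rewrite <- (Cmod_opp (Cminus (u (N+N')%nat) l)).
      replace (Cminus l l') with (Cplus (Cminus (u (N+N')%nat) l') (Copp (Cminus (u (N+N')%nat) l))) by ring.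
      apply Cmod_triangle. }
    lra. }
  replace l with (Cplus (Cminus l l') l') by ring. rewrite E. ring.
Qed.

Lemma climit_ext_from (N0 : nat) (u v : nat -> C) (l : C) :
  (forall n, (N0 <= n)%nat -> u n = v n) -> climit u l -> climit v l.
Proof.
  intros E H eps He. destruct (H eps He) as [N HN]. exists (N + N0)%nat.
  intros n Hn. rewrite <- E by lia. apply HN; lia.
Qed.

Lemma climit_ext (u v : nat -> C) (l : C) :
  (forall n, u n = v n) -> climit u l -> climit v l.
Proof. intros E. apply (climit_ext_from 0). intros; apply E. Qed.

Lemma climit_const (c : C) : climit (fun _ => c) c.
Proof.
  intros eps He. exists 0%nat. intros n _.
  replace (Cminus c c) with (RtoC 0) by ring. rewrite Cmod_0. exact He.
Qed.

Lemma climit_plus (u v : nat -> C) (l m : C) :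
  climit u l -> climit v m -> climit (fun n => Cplus (u n) (v n)) (Cplus l m).
Proof.
  intros Hu Hv eps He.
  destruct (Hu (eps/2) ltac:(lra)) as [N HN]. destruct (Hv (eps/2) ltac:(lra)) as [M HM].
  exists (N + M)%nat. intros n Hn. specialize (HN n ltac:(lia)). specialize (HM n ltac:(lia)).
  replace (Cminus (Cplus (u n) (v n)) (Cplus l m)) with (Cplus (Cminus (u n) l) (Cminus (v n) m)) by ring.
  eapply Rle_lt_trans; [apply Cmod_triangle|]. lra.
Qed.

Lemma climit_bounded (u : nat -> C) (l : C) :
  climit u l -> exists B N, 0 < B /\ forall n, (N <= n)%nat -> Cmod (u n) <= B.
Proof.
  intros H. destruct (H 1 ltac:(lra)) as [N HN]. exists (Cmod l + 1), N.
  split. { generalize (Cmod_ge_0 l); lra. }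
  intros n Hn. specialize (HN n Hn).
  replace (u n) with (Cplus (Cminus (u n) l) l) by ring.
  eapply Rle_trans; [apply Cmod_triangle|]. lra.
Qed.

Lemma climit_mult (u v : nat -> C) (l m : C) :
  climit u l -> climit v m -> climit (fun n => Cmult (u n) (v n)) (Cmult l m).
Proof.
  intros Hu Hv eps He.
  destruct (climit_bounded v m Hv) as [B [N0 [HB HN0]]].
  assert (Hl := Cmod_ge_0 l).
  destruct (Hu (eps / (2 * B))) as [N HN]. { apply Rdiv_lt_0_compat; lra. }
  destruct (Hv (eps / (2 * (Cmod l + 1)))) as [M HM]. { apply Rdiv_lt_0_compat; lra. }
  exists (N + M + N0)%nat. intros n Hn.
  specialize (HN n ltac:(lia)). specialize (HM n ltac:(lia)). specialize (HN0 n ltac:(lia)).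
  replace (Cminus (Cmult (u n) (v n)) (Cmult l m))
    with (Cplus (Cmult (Cminus (u n) l) (v n)) (Cmult l (Cminus (v n) m))) by ring.
  eapply Rle_lt_trans; [apply Cmod_triangle|]. rewrite !Cmod_mult.
  assert (Cmod (Cminus (u n) l) * Cmod (v n) <= Cmod (Cminus (u n) l) * B).
  { apply Rmult_le_compat_l; [apply Cmod_ge_0|exact HN0]. }
  assert (Cmod (Cminus (u n) l) * B < eps / (2 * B) * B).
  { apply Rmult_lt_compat_r; lra. }
  assert (Cmod l * Cmod (Cminus (v n) m) <= (Cmod l + 1) * Cmod (Cminus (v n) m)).
  { apply Rmult_le_compat_r; [apply Cmod_ge_0|lra]. }
  assert ((Cmod l + 1) * Cmod (Cminus (v n) m) < (Cmod l + 1) * (eps / (2 * (Cmod l + 1)))).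
  { apply Rmult_lt_compat_l; lra. }
  replace (eps / (2 * B) * B) with (eps / 2) in * by (field; lra).
  replace ((Cmod l + 1) * (eps / (2 * (Cmod l + 1)))) with (eps / 2) in * by (field; lra).
  lra.
Qed.

Lemma climit_scal (c : C) (u : nat -> C) (l : C) :
  climit u l -> climit (fun n => Cmult c (u n)) (Cmult c l).
Proof. apply climit_mult, climit_const. Qed.

Lemma climit_subseq (p : nat -> nat) (u : nat -> C) (l : C) :
  (forall n, (n <= p n)%nat) -> climit u l -> climit (fun n => u (p n)) l.
Proof.
  intros Hp H eps He. destruct (H eps He) as [N HN]. exists N. intros n Hn.
  apply HN. specialize (Hp n). lia.
Qed.

Lemma climit_squeeze (u : nat -> C) (l : C) (b : nat -> R) :
  (forall n, Cmod (Cminus (u n) l) <= b n) -> is_lim_seq b 0 -> climit u l.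
Proof.
  intros H Hb eps He. apply is_lim_seq_spec in Hb.
  destruct (Hb (mkposreal eps He)) as [N HN]. exists N. intros n Hn.
  specialize (HN n Hn). simpl in HN. rewrite Rminus_0_r in HN.
  eapply Rle_lt_trans; [apply H|]. eapply Rle_lt_trans; [apply Rle_abs|exact HN].
Qed.

Lemma climit_csum (f : nat -> nat -> C) (g : nat -> C) (M : nat) :
  (forall m, climit (fun n => f n m) (g m)) ->
  climit (fun n => csum (f n) M) (csum g M).
Proof.
  intros H. induction M as [|M IH]; simpl; [apply climit_const|].
  apply climit_plus; [exact IH|apply H].
Qed.

(** * Absolutely convergent series and dominated convergence *)

Definition asum (f : nat -> C) : Prop := ex_series (fun n => Cmod (f n)).

Lemma asum_le (f : nat -> C) (b : nat -> R) :
  (forall n, Cmod (f n) <= b n) -> ex_series b -> asum f.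
Proof.
  intros H Hb. apply (ex_series_le (V := R_CompleteNormedModule) _ b); [|exact Hb].
  intros n. unfold norm; simpl. unfold abs; simpl. rewrite Rabs_pos_eq by apply Cmod_ge_0. apply H.
Qed.

Lemma asum_Re (f : nat -> C) : asum f -> ex_series (fun n => Re (f n)).
Proof.
  intros H. apply (ex_series_le (V := R_CompleteNormedModule) _ (fun n => Cmod (f n))); [|exact H].
  intros n. apply re_le_Cmod.
Qed.

Lemma im_le_Cmod (c : C) : Rabs (Im c) <= Cmod c.
Proof. eapply Rle_trans; [apply Rmax_r|apply (Rmax_Cmod c)]. Qed.

Lemma asum_Im (f : nat -> C) : asum f -> ex_series (fun n => Im (f n)).
Proof.
  intros H. apply (ex_series_le (V := R_CompleteNormedModule) _ (fun n => Cmod (f n))); [|exact H].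
  intros n. apply im_le_Cmod.
Qed.

Lemma Cmod_le_Re_Im (c : C) : Cmod c <= Rabs (Re c) + Rabs (Im c).
Proof.
  assert (Hc : c = Cplus (RtoC (Re c)) (Cmult Ci (RtoC (Im c)))).
  { destruct c as [x y]. unfold Cplus, Cmult, Ci, RtoC, Re, Im; simpl. f_equal; ring. }
  rewrite Hc at 1. eapply Rle_trans; [apply Cmod_triangle|].
  rewrite Cmod_mult, Cmod_Ci, !Cmod_R. lra.
Qed.

Lemma climit_Re_Im (u : nat -> C) (l : C) :
  is_lim_seq (fun n => Re (u n)) (Re l) -> is_lim_seq (fun n => Im (u n)) (Im l) -> climit u l.
Proof.
  intros H1 H2.
  apply (climit_squeeze _ _ (fun n => Rabs (Re (u n) - Re l) + Rabs (Im (u n) - Im l))).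
  - intros n. eapply Rle_trans; [apply Cmod_le_Re_Im|]. apply Rle_refl.
  - replace (Finite 0) with (Rbar_plus (Rabs (Re l - Re l)) (Rabs (Im l - Im l))).
    + apply (is_lim_seq_plus _ _ (Rabs (Re l - Re l)) (Rabs (Im l - Im l))); [| |reflexivity].
      * apply (is_lim_seq_abs _ (Finite (Re l - Re l))).
        apply is_lim_seq_minus'; [exact H1|apply is_lim_seq_const].
      * apply (is_lim_seq_abs _ (Finite (Im l - Im l))).
        apply is_lim_seq_minus'; [exact H2|apply is_lim_seq_const].
    + simpl. rewrite !Rminus_diag, Rabs_R0. f_equal; ring.
Qed.

Lemma rsum_Series (f : nat -> R) : ex_series f -> is_lim_seq (rsum f) (Series f).
Proof.
  intros H. apply is_lim_seq_incr_1.
  apply is_lim_seq_ext with (sum_n f); [intros n; symmetry; apply rsum_sum_n|].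
  apply Series_correct in H. exact H.
Qed.

Lemma climit_CSeries (f : nat -> C) : asum f -> climit (csum f) (CSeries f).
Proof.
  intros H. apply climit_Re_Im; simpl.
  - eapply is_lim_seq_ext; [|apply rsum_Series, asum_Re, H].
    intros n. rewrite csum_Re_Im. reflexivity.
  - eapply is_lim_seq_ext; [|apply rsum_Series, asum_Im, H].
    intros n. rewrite csum_Re_Im. reflexivity.
Qed.

(** [Series] is total and has a meaningless value on a divergent input, so every manipulation of
    [CSeries] goes through [asum] and this identification of its value. *)
Lemma CSeries_unique (f : nat -> C) (l : C) : asum f -> climit (csum f) l -> CSeries f = l.
Proof. intros H Hl. eapply climit_unique; [apply climit_CSeries, H|exact Hl]. Qed.

Lemma CSeries_ext (f g : nat -> C) : (forall n, f n = g n) -> CSeries f = CSeries g.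
Proof. intros H. unfold CSeries. f_equal; apply Series_ext; intros n; rewrite H; reflexivity. Qed.

Lemma asum_ext (f g : nat -> C) : (forall n, f n = g n) -> asum f -> asum g.
Proof. intros H. apply ex_series_ext. intros n; rewrite H; reflexivity. Qed.

Lemma asum_plus (f g : nat -> C) : asum f -> asum g -> asum (fun n => Cplus (f n) (g n)).
Proof.
  intros Hf Hg. apply (asum_le _ (fun n => Cmod (f n) + Cmod (g n))).
  - intros n; apply Cmod_triangle.
  - apply (ex_series_plus (V := R_NormedModule)); assumption.
Qed.

Lemma asum_scal (c : C) (f : nat -> C) : asum f -> asum (fun n => Cmult c (f n)).
Proof.
  intros Hf. apply (asum_le _ (fun n => Cmod c * Cmod (f n))).
  - intros n; rewrite Cmod_mult; lra.
  - apply (ex_series_scal_l (V := R_NormedModule)); assumption.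
Qed.

Lemma CSeries_plus (f g : nat -> C) : asum f -> asum g ->
  CSeries (fun n => Cplus (f n) (g n)) = Cplus (CSeries f) (CSeries g).
Proof.
  intros Hf Hg. apply CSeries_unique; [apply asum_plus; assumption|].
  eapply climit_ext; [intros n; symmetry; apply csum_plus|].
  apply climit_plus; apply climit_CSeries; assumption.
Qed.

Lemma CSeries_scal (c : C) (f : nat -> C) : asum f ->
  CSeries (fun n => Cmult c (f n)) = Cmult c (CSeries f).
Proof.
  intros Hf. apply CSeries_unique; [apply asum_scal; assumption|].
  eapply climit_ext; [intros n; symmetry; apply csum_scal|].
  apply climit_scal, climit_CSeries; assumption.
Qed.

Lemma Rle_rsum_Series (b : nat -> R) (N : nat) :
  (forall n, 0 <= b n) -> ex_series b -> rsum b N <= Series b.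
Proof.
  intros Hb He.
  apply (is_lim_seq_incr_compare (rsum b)).
  - apply rsum_Series, He.
  - intros n. simpl. specialize (Hb n). lra.
Qed.

Lemma Cmod_climit_le (u : nat -> C) (l : C) (B : R) :
  climit u l -> (forall n, Cmod (u n) <= B) -> Cmod l <= B.
Proof.
  intros H HB. apply Rnot_lt_le. intros Hlt.
  destruct (H (Cmod l - B) ltac:(lra)) as [N HN]. specialize (HN N ltac:(lia)). specialize (HB N).
  assert (Cmod l <= Cmod (u N) + Cmod (Cminus (u N) l)).
  { rewrite <- (Cmod_opp (Cminus _ _)).
    replace l with (Cplus (u N) (Copp (Cminus (u N) l))) at 1 by ring. apply Cmod_triangle. }
  lra.
Qed.

Lemma Cmod_CSeries_le (f : nat -> C) (b : nat -> R) :
  (forall n, Cmod (f n) <= b n) -> ex_series b -> Cmod (CSeries f) <= Series b.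
Proof.
  intros H Hb. eapply Cmod_climit_le.
  - apply climit_CSeries. eapply asum_le; eassumption.
  - intros N. eapply Rle_trans; [apply Cmod_csum, H|].
    apply Rle_rsum_Series; [|exact Hb]. intros n. eapply Rle_trans; [apply Cmod_ge_0|apply H].
Qed.

Lemma csum_add (f : nat -> C) (M N : nat) :
  csum f (M + N) = Cplus (csum f M) (csum (fun n => f (M + n)%nat) N).
Proof.
  induction N as [|N IH]; simpl.
  - rewrite Nat.add_0_r. ring.
  - rewrite Nat.add_succ_r. simpl. rewrite IH. ring.
Qed.

Lemma CSeries_split (f : nat -> C) (M : nat) : asum f ->
  CSeries f = Cplus (csum f M) (CSeries (fun n => f (M + n)%nat)).
Proof.
  intros H. apply CSeries_unique; [exact H|].
  assert (Hs : asum (fun n => f (M + n)%nat)).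
  { apply (ex_series_incr_n (V := R_NormedModule) (fun n => Cmod (f n))). exact H. }
  assert (L := climit_plus _ _ _ _ (climit_const (csum f M)) (climit_CSeries _ Hs)).
  intros eps He. destruct (L eps He) as [N HN]. exists (M + N)%nat. intros n Hn.
  replace n with (M + (n - M))%nat by lia. rewrite csum_add. apply HN. lia.
Qed.

Lemma Series_tail_small (b : nat -> R) (eps : R) : ex_series b -> 0 < eps ->
  exists M, Series (fun n => b (M + n)%nat) < eps.
Proof.
  intros Hb He. assert (L := rsum_Series b Hb). apply is_lim_seq_spec in L.
  destruct (L (mkposreal eps He)) as [N HN]. specialize (HN (S N) ltac:(lia)). simpl in HN.
  exists (S N).
  assert (E : Series b = rsum b (S N) + Series (fun n => b (S N + n)%nat)).
  { rewrite (Series_incr_n b (S N)) by (lia || exact Hb). f_equal.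
    rewrite rsum_sum_n, sum_n_Reals. reflexivity. }
  apply Rabs_def2 in HN. simpl in E |- *. simpl in HN. lra.
Qed.

(** Dominated convergence. Summability of the limit comes along because its terms inherit the bound
    [b]. *)
Lemma tannery (f : nat -> nat -> C) (g : nat -> C) (b : nat -> R) :
  ex_series b ->
  (forall N n, Cmod (f N n) <= b n) ->
  (forall n, climit (fun N => f N n) (g n)) ->
  asum g /\ climit (fun N => CSeries (f N)) (CSeries g).
Proof.
  intros Hb Hf Hg.
  assert (Hgb : forall n, Cmod (g n) <= b n).
  { intros n. eapply Cmod_climit_le; [apply Hg|]. intros N; apply Hf. }
  assert (Ag : asum g) by (eapply asum_le; eassumption).
  split; [exact Ag|].
  intros eps He.
  (* The budget is eps/2 for the first M terms, by termwise convergence, and eps/4 for each of the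
     two tails, by domination. *)
  destruct (Series_tail_small b (eps/4) Hb ltac:(lra)) as [M HM].
  destruct (climit_csum f g M Hg (eps/2) ltac:(lra)) as [N HN].
  exists N. intros n Hn. specialize (HN n Hn).
  rewrite (CSeries_split g M Ag).
  rewrite (CSeries_split (f n) M) by (eapply asum_le; [apply Hf|exact Hb]).
  assert (Hbt : ex_series (fun n => b (M + n)%nat)).
  { apply (ex_series_incr_n (V := R_NormedModule)). exact Hb. }
  assert (T1 : Cmod (CSeries (fun k => f n (M + k)%nat)) <= eps/4).
  { eapply Rle_trans; [apply Cmod_CSeries_le with (b := fun k => b (M + k)%nat)|]; [|exact Hbt|lra].
    intros k; apply Hf. }
  assert (T2 : Cmod (CSeries (fun k => g (M + k)%nat)) <= eps/4).
  { eapply Rle_trans; [apply Cmod_CSeries_le with (b := fun k => b (M + k)%nat)|]; [|exact Hbt|lra].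
    intros k; apply Hgb. }
  set (a := csum (f n) M) in *. set (c := csum g M) in *.
  set (a' := CSeries (fun k => f n (M + k)%nat)) in *. set (c' := CSeries (fun k => g (M + k)%nat)) in *.
  replace (Cminus (Cplus a a') (Cplus c c')) with (Cplus (Cminus a c) (Cplus a' (Copp c'))) by ring.
  eapply Rle_lt_trans; [apply Cmod_triangle|].
  assert (T3 := Cmod_triangle a' (Copp c')). rewrite Cmod_opp in T3. lra.
Qed.

(** * Series over the integers *)

(** Reference decay for series over Z: theta terms are Gaussian, so this single rate serves
    everywhere. *)
Definition ez (n : Z) : R := exp (- IZR (Z.abs n)).

Lemma ez_pos (n : Z) : 0 < ez n.
Proof. apply exp_pos. Qed.

Definition decZ (f : Z -> C) : Prop := exists K, forall n, Cmod (f n) <= K * ez n.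

Lemma exp_le (x y : R) : x <= y -> exp x <= exp y.
Proof. intros [H|H]; [left; apply exp_increasing, H|rewrite H; lra]. Qed.

Lemma decZ_nonneg (f : Z -> C) (K : R) :
  (forall n, Cmod (f n) <= K * ez n) -> 0 <= K.
Proof.
  intros H. specialize (H 0%Z). assert (0 < ez 0) by apply ez_pos.
  assert (0 <= Cmod (f 0%Z)) by apply Cmod_ge_0.
  apply Rnot_lt_le; intros Hk. assert (K * ez 0 < 0) by nra. lra.
Qed.

Lemma decZ_ext (f g : Z -> C) : (forall n, f n = g n) -> decZ f -> decZ g.
Proof. intros E [K HK]. exists K. intros n. rewrite <- E. apply HK. Qed.

Lemma decZ_plus (f g : Z -> C) : decZ f -> decZ g -> decZ (fun n => Cplus (f n) (g n)).
Proof.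
  intros [K HK] [L HL]. exists (K + L). intros n.
  eapply Rle_trans; [apply Cmod_triangle|]. specialize (HK n). specialize (HL n). lra.
Qed.

Lemma decZ_scal (c : C) (f : Z -> C) : decZ f -> decZ (fun n => Cmult c (f n)).
Proof.
  intros [K HK]. exists (Cmod c * K). intros n. rewrite Cmod_mult, Rmult_assoc.
  apply Rmult_le_compat_l; [apply Cmod_ge_0|apply HK].
Qed.

(** The growth condition on [p] covers shifts, reflections and n -> 2n, 2n + 1 at once; [k] is paid
    for by a factor e^k in the constant. *)
Lemma decZ_reindex (p : Z -> Z) (k : Z) (f : Z -> C) :
  (forall n, (Z.abs n <= Z.abs (p n) + k)%Z) -> decZ f -> decZ (fun n => f (p n)).
Proof.
  intros Hp [K HK]. assert (HK0 := decZ_nonneg _ _ HK). exists (K * exp (IZR k)). intros n.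
  eapply Rle_trans; [apply HK|]. rewrite Rmult_assoc. apply Rmult_le_compat_l; [exact HK0|].
  unfold ez. rewrite <- exp_plus. apply exp_le. specialize (Hp n). apply IZR_le in Hp.
  rewrite plus_IZR in Hp. lra.
Qed.

Lemma ex_series_exp_neg (K : R) : ex_series (fun n => K * exp (- INR n)).
Proof.
  apply (ex_series_scal_l (V := R_NormedModule)).
  apply (ex_series_ext (fun n => exp (-1) ^ n)).
  - intros n. induction n as [|n IH]; [simpl; rewrite Ropp_0, exp_0; reflexivity|].
    rewrite S_INR. simpl. rewrite IH, <- exp_plus. f_equal; ring.
  - apply ex_series_geom. rewrite Rabs_pos_eq by (left; apply exp_pos).
    rewrite <- exp_0. apply exp_increasing. lra.
Qed.

Lemma decZ_bound_pos (f : Z -> C) (K : R) : (forall n, Cmod (f n) <= K * ez n) ->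
  forall n, Cmod (f (Z.of_nat n)) <= K * exp (- INR n).
Proof.
  intros H n. eapply Rle_trans; [apply H|]. unfold ez. rewrite INR_IZR_INZ.
  replace (Z.abs (Z.of_nat n)) with (Z.of_nat n) by lia. lra.
Qed.

Lemma decZ_bound_neg (f : Z -> C) (K : R) : (forall n, Cmod (f n) <= K * ez n) ->
  forall n, Cmod (f (- Z.of_nat n - 1)%Z) <= K * exp (- INR n).
Proof.
  intros H n. eapply Rle_trans; [apply H|]. apply Rmult_le_compat_l; [apply (decZ_nonneg _ _ H)|].
  unfold ez. rewrite INR_IZR_INZ. apply exp_le. apply Ropp_le_contravar, IZR_le. lia.
Qed.

Lemma decZ_asum_pos (f : Z -> C) : decZ f -> asum (fun n => f (Z.of_nat n)).
Proof.
  intros [K HK]. eapply asum_le; [|apply (ex_series_exp_neg K)]. apply decZ_bound_pos, HK.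
Qed.

Lemma decZ_asum_neg (f : Z -> C) : decZ f -> asum (fun n => f (- Z.of_nat n - 1)%Z).
Proof.
  intros [K HK]. eapply asum_le; [|apply (ex_series_exp_neg K)]. apply decZ_bound_neg, HK.
Qed.

(** The partial sum over -N, ..., N - 1. Pairing n with -n - 1 respects the symmetry of the
    half-integers n + 1/2. *)
Definition zsum (f : Z -> C) (N : nat) : C :=
  csum (fun n => Cplus (f (Z.of_nat n)) (f (- Z.of_nat n - 1)%Z)) N.

Lemma climit_CSeriesZ (f : Z -> C) : decZ f -> climit (zsum f) (CSeriesZ f).
Proof.
  intros H. unfold zsum, CSeriesZ.
  eapply climit_ext; [intros n; symmetry; apply csum_plus|].
  apply climit_plus; apply climit_CSeries; [apply decZ_asum_pos|apply decZ_asum_neg]; exact H.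
Qed.

Lemma CSeriesZ_unique (f : Z -> C) (l : C) : decZ f -> climit (zsum f) l -> CSeriesZ f = l.
Proof. intros H Hl. eapply climit_unique; [apply climit_CSeriesZ, H|exact Hl]. Qed.

Lemma CSeriesZ_ext (f g : Z -> C) : (forall n, f n = g n) -> CSeriesZ f = CSeriesZ g.
Proof. intros H. unfold CSeriesZ. f_equal; apply CSeries_ext; intros n; apply H. Qed.

Lemma CSeriesZ_plus (f g : Z -> C) : decZ f -> decZ g ->
  CSeriesZ (fun n => Cplus (f n) (g n)) = Cplus (CSeriesZ f) (CSeriesZ g).
Proof.
  intros Hf Hg. unfold CSeriesZ.
  rewrite (CSeries_plus (fun n => f (Z.of_nat n)) (fun n => g (Z.of_nat n)))
    by (apply decZ_asum_pos; assumption).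
  rewrite (CSeries_plus (fun n => f (- Z.of_nat n - 1)%Z) (fun n => g (- Z.of_nat n - 1)%Z))
    by (apply decZ_asum_neg; assumption).
  ring.
Qed.

Lemma CSeriesZ_scal (c : C) (f : Z -> C) : decZ f ->
  CSeriesZ (fun n => Cmult c (f n)) = Cmult c (CSeriesZ f).
Proof.
  intros Hf. unfold CSeriesZ.
  rewrite (CSeries_scal c (fun n => f (Z.of_nat n))) by (apply decZ_asum_pos; assumption).
  rewrite (CSeries_scal c (fun n => f (- Z.of_nat n - 1)%Z)) by (apply decZ_asum_neg; assumption).
  ring.
Qed.

Lemma Cmod_CSeriesZ_le (f : Z -> C) (K : R) : (forall n, Cmod (f n) <= K * ez n) ->
  Cmod (CSeriesZ f) <= K * (2 * Series (fun n => exp (- INR n))).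
Proof.
  intros H. unfold CSeriesZ. eapply Rle_trans; [apply Cmod_triangle|].
  assert (H1 := Cmod_CSeries_le _ _ (decZ_bound_pos f K H) (ex_series_exp_neg K)).
  assert (H2 := Cmod_CSeries_le _ _ (decZ_bound_neg f K H) (ex_series_exp_neg K)).
  rewrite Series_scal_l in H1, H2. lra.
Qed.

Lemma tanneryZ (f : nat -> Z -> C) (g : Z -> C) (K : R) :
  (forall N n, Cmod (f N n) <= K * ez n) ->
  (forall n, climit (fun N => f N n) (g n)) ->
  climit (fun N => CSeriesZ (f N)) (CSeriesZ g).
Proof.
  intros Hf Hg. unfold CSeriesZ. apply climit_plus.
  - apply (tannery _ _ (fun n => K * exp (- INR n))).
    + apply ex_series_exp_neg.
    + intros N. apply decZ_bound_pos, Hf.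
    + intros n. apply Hg.
  - apply (tannery (fun N n => f N (- Z.of_nat n - 1)%Z) _ (fun n => K * exp (- INR n))).
    + apply ex_series_exp_neg.
    + intros N. apply decZ_bound_neg, Hf.
    + intros n. apply Hg.
Qed.

Lemma CSeriesZ_reflect (f : Z -> C) : CSeriesZ (fun n => f (- n - 1)%Z) = CSeriesZ f.
Proof.
  unfold CSeriesZ. rewrite Cplus_comm. f_equal; apply CSeries_ext; intros n; f_equal; lia.
Qed.

Lemma climit_exp_neg (f : nat -> C) (K : R) :
  (forall n, Cmod (f n) <= K * exp (- INR n)) -> climit f 0.
Proof.
  intros H. apply (climit_squeeze _ _ (fun n => K * exp (- INR n))).
  - intros n. replace (Cminus (f n) 0) with (f n) by ring. apply H.
  - apply (ex_series_lim_0 (fun n => K * exp (- INR n))). apply ex_series_exp_neg.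
Qed.

(** A shift by one moves the window -N, ..., N - 1 so that it gains f(N) and loses f(-N). *)
Lemma zsum_succ (f : Z -> C) (N : nat) :
  zsum (fun n => f (n + 1)%Z) N = Cplus (zsum f N) (Cminus (f (Z.of_nat N)) (f (- Z.of_nat N)%Z)).
Proof.
  unfold zsum. induction N as [|N IH].
  - simpl. ring.
  - simpl csum. rewrite IH.
    replace (- Z.of_nat N - 1 + 1)%Z with (- Z.of_nat N)%Z by lia.
    replace (Z.of_nat (S N)) with (Z.of_nat N + 1)%Z by lia.
    replace (- (Z.of_nat N + 1))%Z with (- Z.of_nat N - 1)%Z by lia. ring.
Qed.

Lemma CSeriesZ_succ (f : Z -> C) : decZ f -> CSeriesZ (fun n => f (n + 1)%Z) = CSeriesZ f.
Proof.
  intros H. apply CSeriesZ_unique.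
  - apply (decZ_reindex (fun n => n + 1)%Z 1 f); [intros; lia|exact H].
  - eapply climit_ext; [intros n; symmetry; apply zsum_succ|].
    destruct H as [K HK].
    replace (CSeriesZ f) with (Cplus (CSeriesZ f) (Cplus 0 (Cmult (-1) 0))) by ring.
    apply climit_plus; [apply climit_CSeriesZ; exists K; exact HK|].
    eapply climit_ext with (u := fun n => Cplus (f (Z.of_nat n)) (Cmult (-1) (f (- Z.of_nat n)%Z))).
    { intros n. simpl. ring. }
    apply climit_plus; [|apply climit_scal]; apply (climit_exp_neg _ K).
    + apply decZ_bound_pos, HK.
    + intros n. eapply Rle_trans; [apply HK|]. unfold ez. rewrite INR_IZR_INZ.
      replace (Z.abs (- Z.of_nat n)) with (Z.of_nat n) by lia. lra.
Qed.

Lemma CSeriesZ_shift (k : Z) (f : Z -> C) : decZ f -> CSeriesZ (fun n => f (n + k)%Z) = CSeriesZ f.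
Proof.
  intros H.
  assert (P : forall m f, decZ f -> CSeriesZ (fun n => f (n + Z.of_nat m)%Z) = CSeriesZ f).
  { intros m. induction m as [|m IH]; intros g Hg.
    - apply CSeriesZ_ext. intros n. f_equal; lia.
    - rewrite <- (CSeriesZ_succ g Hg), <- (IH (fun n => g (n + 1)%Z)).
      + apply CSeriesZ_ext. intros n. f_equal; lia.
      + apply (decZ_reindex (fun n => n + 1)%Z 1 g); [intros; lia|exact Hg]. }
  destruct (Z_le_gt_dec 0 k) as [Hk|Hk].
  - rewrite <- (P (Z.to_nat k) f H). apply CSeriesZ_ext. intros n. f_equal; lia.
  (* For negative k the natural shift by -k is applied to the shifted function, which undoes the
     shift. *)
  - rewrite <- (P (Z.to_nat (- k)) (fun n => f (n + k)%Z)).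
    + apply CSeriesZ_ext. intros n. f_equal; lia.
    + apply (decZ_reindex (fun n => n + k)%Z (Z.abs k) f); [intros; lia|exact H].
Qed.

Lemma CSeriesZ_sub (k : Z) (f : Z -> C) : decZ f -> CSeriesZ (fun n => f (k - n)%Z) = CSeriesZ f.
Proof.
  intros H. rewrite <- (CSeriesZ_shift (k + 1) f H), <- (CSeriesZ_reflect (fun n => f (n + (k + 1))%Z)).
  apply CSeriesZ_ext. intros n. f_equal; lia.
Qed.

(** The window -2N, ..., 2N - 1 consists exactly of the numbers 2n and 2n + 1 with n in -N, ..., N -
    1. *)
Lemma CSeriesZ_parity (f : Z -> C) : decZ f ->
  CSeriesZ f = Cplus (CSeriesZ (fun n => f (2 * n)%Z)) (CSeriesZ (fun n => f (2 * n + 1)%Z)).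
Proof.
  intros H. apply (climit_unique (fun N => zsum f (2 * N))).
  - apply (climit_subseq (fun N => 2 * N)%nat (zsum f)); [intros; lia|apply climit_CSeriesZ, H].
  - eapply climit_ext with (u := fun N => Cplus (zsum (fun n => f (2 * n)%Z) N) (zsum
    (fun n => f (2 * n + 1)%Z) N)).
    + intros N. unfold zsum. rewrite <- csum_plus. induction N as [|N IH]; [reflexivity|].
      replace (2 * S N)%nat with (S (S (2 * N))) by lia. cbn [csum]. rewrite IH.
      replace (2 * (- Z.of_nat N - 1))%Z with (- Z.of_nat (S (2 * N)) - 1)%Z by lia.
      replace (- Z.of_nat (S (2 * N)) - 1 + 1)%Z with (- Z.of_nat (2 * N) - 1)%Z by lia.
      replace (2 * Z.of_nat N)%Z with (Z.of_nat (2 * N)) by lia.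
      replace (Z.of_nat (2 * N) + 1)%Z with (Z.of_nat (S (2 * N))) by lia.
      ring.
    + apply climit_plus; apply climit_CSeriesZ.
      * apply (decZ_reindex (fun n => 2 * n)%Z 0 f); [intros; lia|exact H].
      * apply (decZ_reindex (fun n => 2 * n + 1)%Z 1 f); [intros; lia|exact H].
Qed.

Lemma CSeriesZ_0 : CSeriesZ (fun _ => 0) = 0.
Proof.
  rewrite <- (CSeriesZ_ext (fun n => Cmult 0 0)) by (intros; ring).
  rewrite (CSeriesZ_scal 0 (fun _ => 0)). ring.
  exists 1. intros n. rewrite Cmod_0. assert (H := ez_pos n). lra.
Qed.

Lemma csum_CSeriesZ (f : nat -> Z -> C) (M : nat) : (forall m, decZ (f m)) ->
  decZ (fun s => csum (fun m => f m s) M) /\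
  csum (fun m => CSeriesZ (f m)) M = CSeriesZ (fun s => csum (fun m => f m s) M).
Proof.
  intros H. induction M as [|M [IH1 IH2]]; simpl.
  - split; [|rewrite CSeriesZ_0; reflexivity].
    exists 1. intros n. rewrite Cmod_0. assert (H' := ez_pos n). lra.
  - split; [apply decZ_plus; [exact IH1|apply H]|].
    rewrite (CSeriesZ_plus (fun s => csum (fun m => f m s) M) (f M)) by (exact IH1 || apply H).
    rewrite IH2. reflexivity.
Qed.

(** * Complex derivatives *)

Definition cder (f : C -> C) (z l : C) : Prop :=
  @is_derive C_AbsRing (AbsRing_NormedModule C_AbsRing) f z l.

(** [cder] uses the normed module for which the product rule is stated, [C_derive] another structure
    on C with the same operations; the fields are therefore taken apart and rebuilt. *)
Lemma cder_unique (f : C -> C) (z l : C) : cder f z l -> C_derive f z = l.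
Proof.
  intros [[Ha Hb Hc] H2]. apply is_C_derive_unique. split.
  - split; [exact Ha|exact Hb|exact Hc].
  - intros x Hx eps. exact (H2 x Hx eps).
Qed.

Lemma cder_intro (f : C -> C) (z l : C) :
  (forall eps, 0 < eps -> exists d, 0 < d /\ forall h, Cmod h < d ->
     Cmod (Cminus (Cminus (f (Cplus z h)) (f z)) (Cmult l h)) <= eps * Cmod h) ->
  cder f z l.
Proof.
  intros H. split; [apply is_linear_scal_l|].
  intros x Hx eps.
  assert (E := @is_filter_lim_locally_unique _ (AbsRing_NormedModule C_AbsRing) z x Hx). subst x.
  destruct (H eps (cond_pos eps)) as [d [Hd H']]. exists (mkposreal d Hd). intros y Hy.
  change (Cmod (Cminus y z) < d) in Hy. specialize (H' _ Hy).
  assert (E : Cplus z (Cminus y z) = y) by (change C in y; ring). rewrite E in H'.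
  rewrite Cmult_comm in H'. exact H'.
Qed.

Lemma cder_ext_loc (f g : C -> C) (z l : C) (d : R) :
  0 < d -> (forall y, Cmod (Cminus y z) < d -> f y = g y) -> cder f z l -> cder g z l.
Proof.
  intros Hd H. apply is_derive_ext_loc. exists (mkposreal d Hd). intros y Hy. apply H. exact Hy.
Qed.

Lemma cder_ext (f g : C -> C) (z l : C) : (forall y, f y = g y) -> cder f z l -> cder g z l.
Proof. intros H. apply (cder_ext_loc f g z l 1); [lra|intros; apply H]. Qed.

Lemma cder_plus (f g : C -> C) (z l m : C) :
  cder f z l -> cder g z m -> cder (fun y => Cplus (f y) (g y)) z (Cplus l m).
Proof. apply (@is_derive_plus C_AbsRing (AbsRing_NormedModule C_AbsRing)). Qed.

Lemma cder_mult (f g : C -> C) (z l m : C) :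
  cder f z l -> cder g z m ->
  cder (fun y => Cmult (f y) (g y)) z (Cplus (Cmult l (g z)) (Cmult (f z) m)).
Proof.
  intros H1 H2. apply (@is_derive_mult C_AbsRing f g z l m H1 H2). apply Cmult_comm.
Qed.

Lemma cder_const (c z : C) : cder (fun _ => c) z 0.
Proof. apply (@is_derive_const C_AbsRing (AbsRing_NormedModule C_AbsRing)). Qed.

(** * First-order Taylor bounds for the complex exponential *)

Lemma Rabs_sin_le (y : R) : Rabs (sin y) <= Rabs y.
Proof.
  assert (H := bounded_variation sin cos 1 0 y).
  rewrite sin_0, !Rminus_0_r, Rmult_1_l in H. apply H. intros t _. split.
  - auto_derive; [exact I|ring].
  - apply Rabs_le. apply COS_bound.
Qed.

Lemma Rabs_cos_sub_1 (y : R) : Rabs (cos y - 1) <= Rabs y /\ Rabs (cos y - 1) <= y * y.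
Proof.
  assert (E : cos y - 1 = - 2 * (sin (y/2) * sin (y/2))).
  { replace y with (2 * (y/2)) at 1 by field. rewrite cos_2a_sin. ring. }
  assert (S := Rabs_sin_le (y/2)). assert (B := SIN_bound (y/2)). apply Rabs_le in B.
  assert (P := Rabs_pos (sin (y/2))).
  assert (Y : Rabs (y/2) = Rabs y / 2).
  { unfold Rdiv. rewrite Rabs_mult, (Rabs_pos_eq (/2)); lra. }
  rewrite Y in S.
  rewrite E, !Rabs_mult, (Rabs_left (-2)) by lra. split.
  - nra.
  - assert (Rabs y * Rabs y = y * y) by (rewrite <- Rabs_mult; apply Rabs_pos_eq; nra). nra.
Qed.

Lemma Rabs_sin_sub_id (y : R) : Rabs (sin y - y) <= y * y.
Proof.
  assert (H := bounded_variation (fun t => sin t - t) (fun t => cos t - 1) (Rabs y) 0 y).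
  simpl in H. rewrite sin_0, !Rminus_0_r in H.
  replace (Rabs y * Rabs y) with (y * y) in H
    by (rewrite <- Rabs_mult; symmetry; apply Rabs_pos_eq; nra).
  apply H. intros t Ht. split.
  - auto_derive; [exact I|ring].
  - rewrite !Rminus_0_r in Ht. eapply Rle_trans; [apply (proj1 (Rabs_cos_sub_1 t))|exact Ht].
Qed.

Lemma exp_taylor_1 (x : R) : 0 <= exp x - 1 - x <= x * x * exp (Rabs x).
Proof.
  assert (H1 := exp_ineq1_le x). assert (H2 := exp_ineq1_le (- x)).
  assert (Hx := exp_pos x).
  assert (H3 : exp x * exp (- x) = 1) by (rewrite <- exp_plus, Rplus_opp_r; apply exp_0).
  assert (H4 : exp x - 1 <= x * exp x) by nra.
  split; [lra|].
  destruct (Rle_lt_dec 0 x) as [P|P].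
  - rewrite Rabs_pos_eq by exact P. nra.
  - rewrite Rabs_left by exact P. assert (1 <= exp (- x)) by lra.
    assert (exp x - 1 - x <= x * x) by nra. nra.
Qed.

(** The constant is generous: the square yields differentiability, and Gaussian decay later absorbs
    the exponential. *)
Lemma cexp_taylor_1 (w : C) :
  Cmod (Cminus (Cminus (cexp w) 1) w) <= 8 * (Cmod w * Cmod w) * exp (Cmod w).
Proof.
  destruct w as [x y]. set (w := (x, y)). set (M := Cmod w).
  assert (Hx : Rabs x <= M) by (apply (re_le_Cmod w)).
  assert (Hy : Rabs y <= M) by (apply (im_le_Cmod w)).
  assert (Hxx : x * x <= M * M).
  { replace (x * x) with (Rabs x * Rabs x) by (rewrite <- Rabs_mult; apply Rabs_pos_eq; nra).
    assert (P := Rabs_pos x). nra. }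
  assert (Hyy : y * y <= M * M).
  { replace (y * y) with (Rabs y * Rabs y) by (rewrite <- Rabs_mult; apply Rabs_pos_eq; nra).
    assert (P := Rabs_pos y). nra. }
  assert (HM : 0 <= M) by apply Cmod_ge_0.
  assert (HE : exp (Rabs x) <= exp M) by (apply exp_le, Hx).
  assert (H1 : 1 <= exp M). { rewrite <- exp_0. apply exp_le, HM. }
  destruct (exp_taylor_1 x) as [T0 T1].
  destruct (Rabs_cos_sub_1 y) as [C1 C2]. assert (S1 := Rabs_sin_le y). assert (S2 := Rabs_sin_sub_id y).
  assert (E : Cminus (Cminus (cexp w) 1) w =
     ((exp x - 1 - x) * cos y + (1 + x) * (cos y - 1), (exp x - 1 - x) * sin y + x * sin y + (sin y - y))).
  { unfold w, cexp, Cminus, Cplus, Copp, RtoC, Re, Im. simpl. f_equal; ring. }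
  rewrite E. eapply Rle_trans; [apply Cmod_le_Re_Im|]. simpl Re; simpl Im.
  assert (Bc := COS_bound y). assert (Bs := SIN_bound y). apply Rabs_le in Bc, Bs.
  assert (U : Rabs (exp x - 1 - x) <= M * M * exp M).
  { rewrite Rabs_pos_eq by exact T0. eapply Rle_trans; [exact T1|].
    apply Rmult_le_compat; try nra. left; apply exp_pos. }
  assert (V1 : Rabs ((exp x - 1 - x) * cos y) <= M * M * exp M).
  { rewrite Rabs_mult. assert (P := Rabs_pos (exp x - 1 - x)). assert (P' := Rabs_pos (cos y)). nra. }
  assert (V2 : Rabs ((exp x - 1 - x) * sin y) <= M * M * exp M).
  { rewrite Rabs_mult. assert (P := Rabs_pos (exp x - 1 - x)). assert (P' := Rabs_pos (sin y)). nra. }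
  assert (V3 : Rabs ((1 + x) * (cos y - 1)) <= 2 * (M * M)).
  { replace ((1 + x) * (cos y - 1)) with ((cos y - 1) + x * (cos y - 1)) by ring.
    eapply Rle_trans; [apply Rabs_triang|]. rewrite Rabs_mult.
    assert (P := Rabs_pos x). assert (P' := Rabs_pos (cos y - 1)). assert (P'' := Rabs_pos y). nra. }
  assert (V4 : Rabs (x * sin y) <= M * M).
  { rewrite Rabs_mult. assert (P := Rabs_pos x). assert (P' := Rabs_pos (sin y)). nra. }
  assert (W1 := Rabs_triang ((exp x - 1 - x) * cos y) ((1 + x) * (cos y - 1))).
  assert (W2 := Rabs_triang ((exp x - 1 - x) * sin y + x * sin y) (sin y - y)).
  assert (W3 := Rabs_triang ((exp x - 1 - x) * sin y) (x * sin y)).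
  assert (0 <= M * M) by (apply Rmult_le_pos; exact HM). assert (0 <= M * M * (exp M - 1))
    by (apply Rmult_le_pos; lra). lra.
Qed.

Lemma cexp_plus (v w : C) : cexp (Cplus v w) = Cmult (cexp v) (cexp w).
Proof.
  destruct v as [a b], w as [c d]. unfold cexp, Cplus, Cmult, Re, Im; simpl.
  rewrite exp_plus, cos_plus, sin_plus. f_equal; ring.
Qed.

Lemma e2pi_plus (x y : C) : e2pi (Cplus x y) = Cmult (e2pi x) (e2pi y).
Proof. unfold e2pi. rewrite <- cexp_plus. f_equal. ring. Qed.

Lemma e2pi_0 : e2pi 0 = 1.
Proof.
  unfold e2pi. rewrite Cmult_0_r. unfold cexp, RtoC; simpl.
  rewrite exp_0, cos_0, sin_0. f_equal; ring.
Qed.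

Lemma Cmod_e2pi (x : C) : Cmod (e2pi x) = exp (- (2 * PI * Im x)).
Proof.
  unfold e2pi, cexp, Cmod. destruct x as [a b]. simpl.
  match goal with |- sqrt (exp ?a * cos ?b * _ + _) = _ => set (t := a); set (u := b) end.
  replace (exp t * cos u * (exp t * cos u * 1) + exp t * sin u * (exp t * sin u * 1))
    with (exp t * exp t * ((sin u)² + (cos u)²)) by (unfold Rsqr; ring).
  rewrite sin2_cos2, Rmult_1_r. rewrite sqrt_square by (left; apply exp_pos).
  unfold t. f_equal. ring.
Qed.

Lemma e2pi_neq_0 (x : C) : e2pi x <> 0.
Proof. intros H. apply (f_equal Cmod) in H. rewrite Cmod_e2pi, Cmod_0 in H.
generalize (exp_pos (- (2 * PI * Im x))). lra. Qed.

Lemma e2pi_taylor_1 (w : C) :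
  Cmod (Cminus (Cminus (e2pi w) 1) (Cmult twopii w)) <=
  8 * ((2 * PI * Cmod w) * (2 * PI * Cmod w)) * exp (2 * PI * Cmod w).
Proof.
  assert (E : Cmod (Cmult twopii w) = 2 * PI * Cmod w).
  { unfold twopii. rewrite !Cmod_mult, Cmod_Ci, Cmod_R, Rabs_pos_eq by (generalize PI_RGT_0; lra). ring. }
  rewrite <- E. apply cexp_taylor_1.
Qed.

(** Termwise differentiation: each exponential is expanded to first order at h = 0, and the
    remainders, of size |h|^2 c_n^2 e^(2 pi |c_n| d) times the modulus of A_n, have a summable
    bound. It serves both variables, with c_n = n + 1/2 for z and c_n = (n + 1/2)^2 / 2 for tau. *)
Lemma cder_expsum (A : Z -> C) (c : Z -> R) (d K : R) (F : C -> C) (z : C) :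
  0 < d ->
  (forall n, Cmod (A n) * (1 + c n * c n) * exp (2 * PI * (Rabs (c n) * d)) <= K * ez n) ->
  (forall h, Cmod h < d -> F (Cplus z h) = CSeriesZ (fun n => Cmult (A n) (e2pi (Cmult (c n) h)))) ->
  cder F z (Cmult twopii (CSeriesZ (fun n => Cmult (c n) (A n)))).
Proof.
  intros Hd HK HF.
  assert (Hpi := PI_RGT_0).
  assert (Hex : forall n, 1 <= exp (2 * PI * (Rabs (c n) * d))).
  { intros n. rewrite <- exp_0. apply exp_le. assert (P := Rabs_pos (c n)).
    apply Rmult_le_pos; [lra|]. apply Rmult_le_pos; lra. }
  assert (HK2 : forall n, Cmod (A n) * (1 + c n * c n) <= K * ez n).
  { intros n. eapply Rle_trans; [|apply HK]. specialize (Hex n).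
    assert (0 <= Cmod (A n) * (1 + c n * c n)).
    { apply Rmult_le_pos; [apply Cmod_ge_0|nra]. } nra. }
  assert (DA : decZ A).
  { exists K. intros n. eapply Rle_trans; [|apply HK2]. assert (P := Cmod_ge_0 (A n)).
    assert (0 <= Cmod (A n) * (c n * c n)) by (apply Rmult_le_pos; nra). lra. }
  assert (DcA : decZ (fun n => Cmult (c n) (A n))).
  { exists K. intros n. eapply Rle_trans; [|apply HK2]. rewrite Cmod_mult, Cmod_R, Rmult_comm.
    apply Rmult_le_compat_l; [apply Cmod_ge_0|].
    destruct (Rle_lt_dec 0 (c n)); [rewrite Rabs_pos_eq by assumption|rewrite Rabs_left by assumption]; nra. }
  assert (Bnd : forall h, Cmod h < d -> forall n,
    Cmod (Cminus (Cminus (Cmult (A n) (e2pi (Cmult (c n) h))) (A n)) (Cmult twopii (Cmult h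
      (Cmult (c n) (A n)))))
    <= (32 * PI * PI * K * (Cmod h * Cmod h)) * ez n).
  { intros h Hh n.
    replace (Cminus (Cminus (Cmult (A n) (e2pi (Cmult (c n) h))) (A n)) (Cmult twopii (Cmult h
      (Cmult (c n) (A n)))))
      with (Cmult (A n) (Cminus (Cminus (e2pi (Cmult (c n) h)) 1) (Cmult twopii (Cmult (c n) h)))) by ring.
    rewrite Cmod_mult.
    eapply Rle_trans; [apply Rmult_le_compat_l; [apply Cmod_ge_0|apply e2pi_taylor_1]|].
    rewrite Cmod_mult, Cmod_R.
    assert (P := Rabs_pos (c n)). assert (Ph := Cmod_ge_0 h). assert (PA := Cmod_ge_0 (A n)).
    assert (E1 : exp (2 * PI * (Rabs (c n) * Cmod h)) <= exp (2 * PI * (Rabs (c n) * d))).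
    { apply exp_le. apply Rmult_le_compat_l; [lra|]. apply Rmult_le_compat_l; lra. }
    assert (E2 : Rabs (c n) * Rabs (c n) = c n * c n) by (rewrite <- Rabs_mult; apply Rabs_pos_eq; nra).
    replace (Cmod (A n) * (8 * (2 * PI * (Rabs (c n) * Cmod h) * (2 * PI * (Rabs (c n) * Cmod h))) * exp (2 * PI * (Rabs (c n) * Cmod h))))
      with ((32 * PI * PI * (Cmod h * Cmod h)) * (Cmod (A n) * (Rabs (c n) * Rabs (c n)) * exp (2 * PI * (Rabs (c n) * Cmod h)))) by ring.
    replace (32 * PI * PI * K * (Cmod h * Cmod h) * ez n) with ((32 * PI * PI *
      (Cmod h * Cmod h)) * (K * ez n)) by ring.
    apply Rmult_le_compat_l.
    { apply Rmult_le_pos; nra. }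
    eapply Rle_trans; [|apply HK]. rewrite E2.
    apply Rmult_le_compat; [apply Rmult_le_pos; nra|left; apply exp_pos|apply Rmult_le_compat_l;
      lra|exact E1]. }
  set (S := Series (fun n => exp (- INR n))).
  assert (HS : 0 <= S).
  { unfold S. rewrite <- (Series_ext (fun n => 1 * exp (- INR n))) by (intros; ring).
    eapply Rle_trans; [|apply (Rle_rsum_Series _ 0)]; [simpl; lra| |apply ex_series_exp_neg].
    intros n. generalize (exp_pos (- INR n)); lra. }
  assert (HK0 : 0 <= K).
  { apply Rnot_lt_le; intros Hk. specialize (HK2 0%Z). assert (P := ez_pos 0).
    assert (0 <= Cmod (A 0%Z) * (1 + c 0%Z * c 0%Z)) by (apply Rmult_le_pos; [apply Cmod_ge_0|nra]). nra. }
  apply cder_intro. intros eps He.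
  (* The summed remainder is at most (Q - 1) |h|^2; the added 1 makes Q positive, so that one can
     ask for |h| < eps / Q. *)
  set (Q := 32 * PI * PI * K * (2 * S) + 1).
  assert (HQ : 0 < Q).
  { unfold Q. assert (0 <= 32 * PI * PI * K * (2 * S)); [|lra].
    repeat (apply Rmult_le_pos; try lra). }
  exists (Rmin d (eps / Q)). split. { apply Rmin_glb_lt; [exact Hd|]. apply Rdiv_lt_0_compat; lra. }
  intros h Hh.
  assert (Hhd : Cmod h < d) by (eapply Rlt_le_trans; [exact Hh|apply Rmin_l]).
  assert (Hhe : Cmod h < eps / Q) by (eapply Rlt_le_trans; [exact Hh|apply Rmin_r]).
  specialize (Bnd h Hhd).
  assert (D1 : decZ (fun n => Cminus (Cminus (Cmult (A n) (e2pi (Cmult (c n) h))) (A n)) (Cmult twopii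
    (Cmult h (Cmult (c n) (A n)))))).
  { eexists. exact Bnd. }
  assert (EF : Cminus (Cminus (F (Cplus z h)) (F z)) (Cmult (Cmult twopii (CSeriesZ
    (fun n => Cmult (c n) (A n)))) h) =
    CSeriesZ (fun n => Cminus (Cminus (Cmult (A n) (e2pi (Cmult (c n) h))) (A n)) (Cmult twopii (Cmult h
      (Cmult (c n) (A n)))))).
  { assert (F0 : F z = CSeriesZ A).
    { replace z with (Cplus z 0) by ring. rewrite HF by (rewrite Cmod_0; exact Hd).
      apply CSeriesZ_ext. intros n. rewrite Cmult_0_r, e2pi_0. ring. }
    rewrite HF by exact Hhd. rewrite F0.
    assert (G : CSeriesZ (fun n => Cmult (A n) (e2pi (Cmult (c n) h))) =
      Cplus (CSeriesZ (fun n => Cminus (Cminus (Cmult (A n) (e2pi (Cmult (c n) h))) (A n)) (Cmult twopii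
        (Cmult h (Cmult (c n) (A n))))))
        (Cplus (CSeriesZ A) (Cmult (Cmult twopii h) (CSeriesZ (fun n => Cmult (c n) (A n)))))).
    { rewrite <- (CSeriesZ_scal (Cmult twopii h)) by exact DcA.
      rewrite <- CSeriesZ_plus by (exact DA || apply decZ_scal, DcA).
      rewrite <- CSeriesZ_plus by (first [exact D1|apply decZ_plus; [exact DA|apply decZ_scal, DcA]]).
      apply CSeriesZ_ext. intros n. ring. }
    rewrite G. ring. }
  rewrite EF. eapply Rle_trans; [apply Cmod_CSeriesZ_le, Bnd|]. fold S.
  assert (Ph := Cmod_ge_0 h).
  replace (32 * PI * PI * K * (Cmod h * Cmod h) * (2 * S)) with ((Q - 1) * Cmod h * Cmod h) by (unfold Q;
    ring).
  apply Rmult_le_compat_r; [exact Ph|].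
  assert (Q * Cmod h <= eps).
  { apply Rle_trans with (Q * (eps / Q)); [apply Rmult_le_compat_l; lra|]. right; field; lra. }
  lra.
Qed.

(** * The theta series and its derivatives *)

(** With t = |y|, one has t^k <= e^(k t), and completing the square bounds -a t^2 + B t by B^2 / (4
    a). The parameters [c], [c'] convert decay in y into decay in n whenever y grows at least
    linearly with n. *)
Lemma gauss_ez (a b c c' : R) (k : nat) : 0 < a -> exists K, 0 <= K /\ forall (y : R) (n : Z),
  IZR (Z.abs n) <= c * Rabs y + c' ->
  Rabs y ^ k * exp (- (a * (y * y)) + b * Rabs y) <= K * ez n.
Proof.
  intros Ha. set (B := b + INR k + c).
  exists (exp (B * B / (4 * a) + c')). split; [left; apply exp_pos|].
  intros y n Hn. unfold ez. rewrite <- exp_plus.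
  assert (Py := Rabs_pos y).
  assert (E : y * y = Rabs y * Rabs y) by (rewrite <- Rabs_mult; symmetry; apply Rabs_pos_eq; nra).
  rewrite E. set (t := Rabs y) in *.
  assert (H1 : t ^ k <= exp (INR k * t)).
  { clear -Py. induction k as [|k IH].
    - simpl. rewrite Rmult_0_l, exp_0. lra.
    - rewrite S_INR. simpl. replace ((INR k + 1) * t) with (t + INR k * t) by ring.
      rewrite exp_plus. assert (H := exp_ineq1_le t).
      apply Rmult_le_compat; [exact Py|apply pow_le, Py|lra|exact IH]. }
  apply Rle_trans with (exp (INR k * t) * exp (- (a * (t * t)) + b * t)).
  { apply Rmult_le_compat_r; [left; apply exp_pos|exact H1]. }
  rewrite <- exp_plus. apply exp_le.
  assert (0 <= (2 * a * t - B) * (2 * a * t - B) / (4 * a)).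
  { apply Rmult_le_pos; [apply (Rle_0_sqr (2 * a * t - B))|]. left. apply Rinv_0_lt_compat. lra. }
  replace ((2 * a * t - B) * (2 * a * t - B) / (4 * a)) with (a * (t * t) - B * t + B * B / (4 * a)) in H
    by (field; lra).
  unfold B in *. lra.
Qed.

Lemma Im_scal (x : R) (w : C) : Im (Cmult x w) = x * Im w.
Proof. destruct w as [a b]. simpl. ring. Qed.

Lemma Im_plus (v w : C) : Im (Cplus v w) = Im v + Im w.
Proof. reflexivity. Qed.

Lemma Cmod_e2pi_quad (y : R) (tau z : C) :
  Cmod (e2pi (Cplus (Cmult (y * y / 2) tau) (Cmult y z))) <=
  exp (- (PI * Im tau * (y * y)) + 2 * PI * Rabs (Im z) * Rabs y).
Proof.
  rewrite Cmod_e2pi. apply exp_le.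
  rewrite <- RtoC_mult, <- RtoC_div by lra.
  rewrite Im_plus, !Im_scal.
  assert (H : - (y * Im z) <= Rabs (Im z) * Rabs y).
  { rewrite <- Rabs_mult, Rmult_comm. rewrite <- Rabs_Ropp. apply Rle_abs. }
  assert (Hpi := PI_RGT_0). nra.
Qed.

(** With x = n + 1/2 the prefactor q^(1/8) zeta^(1/2) merges into the series: theta is the sum of
    (-1)^n q^(x^2/2) zeta^x. *)
Definition xh (n : Z) : R := IZR n + / 2.

Definition sg (n : Z) : R := powerRZ (-1) n.

Definition qe (y : R) (tau z : C) : C := e2pi (Cplus (Cmult (y * y / 2) tau) (Cmult y z)).

Definition trm (k : nat) (tau z : C) (n : Z) : C :=
  Cmult (sg n * xh n ^ k) (qe (xh n) tau z).

(** For Im tau > 0 this is (zeta d/dzeta)^k of theta, by [cder_Theta_z]. *)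
Definition Theta (k : nat) (tau z : C) : C := CSeriesZ (trm k tau z).

Lemma Rabs_sg (n : Z) : Rabs (sg n) = 1.
Proof.
  unfold sg. destruct n as [|p|p]; simpl.
  - apply Rabs_R1.
  - apply pow_1_abs.
  - rewrite Rabs_inv, pow_1_abs. apply Rinv_1.
Qed.

Lemma xh_abs (n : Z) : IZR (Z.abs n) <= 1 * Rabs (xh n) + 1.
Proof.
  unfold xh. rewrite abs_IZR.
  replace (IZR n) with ((IZR n + / 2) + - / 2) at 1 by lra.
  eapply Rle_trans; [apply Rabs_triang|]. rewrite (Rabs_left (- / 2)) by lra. lra.
Qed.

Lemma qe_dec (k : nat) (tau z : C) (b c c' : R) : 0 < Im tau -> exists K, 0 <= K /\ forall y n,
  IZR (Z.abs n) <= c * Rabs y + c' ->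
  Rabs y ^ k * exp (b * Rabs y) * Cmod (qe y tau z) <= K * ez n.
Proof.
  intros Ht.
  destruct (gauss_ez (PI * Im tau) (b + 2 * PI * Rabs (Im z)) c c' k) as [K [HK0 HK]].
  { apply Rmult_lt_0_compat; [apply PI_RGT_0|exact Ht]. }
  exists K. split; [exact HK0|]. intros y n Hn. eapply Rle_trans; [|apply HK, Hn].
  rewrite Rmult_assoc. apply Rmult_le_compat_l; [apply pow_le, Rabs_pos|].
  eapply Rle_trans.
  { apply Rmult_le_compat_l; [left; apply exp_pos|]. apply Cmod_e2pi_quad. }
  rewrite <- exp_plus. right. f_equal. ring.
Qed.

Lemma Cmod_trm (k : nat) (tau z : C) (n : Z) : Cmod (trm k tau z n) =
  Rabs (xh n) ^ k * Cmod (qe (xh n) tau z).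
Proof.
  unfold trm. rewrite <- RtoC_pow, <- RtoC_mult, Cmod_mult, Cmod_R, Rabs_mult, Rabs_sg, <- RPow_abs. ring.
Qed.

Lemma trm_dec (k : nat) (tau z : C) : 0 < Im tau -> decZ (trm k tau z).
Proof.
  intros Ht. destruct (qe_dec k tau z 0 1 1 Ht) as [K [_ HK]]. exists K. intros n.
  rewrite Cmod_trm. eapply Rle_trans; [|apply (HK (xh n) n), xh_abs].
  rewrite Rmult_0_l, exp_0. right; ring.
Qed.

Lemma qe_add_z (y : R) (tau z h : C) : qe y tau (Cplus z h) = Cmult (qe y tau z) (e2pi (Cmult y h)).
Proof. unfold qe. rewrite <- e2pi_plus. f_equal. ring. Qed.

Lemma qe_add_tau (y : R) (tau z h : C) : qe y (Cplus tau h) z = Cmult (qe y tau z) (e2pi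
  (Cmult (RtoC (y * y / 2)) h)).
Proof. unfold qe. rewrite <- e2pi_plus. f_equal. rewrite RtoC_div, RtoC_mult by lra. field. Qed.

Lemma cder_Theta_z (k : nat) (tau z : C) : 0 < Im tau ->
  cder (fun w => Theta k tau w) z (Cmult twopii (Theta (S k) tau z)).
Proof.
  intros Ht.
  destruct (qe_dec k tau z (2 * PI) 1 1 Ht) as [K [_ HK]].
  destruct (qe_dec (S (S k)) tau z (2 * PI) 1 1 Ht) as [L [_ HL]].
  replace (Theta (S k) tau z) with (CSeriesZ (fun n => Cmult (xh n) (trm k tau z n))).
  2: { apply CSeriesZ_ext. intros n. unfold trm. simpl. ring. }
  apply (cder_expsum _ _ 1 (K + L)); [lra| |].
  - intros n. rewrite Cmod_trm. specialize (HK (xh n) n (xh_abs n)). specialize (HL (xh n) n (xh_abs n)).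
    assert (E : xh n * xh n = Rabs (xh n) * Rabs (xh n)).
    { rewrite <- Rabs_mult. symmetry. apply Rabs_pos_eq. nra. }
    rewrite E, Rmult_1_r. simpl in HL. lra.
  - intros h _. apply CSeriesZ_ext. intros n. unfold trm. rewrite qe_add_z. ring.
Qed.

(** The heat equation term by term: the exponent of q is half the square of that of zeta. *)
Lemma cder_Theta_tau (k : nat) (tau z : C) : 0 < Im tau ->
  cder (fun t => Theta k t z) tau (Cmult twopii (Cmult (/ 2) (Theta (S (S k)) tau z))).
Proof.
  (* For |h| < Im tau / 2 the factor e(y^2 h / 2) can consume half of the Gaussian decay; [a] is the
     rate that remains. *)
  intros Ht. set (a := PI * Im tau / 2).
  assert (Ha : 0 < a). { unfold a. assert (H := PI_RGT_0). nra. }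
  destruct (gauss_ez a (2 * PI * Rabs (Im z)) 1 1 k Ha) as [K [_ HK]].
  (* The weight 1 + c_n^2 of [cder_expsum] is 1 + y^4 / 4 here, hence the exponent 4 + k and the
     factor 1/4 below. *)
  destruct (gauss_ez a (2 * PI * Rabs (Im z)) 1 1 (4 + k) Ha) as [L [_ HL]].
  rewrite <- RtoC_inv by lra. unfold Theta at 2. rewrite <- CSeriesZ_scal by (apply trm_dec, Ht).
  rewrite (CSeriesZ_ext _ (fun n => Cmult (RtoC (xh n * xh n / 2)) (trm k tau z n))).
  2: { intros n. unfold trm. rewrite <- !RtoC_pow, <- !RtoC_mult, !Cmult_assoc, <- !RtoC_mult. f_equal.
  f_equal. simpl. field. }
  apply (cder_expsum _ _ (Im tau / 2) (K + / 4 * L)); [lra| |].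
  - intros n. rewrite Cmod_trm. specialize (HK (xh n) n (xh_abs n)). specialize (HL (xh n) n (xh_abs n)).
    set (y := xh n) in *.
    assert (E : y * y = Rabs y * Rabs y).
    { rewrite <- Rabs_mult. symmetry. apply Rabs_pos_eq. nra. }
    rewrite (Rabs_pos_eq (y * y / 2)) by nra.
    assert (M : Cmod (qe y tau z) * exp (2 * PI * (y * y / 2 * (Im tau / 2))) <=
      exp (- (a * (y * y)) + 2 * PI * Rabs (Im z) * Rabs y)).
    { eapply Rle_trans; [apply Rmult_le_compat_r; [left; apply exp_pos|apply Cmod_e2pi_quad]|].
      rewrite <- exp_plus. right. f_equal. unfold a. field. }
    set (G := exp (- (a * (y * y)) + 2 * PI * Rabs (Im z) * Rabs y)) in *.
    replace (Rabs y ^ k * Cmod (qe y tau z) * (1 + y * y / 2 * (y * y / 2)) * exp (2 * PI * (y * y / 2 * (Im tau / 2))))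
      with (Rabs y ^ k * (1 + y * y / 2 * (y * y / 2)) * (Cmod (qe y tau z) * exp (2 * PI * (y * y / 2 * (Im tau / 2))))) by ring.
    apply Rle_trans with (Rabs y ^ k * (1 + y * y / 2 * (y * y / 2)) * G).
    { apply Rmult_le_compat_l; [|exact M]. apply Rmult_le_pos; [apply pow_le, Rabs_pos|nra]. }
    rewrite E. simpl in HL. simpl. lra.
  - intros h _. apply CSeriesZ_ext. intros n. unfold trm. rewrite qe_add_tau. ring.
Qed.

(** n (n + 1) is even, so the integer division is exact and the square can be completed. *)
Lemma triangular_shift (n : Z) : IZR (n * (n + 1) / 2) + / 8 = xh n * xh n / 2.
Proof.
  assert (E : (n * (n + 1) = 2 * (n * (n + 1) / 2))%Z).
  { assert (Even : ((n * (n + 1)) mod 2 = 0)%Z).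
    { rewrite Zmult_mod, Zplus_mod. destruct (Z.mod_pos_bound n 2 ltac:(lia)) as [H1 H2].
      assert (n mod 2 = 0 \/ n mod 2 = 1)%Z as [->| ->] by lia; reflexivity. }
    rewrite (Z.div_mod (n * (n + 1)) 2) at 1 by lia. lia. }
  apply (f_equal IZR) in E. rewrite !mult_IZR, plus_IZR in E. unfold xh. lra.
Qed.

Lemma jtheta_Theta (tau z : C) : 0 < Im tau -> jtheta tau z = Theta 0 tau z.
Proof.
  intros Ht. unfold jtheta.
  set (g := fun n : Z => _). set (c := Cmult (e2pi _) (e2pi _)).
  assert (Hc : c <> 0) by (apply Cmult_neq_0; apply e2pi_neq_0).
  assert (E : forall n, trm 0 tau z n = Cmult c (g n)).
  { intros n. unfold g, c, trm, qe, sg.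
    transitivity (Cmult (powerRZ (-1) n) (Cmult (Cmult (e2pi (Cdiv tau 8)) (e2pi (Cdiv z 2)))
      (Cmult (e2pi (Cmult (RtoC (IZR (n * (n + 1) / 2))) tau)) (e2pi (Cmult (RtoC (IZR n)) z))))); [|ring].
    rewrite <- !e2pi_plus. simpl. rewrite Cmult_1_r. f_equal. f_equal.
    rewrite <- RtoC_mult, <- RtoC_div, <- triangular_shift, !RtoC_plus, !RtoC_inv by lra.
    unfold xh. rewrite RtoC_plus, RtoC_inv by lra. field. }
  rewrite <- CSeriesZ_scal.
  - apply CSeriesZ_ext. intros n. symmetry. apply E.
  (* The inner series inherits its decay from [trm] through division by the nonzero prefactor. *)
  - apply (decZ_ext (fun n => Cmult (/ c) (trm 0 tau z n))).
    + intros n. rewrite E. field. exact Hc.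
    + apply decZ_scal, trm_dec, Ht.
Qed.

Lemma xh_opp (n : Z) : xh (- n - 1) = - xh n.
Proof. unfold xh. rewrite minus_IZR, opp_IZR. lra. Qed.

Lemma sg_add (m n : Z) : sg (m + n) = sg m * sg n.
Proof. unfold sg. apply powerRZ_add. lra. Qed.

Lemma sg_even (n : Z) : sg (2 * n) = 1.
Proof.
  replace (2 * n)%Z with (n + n)%Z by lia. rewrite sg_add.
  assert (H := Rabs_sg n). destruct (Rle_lt_dec 0 (sg n)); [rewrite Rabs_pos_eq in H
    by assumption|rewrite Rabs_left in H by assumption]; nra.
Qed.

Lemma sg_opp (n : Z) : sg (- n - 1) = - sg n.
Proof.
  assert (H : sg (- n - 1 + n) = sg (-1)) by (f_equal; lia).
  rewrite sg_add in H. unfold sg in H at 3. simpl in H.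
  assert (H2 : sg n * sg n = 1). { rewrite <- sg_add. replace (n + n)%Z with (2 * n)%Z by lia.
  apply sg_even. }
  assert (E : sg (- n - 1) * (sg n * sg n) = - sg n).
  { rewrite <- Rmult_assoc, H. lra. }
  rewrite H2 in E. lra.
Qed.

(** theta is odd in z: under n -> -n - 1 both the half-integer and the sign (-1)^n change sign. *)
Lemma Theta_even_0 (j : nat) (tau : C) : 0 < Im tau -> Theta (2 * j) tau 0 = 0.
Proof.
  intros Ht.
  assert (E : Theta (2 * j) tau 0 = Cmult (-1) (Theta (2 * j) tau 0)).
  { unfold Theta at 1. rewrite <- CSeriesZ_reflect. unfold Theta. rewrite <- CSeriesZ_scal
    by (apply trm_dec, Ht).
    apply CSeriesZ_ext. intros n. unfold trm, qe.
    rewrite xh_opp, sg_opp, <- !RtoC_pow, !Cmult_0_r, <- !RtoC_mult.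
    replace (- xh n * - xh n) with (xh n * xh n) by ring.
    rewrite Cmult_assoc, <- RtoC_mult. f_equal. f_equal.
    rewrite !pow_mult. replace ((- xh n) ^ 2) with (xh n ^ 2) by ring. ring. }
  assert (E2 : Cmult 2 (Theta (2 * j) tau 0) = 0).
  { replace (Cmult 2 (Theta (2 * j) tau 0)) with (Cminus (Theta (2 * j) tau 0)
    (Cmult (-1) (Theta (2 * j) tau 0))) by ring.
    rewrite <- E. ring. }
  replace (Theta (2 * j) tau 0) with (Cmult (/ 2) (Cmult 2 (Theta (2 * j) tau 0))).
  - rewrite E2. ring.
  - field.
Qed.

(** * The addition formula *)

Lemma Cmod_zsum_le (f : Z -> C) (K : R) (M : nat) : (forall n, Cmod (f n) <= K * ez n) ->
  Cmod (zsum f M) <= K * (2 * Series (fun n => exp (- INR n))).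
Proof.
  intros H. unfold zsum.
  eapply Rle_trans; [apply (Cmod_csum _ (fun n => (2 * K) * exp (- INR n)))|].
  - intros n. eapply Rle_trans; [apply Cmod_triangle|].
    assert (H1 := decZ_bound_pos f K H n). assert (H2 := decZ_bound_neg f K H n). lra.
  - eapply Rle_trans; [apply Rle_rsum_Series|].
    + intros n. assert (P := exp_pos (- INR n)). assert (P' := decZ_nonneg f K H). nra.
    + apply ex_series_exp_neg.
    + rewrite Series_scal_l. right; ring.
Qed.

Lemma zsum_scal (c : C) (f : Z -> C) (M : nat) :
  zsum (fun m => Cmult c (f m)) M = Cmult c (zsum f M).
Proof. unfold zsum. rewrite <- csum_scal. apply csum_ext. intros; ring. Qed.

Lemma zsum_plus (f g : Z -> C) (M : nat) :
  zsum (fun m => Cplus (f m) (g m)) M = Cplus (zsum f M) (zsum g M).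
Proof. unfold zsum. rewrite <- csum_plus. apply csum_ext. intros; ring. Qed.

Lemma zsum_ext (f g : Z -> C) (M : nat) : (forall m, f m = g m) -> zsum f M = zsum g M.
Proof. intros H. apply csum_ext. intros n _. rewrite !H. reflexivity. Qed.

Lemma zsum_CSeriesZ (f : Z -> Z -> C) (M : nat) : (forall m, decZ (f m)) ->
  zsum (fun m => CSeriesZ (f m)) M = CSeriesZ (fun s => zsum (fun m => f m s) M).
Proof.
  intros H. unfold zsum.
  rewrite <- (proj2 (csum_CSeriesZ (fun k s => Cplus (f (Z.of_nat k) s) (f (- Z.of_nat k - 1)%Z s)) M
    (fun k => decZ_plus _ _ (H _) (H _)))).
  apply csum_ext. intros n _. rewrite CSeriesZ_plus by apply H. reflexivity.
Qed.

(** The index r = 2m + 1 - s has parity opposite to that of s, so summing over m for fixed s gives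
    the odd part of F for even s and the even part for odd s. As a bound in m, that on F degrades by
    e^(|s| + 1), which is why G must decay with a factor e^|s| to spare. *)
Lemma bilinear_parity (G F : Z -> C) (K : R) :
  (forall s, exp (IZR (Z.abs s)) * Cmod (G s) <= K * ez s) -> decZ F ->
  (forall m, decZ (fun s => Cmult (G s) (F (2 * m + 1 - s)%Z))) ->
  climit (zsum (fun m => CSeriesZ (fun s => Cmult (G s) (F (2 * m + 1 - s)%Z))))
    (Cplus (Cmult (CSeriesZ (fun t => G (2 * t)%Z)) (CSeriesZ (fun t => F (2 * t + 1)%Z)))
           (Cmult (CSeriesZ (fun t => G (2 * t + 1)%Z)) (CSeriesZ (fun t => F (2 * t)%Z)))).
Proof.
  intros HG DF DGF. destruct DF as [L HL]. assert (L0 := decZ_nonneg _ _ HL).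
  assert (DF : decZ F) by (exists L; exact HL).
  assert (HF : forall s m, Cmod (F (2 * m + 1 - s)%Z) <= (L * exp (IZR (Z.abs s) + 1)) * ez m).
  { intros s m. eapply Rle_trans; [apply HL|]. rewrite Rmult_assoc. apply Rmult_le_compat_l; [exact L0|].
    unfold ez. rewrite <- exp_plus. apply exp_le.
    assert (A : (Z.abs m <= Z.abs (2 * m + 1 - s) + Z.abs s + 1)%Z) by lia.
    apply IZR_le in A. rewrite !plus_IZR in A. lra. }
  assert (DFs : forall s, decZ (fun m => F (2 * m + 1 - s)%Z)) by (intros s; eexists; apply HF).
  set (S := Series (fun n => exp (- INR n))).
  set (g := fun s => CSeriesZ (fun m => F (2 * m + 1 - s)%Z)).
  assert (HB : forall s w, Cmod w <= (L * exp (IZR (Z.abs s) + 1)) * (2 * S) ->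
    Cmod (Cmult (G s) w) <= (L * exp 1 * Rabs (2 * S) * K) * ez s).
  { intros s w Hw. rewrite Cmod_mult. rewrite exp_plus in Hw.
    apply Rle_trans with (Cmod (G s) * (L * (exp (IZR (Z.abs s)) * exp 1) * Rabs (2 * S))).
    - apply Rmult_le_compat_l; [apply Cmod_ge_0|]. eapply Rle_trans; [exact Hw|].
      apply Rmult_le_compat_l; [|apply Rle_abs].
      apply Rmult_le_pos; [exact L0|]. apply Rmult_le_pos; left; apply exp_pos.
    - replace (Cmod (G s) * (L * (exp (IZR (Z.abs s)) * exp 1) * Rabs (2 * S)))
        with ((L * exp 1 * Rabs (2 * S)) * (exp (IZR (Z.abs s)) * Cmod (G s))) by ring.
      rewrite Rmult_assoc with (r2 := K). apply Rmult_le_compat_l; [|apply HG].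
      apply Rmult_le_pos; [|apply Rabs_pos]. apply Rmult_le_pos; [exact L0|left; apply exp_pos]. }
  assert (Dg : decZ (fun s => Cmult (G s) (g s))).
  { eexists. intros s. apply HB. apply Cmod_CSeriesZ_le, HF. }
  replace (Cplus _ _) with (CSeriesZ (fun s => Cmult (G s) (g s))).
  (* A finite sum over m commutes with the series over s; dominated convergence then lets the range
     of m grow. *)
  - eapply climit_ext with (u := fun M => CSeriesZ (fun s => Cmult (G s) (zsum
    (fun m => F (2 * m + 1 - s)%Z) M))).
    { intros M. rewrite (zsum_CSeriesZ (fun m s => Cmult (G s) (F (2 * m + 1 - s)%Z))) by exact DGF.
      apply CSeriesZ_ext. intros s. symmetry. apply (zsum_scal (G s) (fun m => F (2 * m + 1 - s)%Z)). }
    eapply tanneryZ.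
    + intros M s. apply HB. apply Cmod_zsum_le, HF.
    + intros s. apply climit_scal, climit_CSeriesZ, DFs.
  - rewrite CSeriesZ_parity by exact Dg.
    assert (G1 : forall t, g (2 * t)%Z = CSeriesZ (fun t => F (2 * t + 1)%Z)).
    { intros t. unfold g. rewrite <- (CSeriesZ_shift (- t) (fun t => F (2 * t + 1)%Z)).
      - apply CSeriesZ_ext. intros n. f_equal. lia.
      - apply (decZ_reindex (fun t => 2 * t + 1)%Z 1 F); [intros; lia|exact DF]. }
    assert (G2 : forall t, g (2 * t + 1)%Z = CSeriesZ (fun t => F (2 * t)%Z)).
    { intros t. unfold g. rewrite <- (CSeriesZ_shift (- t) (fun t => F (2 * t)%Z)).
      - apply CSeriesZ_ext. intros n. f_equal. lia.
      - apply (decZ_reindex (fun t => 2 * t)%Z 0 F); [intros; lia|exact DF]. }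
    assert (DG : decZ G).
    { exists K. intros n. eapply Rle_trans; [|apply HG].
      assert (1 <= exp (IZR (Z.abs n))). { rewrite <- exp_0. apply exp_le, IZR_le. lia. }
      assert (P := Cmod_ge_0 (G n)). nra. }
    rewrite (CSeriesZ_ext (fun n => Cmult (G (2 * n)%Z) (g (2 * n)%Z)) (fun n => Cmult (CSeriesZ
      (fun t => F (2 * t + 1)%Z)) (G (2 * n)%Z)))
      by (intros n; rewrite G1; ring).
    rewrite (CSeriesZ_ext (fun n => Cmult (G (2 * n + 1)%Z) (g (2 * n + 1)%Z)) (fun n => Cmult (CSeriesZ
      (fun t => F (2 * t)%Z)) (G (2 * n + 1)%Z)))
      by (intros n; rewrite G2; ring).
    rewrite !CSeriesZ_scal.
    + ring.
    + apply (decZ_reindex (fun t => 2 * t + 1)%Z 1 G); [intros; lia|exact DG].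
    + apply (decZ_reindex (fun t => 2 * t)%Z 0 G); [intros; lia|exact DG].
Qed.

(* A list of triples [(c, a, b)] encodes the polynomial with monomials [c x^a y^b]. *)
Definition poly2 : Type := list (R * nat * nat).

Fixpoint eval2 (l : poly2) (x y : R) : R :=
  match l with
  | nil => 0
  | (c, a, b) :: l' => c * x ^ a * y ^ b + eval2 l' x y
  end.

Fixpoint theta2 (l : poly2) (tau z : C) : C :=
  match l with
  | nil => 0
  | (c, a, b) :: l' => Cplus (Cmult c (Cmult (Theta a tau z) (Theta b tau z))) (theta2 l' tau z)
  end.

Definition trm2 (l : poly2) (tau z : C) (m n : Z) : C :=
  Cmult (eval2 l (xh m) (xh n)) (Cmult (trm 0 tau z m) (trm 0 tau z n)).

Lemma trm2_cons (c : R) (a b : nat) (l : poly2) (tau z : C) (m n : Z) :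
  trm2 ((c, a, b) :: l) tau z m n =
  Cplus (Cmult (Cmult c (trm a tau z m)) (trm b tau z n)) (trm2 l tau z m n).
Proof.
  unfold trm2, trm. simpl. rewrite !RtoC_plus, !RtoC_mult, !RtoC_pow. ring.
Qed.

Lemma trm2_dec (l : poly2) (tau z : C) (m : Z) : 0 < Im tau -> decZ (trm2 l tau z m).
Proof.
  intros Ht. induction l as [|[[c a] b] l IH].
  - exists 0. intros n. unfold trm2. simpl. rewrite Cmult_0_l, Cmod_0. lra.
  - eapply decZ_ext; [intros n; symmetry; apply trm2_cons|].
    apply decZ_plus; [apply decZ_scal, trm_dec, Ht|exact IH].
Qed.

(** Products of two series are kept as iterated sums, finite in m and infinite in n, the form that
    [bilinear_parity] evaluates. *)
Lemma theta2_double_sum (l : poly2) (tau z : C) : 0 < Im tau ->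
  climit (zsum (fun m => CSeriesZ (trm2 l tau z m))) (theta2 l tau z).
Proof.
  intros Ht. induction l as [|[[c a] b] l IH].
  - eapply climit_ext; [|apply climit_const]. intros M. symmetry.
    rewrite (zsum_ext _ (fun _ => Cmult 0 0)); [rewrite zsum_scal; simpl; ring|].
    intros m. rewrite Cmult_0_l, <- CSeriesZ_0. apply CSeriesZ_ext. intros n. unfold trm2. simpl. ring.
  - eapply climit_ext with (u := fun M => Cplus (Cmult c (Cmult (zsum (trm a tau z) M) (Theta b tau z)))
      (zsum (fun m => CSeriesZ (trm2 l tau z m)) M)).
    + intros M.
      rewrite (zsum_ext (fun m => CSeriesZ (trm2 ((c, a, b) :: l) tau z m))
        (fun m => Cplus (Cmult (Cmult c (Theta b tau z)) (trm a tau z m)) (CSeriesZ (trm2 l tau z m)))).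
      * rewrite zsum_plus, zsum_scal. ring.
      * intros m. rewrite (CSeriesZ_ext _ _ (trm2_cons c a b l tau z m)).
        rewrite CSeriesZ_plus; [|apply decZ_scal, trm_dec, Ht|apply trm2_dec, Ht].
        rewrite CSeriesZ_scal by apply trm_dec, Ht. unfold Theta. ring.
    + simpl. apply climit_plus; [|exact IH]. apply climit_scal. apply climit_mult; [|apply climit_const].
      apply climit_CSeriesZ, trm_dec, Ht.
Qed.

(** The term r^i q^(r^2/4) zeta^r. For x + y = r and x - y = s one has x^2/2 + y^2/2 = (r^2 +
    s^2)/4, hence [tau / 2]. *)
Definition hterm (i : nat) (tau z : C) (r : Z) : C :=
  Cmult (RtoC (IZR r ^ i)) (qe (IZR r) (Cdiv tau 2) z).

(** For i = 0, [Feven] and [Fodd] are the theta functions theta_3 and theta_2 at (2 tau, 2 z), the g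
    and f of the overview. *)
Definition Feven (i : nat) (tau z : C) : C := CSeriesZ (fun t => hterm i tau z (2 * t)%Z).

Definition Fodd (i : nat) (tau z : C) : C := CSeriesZ (fun t => hterm i tau z (2 * t + 1)%Z).

Lemma Im_half (tau : C) : 0 < Im tau -> 0 < Im (Cdiv tau 2).
Proof.
  intros H. replace (Cdiv tau 2) with (Cmult (RtoC (/ 2)) tau).
  - rewrite Im_scal. lra.
  - rewrite RtoC_inv by lra. unfold Cdiv. apply Cmult_comm.
Qed.

Lemma hterm_exp_dec (i : nat) (tau z : C) : 0 < Im tau ->
  exists K, forall r, exp (IZR (Z.abs r)) * Cmod (hterm i tau z r) <= K * ez r.
Proof.
  intros Ht. destruct (qe_dec i (Cdiv tau 2) z 1 1 0 (Im_half _ Ht)) as [K [_ HK]]. exists K. intros r.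
  specialize (HK (IZR r) r). rewrite abs_IZR in *.
  eapply Rle_trans; [|apply HK; lra]. unfold hterm. rewrite Cmod_mult, Cmod_R, <- RPow_abs, Rmult_1_l.
  right; ring.
Qed.

Lemma hterm_dec (i : nat) (tau z : C) : 0 < Im tau -> decZ (hterm i tau z).
Proof.
  intros Ht. destruct (hterm_exp_dec i tau z Ht) as [K HK]. exists K. intros r.
  eapply Rle_trans; [|apply HK].
  assert (1 <= exp (IZR (Z.abs r))). { rewrite <- exp_0. apply exp_le, IZR_le. lia. }
  assert (P := Cmod_ge_0 (hterm i tau z r)). nra.
Qed.

(* [x^2 + y^2 = ((x + y)^2 + (x - y)^2) / 2] separates the double series in the
   variables [r = m + n + 1] and [s = m - n], which have opposite parities. *)
Lemma theta_addition (i j : nat) (l : poly2) (tau z : C) : 0 < Im tau ->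
  (forall x y, eval2 l x y = (x + y) ^ i * (x - y) ^ j) ->
  theta2 l tau z =
  Cminus (Cmult (Feven j tau 0) (Fodd i tau z)) (Cmult (Fodd j tau 0) (Feven i tau z)).
Proof.
  intros Ht Hl.
  (* The sign (-1)^(m + n) depends on s = m - n alone, so it is attached to the factor in s. *)
  set (G := fun s : Z => Cmult (sg s) (hterm j tau 0 s)).
  assert (E : forall m s, trm2 l tau z m (m - s)%Z = Cmult (G s) (hterm i tau z (2 * m + 1 - s)%Z)).
  { intros m s. unfold trm2, G, hterm, trm. rewrite Hl.
    assert (Hsg : sg s = sg m * sg (m - s)).
    { rewrite <- sg_add. replace (m + (m - s))%Z with (2 * (m - s) + s)%Z by lia.
      rewrite sg_add, sg_even. ring. }
    assert (Hr : IZR (2 * m + 1 - s) = xh m + xh (m - s)).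
    { unfold xh. rewrite !minus_IZR, plus_IZR, mult_IZR. lra. }
    assert (Hs : IZR s = xh m - xh (m - s)).
    { unfold xh. rewrite !minus_IZR. lra. }
    assert (Hq : Cmult (qe (xh m) tau z) (qe (xh (m - s)) tau z) =
      Cmult (qe (IZR s) (Cdiv tau 2) 0) (qe (IZR (2 * m + 1 - s)) (Cdiv tau 2) z)).
    { unfold qe. rewrite <- !e2pi_plus. f_equal. rewrite Hr, Hs.
      rewrite !RtoC_minus, !RtoC_plus. field. }
    rewrite Hsg, Hr, Hs in *. simpl. rewrite !RtoC_mult in *.
    transitivity (Cmult (Cmult (Cmult (sg m) (sg (m - s))) (Cmult (RtoC ((xh m + xh (m - s)) ^ i)) (RtoC ((xh m - xh (m - s)) ^ j)))) (Cmult (qe (xh m) tau z) (qe (xh (m - s)) tau z))).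
    - ring.
    - rewrite Hq. ring. }
  destruct (hterm_exp_dec j tau 0 Ht) as [K HK].
  eapply climit_unique; [apply theta2_double_sum, Ht|].
  eapply climit_ext with (u := zsum (fun m => CSeriesZ (fun s => Cmult (G s) (hterm i tau z (2 * m + 1 - s)%Z)))).
  { intros M. apply zsum_ext. intros m. rewrite <- (CSeriesZ_sub m (trm2 l tau z m)) by apply trm2_dec, Ht.
    apply CSeriesZ_ext. intros s. symmetry. apply E. }
  replace (Cminus _ _) with (Cplus (Cmult (CSeriesZ (fun t => G (2 * t)%Z)) (CSeriesZ
    (fun t => hterm i tau z (2 * t + 1)%Z)))
           (Cmult (CSeriesZ (fun t => G (2 * t + 1)%Z)) (CSeriesZ (fun t => hterm i tau z (2 * t)%Z)))).
  - apply (bilinear_parity _ _ K).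
    + intros s. unfold G. rewrite Cmod_mult, Cmod_R, Rabs_sg, Rmult_1_l. apply HK.
    + apply hterm_dec, Ht.
    + intros m. apply (decZ_ext (fun s => trm2 l tau z m (m - s)%Z)); [intros; apply E|].
      apply (decZ_reindex (fun s => m - s)%Z (Z.abs m) (trm2 l tau z m)); [intros; lia|apply trm2_dec, Ht].
  - unfold Feven, Fodd, G.
    rewrite (CSeriesZ_ext (fun t => Cmult (sg (2 * t)) (hterm j tau 0 (2 * t)%Z))
      (fun t => hterm j tau 0 (2 * t)%Z)).
    2: { intros t. rewrite sg_even. ring. }
    (* Odd s carry the sign -1, the source of the difference in the conclusion. *)
    rewrite (CSeriesZ_ext (fun t => Cmult (sg (2 * t + 1)) (hterm j tau 0 (2 * t + 1)%Z))
      (fun t => Cmult (-1) (hterm j tau 0 (2 * t + 1)%Z))).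
    2: { intros t. rewrite sg_add, sg_even. f_equal. f_equal. unfold sg; simpl. ring. }
    rewrite (CSeriesZ_scal (-1)); [ring|].
    apply (decZ_reindex (fun t => 2 * t + 1)%Z 1 (hterm j tau 0)); [intros; lia|apply hterm_dec, Ht].
Qed.

(** Three vectors (e_j, o_j), j = 0, 2, 4, in a plane satisfy a linear relation whose coefficients
    are their 2x2 minors. The minors are values of the same addition formula at z = 0. *)
Lemma theta_quartic_relation (tau z : C) : 0 < Im tau ->
  let Th k := Theta k tau z in let T0 := Theta 1 tau 0 in let T1 := Theta 3 tau 0 in let T2 :=
    Theta 5 tau 0 in
  Cplus (Cminus (Cmult (Cmult T0 T0) (Cplus (Cminus (Cmult (Th 0%nat) (Th 4%nat)) (Cmult 4
    (Cmult (Th 1%nat) (Th 3%nat)))) (Cmult 3 (Cmult (Th 2%nat) (Th 2%nat)))))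
     (Cmult 4 (Cmult (Cmult T0 T1) (Cminus (Cmult (Th 0%nat) (Th 2%nat)) (Cmult (Th 1%nat) (Th 1%nat))))))
     (Cmult (Cminus (Cmult T0 T2) (Cmult T1 T1)) (Cmult (Th 0%nat) (Th 0%nat))) = 0.
Proof.
  intros Ht Th T0 T1 T2.
  assert (Z0 := Theta_even_0 0 tau Ht). assert (Z2 := Theta_even_0 1 tau Ht).
  assert (Z4 := Theta_even_0 2 tau Ht). assert (Z6 := Theta_even_0 3 tau Ht). simpl in Z0, Z2, Z4, Z6.
  (* [l0], [l2], [l4] expand (x - y)^j, the j-th derivative in w at w = 0 of theta(z + w) theta(z -
     w); [l24] expands (x + y)^2 (x - y)^4. *)
  set (l0 := (1, 0%nat, 0%nat) :: nil : poly2).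
  set (l2 := (1, 2%nat, 0%nat) :: (-2, 1%nat, 1%nat) :: (1, 0%nat, 2%nat) :: nil : poly2).
  set (l4 := (1, 4%nat, 0%nat) :: (-4, 3%nat, 1%nat) :: (6, 2%nat, 2%nat) :: (-4, 1%nat, 3%nat) :: (1,
    0%nat, 4%nat) :: nil : poly2).
  set (l24 := (1, 6%nat, 0%nat) :: (-2, 5%nat, 1%nat) :: (-1, 4%nat, 2%nat) :: (4, 3%nat, 3%nat) :: (-1,
    2%nat, 4%nat) :: (-2, 1%nat, 5%nat) :: (1, 0%nat, 6%nat) :: nil : poly2).
  assert (X0 := theta_addition 0 0 l0 tau z Ht ltac:(intros; simpl; ring)).
  assert (X2 := theta_addition 0 2 l2 tau z Ht ltac:(intros; simpl; ring)).
  assert (X4 := theta_addition 0 4 l4 tau z Ht ltac:(intros; simpl; ring)).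
  (* At z = 0 the even derivatives vanish, so the minors reduce to products of odd derivatives. *)
  assert (V02 := theta_addition 0 2 l2 tau 0 Ht ltac:(intros; simpl; ring)).
  assert (V04 := theta_addition 0 4 l4 tau 0 Ht ltac:(intros; simpl; ring)).
  assert (V24 := theta_addition 2 4 l24 tau 0 Ht ltac:(intros; simpl; ring)).
  simpl in X0, X2, X4, V02, V04, V24. rewrite Z0, Z2, Z4, ?Z6 in *.
  fold T0 T1 T2 in V02, V04, V24. fold (Th 0%nat) (Th 1%nat) (Th 2%nat) (Th 3%nat) (Th 4%nat) in X0, X2, X4.
  set (e := Feven 0 tau z) in *. set (o := Fodd 0 tau z) in *.
  set (e0 := Feven 0 tau 0) in *. set (o0 := Fodd 0 tau 0) in *.
  set (e2 := Feven 2 tau 0) in *. set (o2 := Fodd 2 tau 0) in *.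
  set (e4 := Feven 4 tau 0) in *. set (o4 := Fodd 4 tau 0) in *.
  set (A := Cplus (Cminus (Cmult (Th 0%nat) (Th 4%nat)) (Cmult 4 (Cmult (Th 1%nat) (Th 3%nat)))) (Cmult 3
    (Cmult (Th 2%nat) (Th 2%nat)))).
  set (Y := Cminus (Cmult (Th 0%nat) (Th 2%nat)) (Cmult (Th 1%nat) (Th 1%nat))).
  assert (HA : A = Cmult (/ 2) (Cminus (Cmult e4 o) (Cmult o4 e))) by (rewrite <- X4; unfold A; field).
  assert (HY : Y = Cmult (/ 2) (Cminus (Cmult e2 o) (Cmult o2 e))) by (rewrite <- X2; unfold Y; field).
  assert (H0 : Cmult (Th 0%nat) (Th 0%nat) = Cminus (Cmult e0 o) (Cmult o0 e)) by (rewrite <- X0; ring).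
  assert (W0 : Cmult T0 T0 = Cmult (- / 2) (Cminus (Cmult e2 o0) (Cmult o2 e0))) by (rewrite <- V02; field).
  assert (W1 : Cmult T0 T1 = Cmult (- / 8) (Cminus (Cmult e4 o0) (Cmult o4 e0))) by (rewrite <- V04; field).
  assert (W2 : Cminus (Cmult T0 T2) (Cmult T1 T1) = Cmult (- / 4) (Cminus (Cmult e4 o2) (Cmult o4 e2)))
    by (rewrite <- V24; field).
  rewrite HA, HY, H0, W0, W1, W2. field.
Qed.

(** * Finite Jacobi products *)

Lemma Cmod_1_sub_ge (x : C) : 1 - Cmod x <= Cmod (Cminus 1 x).
Proof.
  assert (H := Cmod_triangle (Cminus 1 x) x).
  replace (Cplus (Cminus 1 x) x) with (RtoC 1) in H by ring. rewrite Cmod_1 in H. lra.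
Qed.

Lemma C1_sub_neq_0 (x : C) : Cmod x < 1 -> Cminus 1 x <> 0.
Proof. intros H E. assert (P := Cmod_1_sub_ge x). rewrite E, Cmod_0 in P. lra. Qed.

Lemma climit_series_increments (u : nat -> C) (b : nat -> R) :
  (forall n, Cmod (Cminus (u (S n)) (u n)) <= b n) -> ex_series b -> exists l, climit u l.
Proof.
  intros H Hb. exists (Cplus (u 0%nat) (CSeries (fun n => Cminus (u (S n)) (u n)))).
  eapply climit_ext with (u := fun n => Cplus (u 0%nat) (csum (fun n => Cminus (u (S n)) (u n)) n)).
  - intros n. induction n as [|n IH]; simpl; [ring|].
    rewrite Cplus_assoc, IH. ring.
  - apply climit_plus; [apply climit_const|]. apply climit_CSeries. eapply asum_le; eassumption.
Qed.

Lemma Cmod_pow_lt_1 (x : C) (n : nat) : Cmod x < 1 -> Cmod (Cpow x (S n)) <= Cmod x.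
Proof.
  intros H. rewrite Cmod_pow. simpl. assert (P := Cmod_ge_0 x).
  assert (Cmod x ^ n <= 1). { rewrite <- (pow1 n). apply pow_incr. lra. } nra.
Qed.

(** * The q-Pochhammer symbol, its reciprocal and their limits *)

Fixpoint qpoch (q : C) (n : nat) : C :=
  match n with
  | O => 1
  | S k => Cmult (qpoch q k) (Cminus 1 (Cpow q (S k)))
  end.

Lemma qpoch_neq_0 (q : C) (n : nat) : Cmod q < 1 -> qpoch q n <> 0.
Proof.
  intros H. induction n as [|n IH].
  - simpl. intros E. apply (f_equal Cmod) in E. rewrite Cmod_1, Cmod_0 in E. lra.
  - apply Cmult_neq_0; [exact IH|]. apply C1_sub_neq_0. eapply Rle_lt_trans; [apply Cmod_pow_lt_1, H|exact H].
Qed.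

Lemma ex_series_pow_S (t : R) : 0 <= t < 1 -> ex_series (fun n => t ^ S n).
Proof.
  intros H. apply (ex_series_scal_l (V := R_NormedModule) t (fun n => t ^ n)).
  apply ex_series_geom. rewrite Rabs_pos_eq; lra.
Qed.

(** One exponential bounds both: for 0 <= y <= t < 1, each of 1 + y and 1 / (1 - y) is at most 1 + y
    / (1 - t) <= e^(y / (1 - t)). *)
Lemma qpoch_bounds (q : C) : Cmod q < 1 -> exists B, 0 < B /\
  forall n, Cmod (qpoch q n) <= B /\ Cmod (/ qpoch q n) <= B.
Proof.
  intros H. set (t := Cmod q) in *. assert (P : 0 <= t) by apply Cmod_ge_0.
  set (s := rsum (fun n => t ^ S n)).
  assert (Hs : forall n, 0 <= s n <= Series (fun n => t ^ S n)).
  { intros n. split.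
    - unfold s. induction n as [|n IH]; cbn [rsum]; [lra|]. assert (0 <= t ^ S n) by (apply pow_le;
      exact P). lra.
    - apply Rle_rsum_Series; [intros; apply pow_le; exact P|apply ex_series_pow_S; lra]. }
  assert (A : forall n, Cmod (qpoch q n) <= exp (s n / (1 - t)) /\ Cmod (/ qpoch q n) <= exp (s n / (1 - t))).
  { intros n. induction n as [|n [IH1 IH2]].
    - unfold s. cbn [rsum qpoch]. replace (/ 1)%C with (RtoC 1) by field.
      rewrite Cmod_1. replace (0 / (1 - t)) with 0 by (field; lra). rewrite exp_0. lra.
    - assert (Hq : Cmod (Cpow q (S n)) = t ^ S n) by (apply Cmod_pow).
      assert (Ht : 0 <= t ^ S n <= t).
      { split; [apply pow_le, P|]. rewrite <- Hq. apply Cmod_pow_lt_1, H. }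
      assert (Hx : Cmod (Cpow q (S n)) < 1) by lra.
      unfold s. cbn [rsum qpoch]. fold s. set (x := Cpow q (S n)) in *. set (y := t ^ S n) in *.
      replace ((s n + y) / (1 - t)) with (s n / (1 - t) + y / (1 - t)) by (field; lra).
      rewrite exp_plus.
      assert (X : 1 + y / (1 - t) <= exp (y / (1 - t))) by apply exp_ineq1_le.
      assert (Y0 : y <= y / (1 - t)).
      { apply Rmult_le_reg_r with (1 - t); [lra|]. replace (y / (1 - t) * (1 - t)) with y by (field;
        lra). nra. }
      split.
      + rewrite Cmod_mult. apply Rmult_le_compat; try apply Cmod_ge_0; [exact IH1|].
        unfold Cminus. eapply Rle_trans; [apply Cmod_triangle|]. rewrite Cmod_opp, Cmod_1. lra.
      + assert (N1 := qpoch_neq_0 q n H). assert (N2 := C1_sub_neq_0 x Hx).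
        replace (/ (qpoch q n * (1 - x)))%C with (Cmult (/ qpoch q n) (/ (1 - x))) by (field; split;
          assumption).
        rewrite Cmod_mult. apply Rmult_le_compat; try apply Cmod_ge_0; [exact IH2|].
        rewrite Cmod_inv by exact N2. assert (L := Cmod_1_sub_ge x).
        apply Rle_trans with (/ (1 - y)); [apply Rinv_le_contravar; lra|].
        eapply Rle_trans; [|exact X].
        apply Rmult_le_reg_r with ((1 - y) * (1 - t)); [apply Rmult_lt_0_compat; lra|].
        replace (/ (1 - y) * ((1 - y) * (1 - t))) with (1 - t) by (field; lra).
        replace ((1 + y / (1 - t)) * ((1 - y) * (1 - t))) with ((1 - y) * (1 - t) + y * (1 - y))
          by (field; lra).
        nra. }
  exists (exp (Series (fun n => t ^ S n) / (1 - t))). split; [apply exp_pos|].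
  intros n. assert (E : exp (s n / (1 - t)) <= exp (Series (fun n => t ^ S n) / (1 - t))).
  { apply exp_le. apply Rmult_le_compat_r; [left; apply Rinv_0_lt_compat; lra|apply Hs]. }
  destruct (A n). lra.
Qed.

(** The reciprocals get a limit of their own; P r = 1 then shows that neither limit is zero. *)
Lemma qpoch_limit (q : C) : Cmod q < 1 -> exists P r : C, P <> 0 /\ r <> 0 /\
  climit (qpoch q) P /\ climit (fun n => / qpoch q n)%C r.
Proof.
  intros H. destruct (qpoch_bounds q H) as [B [HB HBn]].
  assert (Ht : 0 <= Cmod q < 1) by (split; [apply Cmod_ge_0|exact H]).
  assert (Hser : ex_series (fun n => B * Cmod q ^ S n)).
  { apply (ex_series_scal_l (V := R_NormedModule)). apply ex_series_pow_S, Ht. }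
  destruct (climit_series_increments (qpoch q) (fun n => B * Cmod q ^ S n)) as [P HP].
  - intros n. cbn [qpoch].
    replace (Cminus (Cmult (qpoch q n) (Cminus 1 (Cpow q (S n)))) (qpoch q n)) with (Cmult
      (Copp (qpoch q n)) (Cpow q (S n))) by ring.
    rewrite Cmod_mult, Cmod_opp, Cmod_pow. apply Rmult_le_compat_r; [apply pow_le, Ht|apply HBn].
  - exact Hser.
  - destruct (climit_series_increments (fun n => / qpoch q n)%C (fun n => B * Cmod q ^ S n)) as [r Hr].
    + intros n.
      replace (Cminus (/ qpoch q (S n)) (/ qpoch q n)) with (Cmult (/ qpoch q (S n)) (Cpow q (S n))).
      * rewrite Cmod_mult, Cmod_pow. apply Rmult_le_compat_r; [apply pow_le, Ht|apply HBn].
      * assert (N := qpoch_neq_0 q (S n) H). assert (N' := qpoch_neq_0 q n H). cbn [qpoch] in *.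
        set (x := Cpow q (S n)) in *. field. split; [exact N'|intros E; apply N; rewrite E; ring].
    + exact Hser.
    + assert (E : Cmult P r = 1).
      { apply (climit_unique (fun n => Cmult (qpoch q n) (/ qpoch q n))); [apply climit_mult; assumption|].
        eapply climit_ext; [|apply climit_const]. intros n. symmetry. apply Cinv_r, qpoch_neq_0, H. }
      assert (C10 : RtoC 1 <> 0). { intros E'. apply (f_equal Cmod) in E'. rewrite Cmod_1, Cmod_0 in E'.
      lra. }
      exists P, r. split; [|split; [|split; assumption]].
      * intros E'. rewrite E', Cmult_0_l in E. symmetry in E. exact (C10 E).
      * intros E'. rewrite E', Cmult_0_r in E. symmetry in E. exact (C10 E).
Qed.

Definition rz (q : C) (k : Z) : C :=
  match k with
  | Zneg _ => 0
  | _ => (/ qpoch q (Z.to_nat k))%C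
  end.

Definition qz (tau : C) (n : Z) : C := e2pi (Cmult (IZR n) tau).

Lemma qz_add (tau : C) (m n : Z) : qz tau (m + n) = Cmult (qz tau m) (qz tau n).
Proof. unfold qz. rewrite <- e2pi_plus, plus_IZR, RtoC_plus. f_equal. ring. Qed.

Lemma qz_of_nat (tau : C) (n : nat) : qz tau (Z.of_nat n) = Cpow (e2pi tau) n.
Proof.
  induction n as [|n IH].
  - unfold qz. simpl. rewrite Cmult_0_l. apply e2pi_0.
  - rewrite Nat2Z.inj_succ. unfold Z.succ. rewrite qz_add, IH. simpl. rewrite Cmult_comm. f_equal.
    unfold qz. rewrite Cmult_1_l. reflexivity.
Qed.

Lemma Cmod_q_lt_1 (tau : C) : 0 < Im tau -> Cmod (e2pi tau) < 1.
Proof.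
  intros H. rewrite Cmod_e2pi, <- exp_0. apply exp_increasing. assert (P := PI_RGT_0). nra.
Qed.

Lemma rz_of_nat (q : C) (m : nat) : rz q (Z.of_nat m) = (/ qpoch q m)%C.
Proof. unfold rz. destruct (Z.of_nat m) eqn:E; try lia; rewrite <- E, Nat2Z.id; reflexivity. Qed.

(* The convention [1 / (q; q)_k = 0] for [k < 0] makes this recurrence valid on all of Z. *)
Lemma rz_pred (tau : C) (k : Z) : 0 < Im tau ->
  rz (e2pi tau) (k - 1) = Cmult (Cminus 1 (qz tau k)) (rz (e2pi tau) k).
Proof.
  intros Ht. assert (H := Cmod_q_lt_1 tau Ht).
  destruct (Z_le_gt_dec k 0) as [Hk|Hk].
  - destruct (Z.eq_dec k 0) as [->|Hn].
    + replace (qz tau 0) with (RtoC 1); [simpl; ring|].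
      symmetry. apply (qz_of_nat tau 0).
    + destruct k as [|p|p]; try lia. simpl. ring.
  - replace k with (Z.of_nat (S (Z.to_nat (k - 1)))) by lia. set (n := Z.to_nat (k - 1)).
    rewrite qz_of_nat. replace (Z.of_nat (S n) - 1)%Z with (Z.of_nat n) by lia.
    rewrite !rz_of_nat. assert (N := qpoch_neq_0 _ (S n) H). assert (N' := qpoch_neq_0 _ n H).
    cbn [qpoch] in *.
    set (x := Cpow (e2pi tau) (S n)) in *. field. split; [intros E; apply N; rewrite E; ring|exact N'].
Qed.

(* These are q^(1/8) / (q; q)_(2N+1) times the Laurent coefficients of
   (zeta^(1/2) - zeta^(-1/2)) prod_(1 <= i <= N) (1 - q^i zeta) (1 - q^i / zeta). *)
Definition jtp (tau : C) (N : nat) (n : Z) : C :=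
  Cmult (trm 0 tau 0 n)
    (Cmult (rz (e2pi tau) (Z.of_nat N - n)) (rz (e2pi tau) (Z.of_nat N + 1 + n))).

Lemma trm_succ (tau : C) (n : Z) : trm 0 tau 0 (n + 1) = Copp (Cmult (qz tau (n + 1)) (trm 0 tau 0 n)).
Proof.
  unfold trm. rewrite sg_add. replace (sg 1) with (-1) by (unfold sg; simpl; ring). cbn [Cpow].
  rewrite !Cmult_1_r.
  replace (qe (xh (n + 1)) tau 0) with (Cmult (qz tau (n + 1)) (qe (xh n) tau 0)).
  - rewrite RtoC_mult. ring.
  - unfold qe, qz. rewrite <- e2pi_plus. f_equal. unfold xh. rewrite plus_IZR, !RtoC_plus, RtoC_inv
    by lra. field.
Qed.

(** The next factor is (1 - Q zeta)(1 - Q / zeta) = 1 + Q^2 - Q (zeta + 1/zeta) with Q = q^(N+1);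
    the left side accounts for the passage from (q; q)_(2N+1) to (q; q)_(2N+3). *)
Lemma jtp_rec (tau : C) (N : nat) (n : Z) : 0 < Im tau ->
  let q2 := Cpow (e2pi tau) (2 * N + 2) in let q3 := Cpow (e2pi tau) (2 * N + 3) in
  Cmult (Cmult (Cminus 1 q2) (Cminus 1 q3)) (jtp tau (S N) n) =
  Cminus (Cmult (Cplus 1 q2) (jtp tau N n))
    (Cmult (Cpow (e2pi tau) (S N)) (Cplus (jtp tau N (n - 1)) (jtp tau N (n + 1)))).
Proof.
  intros Ht q2 q3. unfold jtp.
  rewrite (trm_succ tau n).
  assert (T : trm 0 tau 0 (n - 1) = Copp (Cmult (qz tau (- n)) (trm 0 tau 0 n))).
  { assert (Hn := trm_succ tau (n - 1)). replace (n - 1 + 1)%Z with n in Hn by lia.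
    rewrite Hn. replace (Copp (Cmult (qz tau (- n)) (Copp (Cmult (qz tau n) (trm 0 tau 0 (n - 1))))))
      with (Cmult (Cmult (qz tau (- n)) (qz tau n)) (trm 0 tau 0 (n - 1))) by ring.
    rewrite <- qz_add. replace (- n + n)%Z with 0%Z by lia. rewrite (qz_of_nat tau 0 : qz tau 0 = _).
    simpl. ring. }
  rewrite T.
  set (NN := Z.of_nat N). replace (Z.of_nat (S N)) with (NN + 1)%Z by lia.
  (* [R1] and [R2] have the largest indices that occur; every other [rz] is one of them times
     factors 1 - q^k, which leaves a rational identity in q^N, q^n and q. *)
  set (R1 := rz (e2pi tau) (NN + 1 - n)). set (R2 := rz (e2pi tau) (NN + 1 + 1 + n)).
  assert (A1 : rz (e2pi tau) (NN - n) = Cmult (Cminus 1 (qz tau (NN + 1 - n))) R1).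
  { unfold R1. rewrite <- rz_pred by exact Ht. f_equal; lia. }
  assert (A2 : rz (e2pi tau) (NN + 1 + n) = Cmult (Cminus 1 (qz tau (NN + 1 + 1 + n))) R2).
  { unfold R2. rewrite <- rz_pred by exact Ht. f_equal; lia. }
  assert (A3 : rz (e2pi tau) (NN - (n - 1)) = R1) by (unfold R1; f_equal; lia).
  assert (A4 : rz (e2pi tau) (NN + 1 + (n - 1)) = Cmult (Cminus 1 (qz tau (NN + 1 + n))) (Cmult
    (Cminus 1 (qz tau (NN + 1 + 1 + n))) R2)).
  { rewrite <- A2. rewrite <- rz_pred by exact Ht. f_equal; lia. }
  assert (A5 : rz (e2pi tau) (NN - (n + 1)) = Cmult (Cminus 1 (qz tau (NN - n))) (Cmult
    (Cminus 1 (qz tau (NN + 1 - n))) R1)).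
  { rewrite <- A1. rewrite <- rz_pred by exact Ht. f_equal; lia. }
  assert (A6 : rz (e2pi tau) (NN + 1 + (n + 1)) = R2) by (unfold R2; f_equal; lia).
  rewrite A1, A2, A3, A4, A5, A6.
  set (p := e2pi tau). set (a := qz tau NN). set (b := qz tau n). set (c := qz tau (- n)).
  assert (P1 : qz tau 1 = p). { unfold qz. rewrite Cmult_1_l. reflexivity. }
  assert (Hbc : Cmult b c = 1).
  { unfold b, c. rewrite <- qz_add. replace (n + - n)%Z with 0%Z by lia. apply (qz_of_nat tau 0). }
  assert (Ha : a = Cpow p N) by apply qz_of_nat.
  unfold Z.sub. rewrite !qz_add, P1. fold a b c.
  assert (Q2 : q2 = Cmult (Cmult a a) (Cmult p p)).
  { unfold q2. fold p. rewrite Ha. replace (2 * N + 2)%nat with (N + N + 2)%nat by lia.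
  rewrite !Cpow_add_r. simpl. ring. }
  assert (Q3 : q3 = Cmult (Cmult a a) (Cmult p (Cmult p p))).
  { unfold q3. fold p. rewrite Ha. replace (2 * N + 3)%nat with (N + N + 3)%nat by lia.
  rewrite !Cpow_add_r. simpl. ring. }
  rewrite Q2, Q3. cbn [Cpow]. rewrite <- Ha.
  assert (Hb0 : b <> 0) by apply e2pi_neq_0.
  assert (Hc : c = Cdiv 1 b). { rewrite <- Hbc. field. exact Hb0. }
  rewrite Hc. field. exact Hb0.
Qed.

(** * Weighted moments of the finite products *)

Definition exp_bounded (w : R -> R) : Prop :=
  exists K c, 0 <= K /\ 0 <= c /\ forall x, Rabs (w x) <= K * exp (c * Rabs x).

Lemma exp_bounded_const (a : R) : exp_bounded (fun _ => a).
Proof.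
  exists (Rabs a), 0. split; [apply Rabs_pos|split; [lra|]]. intros x. rewrite Rmult_0_l, exp_0. lra.
Qed.

Lemma exp_bounded_id : exp_bounded (fun x => x).
Proof.
  exists 1, 1. split; [lra|split; [lra|]]. intros x. assert (H := exp_ineq1_le (Rabs x)).
  rewrite !Rmult_1_l. lra.
Qed.

Lemma exp_bounded_mult (v w : R -> R) : exp_bounded v -> exp_bounded w -> exp_bounded (fun x => v x * w x).
Proof.
  intros [K [c [HK [Hc H]]]] [L [d [HL [Hd H']]]]. exists (K * L), (c + d).
  split; [nra|split; [lra|]]. intros x. rewrite Rabs_mult, Rmult_plus_distr_r, exp_plus.
  replace (K * L * (exp (c * Rabs x) * exp (d * Rabs x))) with ((K * exp (c * Rabs x)) * (L * exp (d * Rabs x))) by ring.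
  apply Rmult_le_compat; try apply Rabs_pos; [apply H|apply H'].
Qed.

Lemma exp_bounded_plus (v w : R -> R) : exp_bounded v -> exp_bounded w -> exp_bounded (fun x => v x + w x).
Proof.
  intros [K [c [HK [Hc H]]]] [L [d [HL [Hd H']]]]. exists (K + L), (c + d).
  split; [nra|split; [lra|]]. intros x. eapply Rle_trans; [apply Rabs_triang|].
  specialize (H x). specialize (H' x). assert (P := Rabs_pos x).
  assert (E1 : exp (c * Rabs x) <= exp ((c + d) * Rabs x)) by (apply exp_le; nra).
  assert (E2 : exp (d * Rabs x) <= exp ((c + d) * Rabs x)) by (apply exp_le; nra).
  nra.
Qed.

Lemma exp_bounded_minus (v w : R -> R) : exp_bounded v -> exp_bounded w -> exp_bounded (fun x => v x - w x).
Proof.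
  intros Hv [L [d [HL [Hd H']]]]. apply (exp_bounded_plus v (fun x => - w x)); [exact Hv|].
  exists L, d. split; [exact HL|split; [exact Hd|]]. intros x. rewrite Rabs_Ropp. apply H'.
Qed.

(** An exponential bound on the weight is stable under products and unit shifts, and Gaussian decay
    absorbs it. *)
Lemma weighted_dec (w : R -> R) (tau : C) : 0 < Im tau -> exp_bounded w ->
  exists K, 0 <= K /\ forall n, Cmod (Cmult (w (xh n)) (trm 0 tau 0 n)) <= K * ez n.
Proof.
  intros Ht [K [c [HK [_ H]]]]. destruct (qe_dec 0 tau 0 c 1 1 Ht) as [L [HL HLn]].
  exists (K * L). split; [nra|]. intros n. rewrite Cmod_mult, Cmod_R, Cmod_trm.
  specialize (HLn (xh n) n (xh_abs n)). specialize (H (xh n)). simpl in *. rewrite Rmult_1_l in *.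
  assert (P := Cmod_ge_0 (qe (xh n) tau 0)).
  apply Rle_trans with (K * exp (c * Rabs (xh n)) * Cmod (qe (xh n) tau 0)).
  - apply Rmult_le_compat_r; assumption.
  - rewrite !Rmult_assoc. apply Rmult_le_compat_l; assumption.
Qed.

Lemma jtp_weighted_dec (w : R -> R) (tau : C) : 0 < Im tau -> exp_bounded w ->
  exists K, forall N n, Cmod (Cmult (w (xh n)) (jtp tau N n)) <= K * ez n.
Proof.
  intros Ht Hw. destruct (weighted_dec w tau Ht Hw) as [K [HK0 HK]].
  destruct (qpoch_bounds (e2pi tau) (Cmod_q_lt_1 tau Ht)) as [B [HB HBn]].
  assert (HR : forall k, Cmod (rz (e2pi tau) k) <= B).
  { intros [|p|p]; unfold rz; [apply (HBn (Z.to_nat 0))|apply HBn|rewrite Cmod_0; lra]. }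
  exists (K * (B * B)). intros N n. unfold jtp. rewrite Cmult_assoc, Cmod_mult, (Cmod_mult (rz _ _)).
  replace (K * (B * B) * ez n) with ((K * ez n) * (B * B)) by ring.
  apply Rmult_le_compat; [apply Cmod_ge_0| |apply HK|].
  - apply Rmult_le_pos; apply Cmod_ge_0.
  - apply Rmult_le_compat; try apply Cmod_ge_0; apply HR.
Qed.

Definition mom (w : R -> R) (tau : C) (N : nat) : C :=
  CSeriesZ (fun n => Cmult (w (xh n)) (jtp tau N n)).

Lemma xh_add (n k : Z) : xh (n + k) = xh n + IZR k.
Proof. unfold xh. rewrite plus_IZR. ring. Qed.

(** Summation by parts: the shifts of the coefficients in [jtp_rec] are moved onto the weight, where
    w(x + 1) + w(x - 1) = 2 w(x) + c v(x). *)
Lemma mom_rec (w v : R -> R) (c : R) (tau : C) (N : nat) : 0 < Im tau ->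
  exp_bounded w -> exp_bounded v ->
  (forall x, w (x + 1) - 2 * w x + w (x - 1) = c * v x) ->
  let q2 := Cpow (e2pi tau) (2 * N + 2) in let q3 := Cpow (e2pi tau) (2 * N + 3) in
  Cmult (Cmult (Cminus 1 q2) (Cminus 1 q3)) (mom w tau (S N)) =
  Cminus (Cmult (Cplus 1 q2) (mom w tau N))
    (Cmult (Cpow (e2pi tau) (S N)) (Cplus (Cmult 2 (mom w tau N)) (Cmult c (mom v tau N)))).
Proof.
  intros Ht Hw Hv Hrec q2 q3.
  destruct (jtp_weighted_dec w tau Ht Hw) as [K HK]. destruct (jtp_weighted_dec v tau Ht Hv) as [L HL].
  assert (Dw : forall M, decZ (fun n => Cmult (w (xh n)) (jtp tau M n))) by (intros M; exists K; apply HK).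
  assert (Dv : forall M, decZ (fun n => Cmult (v (xh n)) (jtp tau M n))) by (intros M; exists L; apply HL).
  set (a := fun n => Cmult (RtoC (w (xh (n + 1)%Z))) (jtp tau N n)).
  set (b := fun n => Cmult (RtoC (w (xh (n - 1)%Z))) (jtp tau N n)).
  assert (Hab : forall n, Cplus (a n) (b n) = Cplus (Cmult 2 (Cmult (w (xh n)) (jtp tau N n))) (Cmult c
    (Cmult (v (xh n)) (jtp tau N n)))).
  { intros n. unfold a, b. rewrite !Cmult_assoc, <- !RtoC_mult, <- !Cmult_plus_distr_r, <- !RtoC_plus.
    f_equal. f_equal. specialize (Hrec (xh n)). rewrite xh_add. unfold Z.sub. rewrite xh_add.
    unfold Rminus in Hrec. rewrite opp_IZR. lra. }
  (* A unit shift of the weight enlarges its exponential bound only by a constant factor, so the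
     shifted series converge too. *)
  assert (Da' : decZ (fun n => Cmult (w (xh n)) (jtp tau N (n - 1)))).
  { assert (E1 : exp_bounded (fun x => w (x + 1))).
    { destruct Hw as [K' [c' [HK' [Hc' H]]]]. exists (K' * exp c'), c'.
      split; [apply Rmult_le_pos; [exact HK'|left; apply exp_pos]|split; [exact Hc'|]]. intros x.
      eapply Rle_trans; [apply H|]. rewrite Rmult_assoc, <- exp_plus. apply Rmult_le_compat_l; [exact HK'|].
      apply exp_le. assert (T := Rabs_triang x 1). rewrite Rabs_R1 in T. nra. }
    destruct (jtp_weighted_dec _ tau Ht E1) as [K' HK'].
    apply (decZ_ext (fun n => Cmult (w (xh (n - 1) + 1)) (jtp tau N (n - 1)))).
    - intros n. f_equal. f_equal. f_equal. unfold Z.sub. rewrite xh_add, opp_IZR. ring.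
    - apply (decZ_reindex (fun n => n - 1)%Z 1 (fun n => Cmult (w (xh n + 1)) (jtp tau N n))); [intros; lia|].
      exists K'. intros n. apply HK'. }
  assert (Db' : decZ (fun n => Cmult (w (xh n)) (jtp tau N (n + 1)))).
  { assert (E1 : exp_bounded (fun x => w (x - 1))).
    { destruct Hw as [K' [c' [HK' [Hc' H]]]]. exists (K' * exp c'), c'.
      split; [apply Rmult_le_pos; [exact HK'|left; apply exp_pos]|split; [exact Hc'|]]. intros x.
      eapply Rle_trans; [apply H|]. rewrite Rmult_assoc, <- exp_plus. apply Rmult_le_compat_l; [exact HK'|].
      apply exp_le. assert (T := Rabs_triang x (-1)). rewrite (Rabs_left (-1)) in T by lra.
      replace (x - 1) with (x + -1) by ring. nra. }
    destruct (jtp_weighted_dec _ tau Ht E1) as [K' HK'].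
    apply (decZ_ext (fun n => Cmult (w (xh (n + 1) - 1)) (jtp tau N (n + 1)))).
    - intros n. f_equal. f_equal. f_equal. rewrite xh_add. ring.
    - apply (decZ_reindex (fun n => n + 1)%Z 1 (fun n => Cmult (w (xh n - 1)) (jtp tau N n))); [intros; lia|].
      exists K'. intros n. apply HK'. }
  assert (Sa : CSeriesZ (fun n => Cmult (w (xh n)) (jtp tau N (n - 1))) = CSeriesZ a).
  { rewrite <- (CSeriesZ_shift 1 _ Da'). apply CSeriesZ_ext. intros n. unfold a.
    replace (n + 1 - 1)%Z with n by lia. reflexivity. }
  assert (Sb : CSeriesZ (fun n => Cmult (w (xh n)) (jtp tau N (n + 1))) = CSeriesZ b).
  { rewrite <- (CSeriesZ_shift (-1) _ Db'). apply CSeriesZ_ext. intros n. unfold b.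
    replace (n + -1 + 1)%Z with n by lia. reflexivity. }
  assert (Da : decZ a).
  { apply (decZ_ext (fun n => Cmult (w (xh (n + 1)%Z)) (jtp tau N (n + 1 - 1)))).
    - intros n. unfold a. replace (n + 1 - 1)%Z with n by lia. reflexivity.
    - apply (decZ_reindex (fun n => n + 1)%Z 1 (fun n => Cmult (w (xh n)) (jtp tau N (n - 1)))); [intros;
      lia|exact Da']. }
  assert (Db : decZ b).
  { apply (decZ_ext (fun n => Cmult (w (xh (n - 1)%Z)) (jtp tau N (n - 1 + 1)))).
    - intros n. unfold b. replace (n - 1 + 1)%Z with n by lia. reflexivity.
    - apply (decZ_reindex (fun n => n - 1)%Z 1 (fun n => Cmult (w (xh n)) (jtp tau N (n + 1)))); [intros;
      lia|exact Db']. }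
  assert (Sab : Cplus (CSeriesZ a) (CSeriesZ b) = Cplus (Cmult 2 (mom w tau N)) (Cmult c (mom v tau N))).
  { unfold mom. rewrite <- !CSeriesZ_scal by apply Dw || apply Dv.
    rewrite <- !CSeriesZ_plus; [|apply decZ_scal, Dw|apply decZ_scal, Dv|exact Da|exact Db].
    apply CSeriesZ_ext, Hab. }
  rewrite <- Sab, <- Sa, <- Sb. unfold mom.
  rewrite <- CSeriesZ_plus by assumption.
  rewrite <- !CSeriesZ_scal; [|apply decZ_plus; assumption|apply Dw|apply Dw].
  set (f1 := fun n => Cmult (Cplus 1 q2) _). set (f2 := fun n => Cmult (Cpow _ _) _).
  replace (Cminus (CSeriesZ f1) (CSeriesZ f2)) with (Cplus (CSeriesZ f1) (Cmult (-1) (CSeriesZ f2))) by ring.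
  assert (D2 : decZ f2) by (apply decZ_scal, decZ_plus; assumption).
  rewrite <- CSeriesZ_scal, <- CSeriesZ_plus; [|apply decZ_scal, Dw|apply decZ_scal, D2|exact D2].
  apply CSeriesZ_ext. intros n. unfold f1, f2.
  transitivity (Cmult (w (xh n)) (Cmult (Cmult (Cminus 1 q2) (Cminus 1 q3)) (jtp tau (S N) n))); [ring|].
  unfold q2, q3. rewrite (jtp_rec tau N n Ht). ring.
Qed.

Lemma CSeriesZ_two (f : Z -> C) : (forall n, n <> 0%Z -> n <> (-1)%Z -> f n = 0) ->
  CSeriesZ f = Cplus (f 0%Z) (f (-1)%Z).
Proof.
  intros H. apply CSeriesZ_unique.
  - exists ((Cmod (f 0%Z) + Cmod (f (-1)%Z)) * exp 1). intros n.
    assert (P0 := Cmod_ge_0 (f 0%Z)). assert (P1 := Cmod_ge_0 (f (-1)%Z)).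
    assert (E1 : 1 <= exp 1) by (generalize (exp_ineq1_le 1); lra).
    destruct (Z.eq_dec n 0) as [->|N0]; [|destruct (Z.eq_dec n (-1)) as [->|N1]].
    + unfold ez. simpl. rewrite Ropp_0, exp_0. nra.
    + unfold ez. simpl. rewrite Rmult_assoc, <- exp_plus, Rplus_opp_r, exp_0. lra.
    + rewrite H by assumption. rewrite Cmod_0. apply Rmult_le_pos; [nra|left; apply ez_pos].
  - eapply climit_ext_from with (N0 := 1%nat); [|apply climit_const].
    intros n Hn. destruct n as [|n]; [lia|]. induction n as [|n IH].
    + unfold zsum. simpl. ring.
    + unfold zsum in *. cbn [csum] in *. rewrite <- IH by lia.
      rewrite (H (Z.of_nat (S n))), (H (- Z.of_nat (S n) - 1)%Z) by lia. ring.
Qed.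

(** The empty product leaves zeta^(1/2) - zeta^(-1/2): for n other than 0 and -1, one of the two
    [rz] factors has a negative index and is 0. *)
Lemma mom_0 (w : R -> R) (tau : C) : 0 < Im tau ->
  mom w tau 0 = Cmult (w (/ 2) - w (- / 2)) (Cmult (qe (/ 2) tau 0) (/ qpoch (e2pi tau) 1)).
Proof.
  intros Ht. unfold mom. rewrite CSeriesZ_two.
  - unfold jtp, trm.
    replace (xh 0) with (/ 2) by (unfold xh; lra). replace (xh (-1)) with (- / 2) by (unfold xh; lra).
    replace (qe (- / 2) tau 0) with (qe (/ 2) tau 0).
    2: { unfold qe. f_equal. rewrite !Cmult_0_r. f_equal. f_equal. rewrite RtoC_opp. field. }
    simpl Z.of_nat. simpl Z.sub. simpl Z.add.
    replace (sg 0) with 1 by reflexivity. replace (sg (-1)) with (-1) by (unfold sg; simpl; field).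
    assert (H1 := qpoch_neq_0 (e2pi tau) 1 (Cmod_q_lt_1 tau Ht)).
    simpl rz. change (Pos.to_nat 1) with 1%nat. change (qpoch (e2pi tau) 0) with (RtoC 1). cbn [Cpow].
    cbn [qpoch Cpow] in *. field. intros E. apply H1. rewrite <- E. ring.
  - intros n N0 N1. unfold jtp. destruct (Z_lt_le_dec n 0).
    + assert (E : rz (e2pi tau) (Z.of_nat 0 + 1 + n) = 0).
      { change (Z.of_nat 0 + 1)%Z with 1%Z. unfold rz. destruct (1 + n)%Z eqn:En; try lia. reflexivity.
      } rewrite E. ring.
    + assert (E : rz (e2pi tau) (Z.of_nat 0 - n) = 0).
      { change (Z.of_nat 0 - n)%Z with (- n)%Z. unfold rz. destruct (- n)%Z eqn:En; try lia. reflexivity.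
      } rewrite E. ring.
Qed.

Lemma climit_rz (q r : C) (k : Z) : climit (fun n => / qpoch q n)%C r ->
  climit (fun N => rz q (Z.of_nat N + k)) r.
Proof.
  intros H eps He. destruct (H eps He) as [N0 HN0]. exists (N0 + Z.to_nat (Z.abs k))%nat. intros n Hn.
  replace (Z.of_nat n + k)%Z with (Z.of_nat (Z.to_nat (Z.of_nat n + k))) by lia.
  rewrite rz_of_nat. apply HN0. lia.
Qed.

Definition wtheta (w : R -> R) (tau : C) : C := CSeriesZ (fun n => Cmult (w (xh n)) (trm 0 tau 0 n)).

(** The finite Jacobi product in the limit, one moment at a time: both reciprocal symbols tend to r,
    under a bound uniform in N. *)
Lemma mom_limit (w : R -> R) (tau r : C) : 0 < Im tau -> exp_bounded w ->
  climit (fun n => / qpoch (e2pi tau) n)%C r ->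
  climit (mom w tau) (Cmult (Cmult r r) (wtheta w tau)).
Proof.
  intros Ht Hw Hr. unfold wtheta. destruct (weighted_dec w tau Ht Hw) as [K0 [_ HK0]].
  rewrite <- CSeriesZ_scal by (exists K0; exact HK0).
  destruct (jtp_weighted_dec w tau Ht Hw) as [K HK].
  apply (tanneryZ (fun N n => Cmult (w (xh n)) (jtp tau N n)) _ K HK).
  intros n. unfold jtp.
  replace (Cmult (Cmult r r) (Cmult (w (xh n)) (trm 0 tau 0 n)))
    with (Cmult (w (xh n)) (Cmult (trm 0 tau 0 n) (Cmult r r))) by ring.
  apply climit_scal, climit_scal, climit_mult.
  - apply (climit_rz _ _ (- n) Hr).
  - apply climit_ext with (u := fun N => rz (e2pi tau) (Z.of_nat N + (1 + n)));
    [|apply (climit_rz _ _ (1 + n) Hr)].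
    intros N. f_equal. lia.
Qed.

(* [W_k(n + 1/2) = (n + 1/2) prod_(j < k) (n - j) (n + 1 + j)] are the weights whose second
   differences are [2 k (2 k + 1) W_(k-1)]. *)
Definition W0 (x : R) : R := x.
Definition W1 (x : R) : R := x * (x * x - 1 / 4).
Definition W2 (x : R) : R := x * (x * x - 1 / 4) * (x * x - 9 / 4).
Definition W3 (x : R) : R := x * (x * x - 1 / 4) * (x * x - 9 / 4) * (x * x - 25 / 4).

Lemma W_exp_bounded : exp_bounded W0 /\ exp_bounded W1 /\ exp_bounded W2 /\ exp_bounded W3.
Proof.
  unfold W0, W1, W2, W3.
  assert (I := exp_bounded_id).
  assert (F : forall a, exp_bounded (fun x => x * x - a)).
  { intros a. apply (exp_bounded_minus (fun x => x * x) (fun _ => a)); [apply exp_bounded_mult;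
    exact I|apply exp_bounded_const]. }
  assert (B1 : exp_bounded (fun x => x * (x * x - 1 / 4))) by (apply (exp_bounded_mult (fun x => x));
    [exact I|apply F]).
  assert (B2 : exp_bounded (fun x => x * (x * x - 1 / 4) * (x * x - 9 / 4))).
  { apply (exp_bounded_mult (fun x => x * (x * x - 1 / 4))); [exact B1|apply F]. }
  split; [exact I|split; [exact B1|split; [exact B2|]]].
  apply (exp_bounded_mult (fun x => x * (x * x - 1 / 4) * (x * x - 9 / 4))); [exact B2|apply F].
Qed.

(** This is y_(n+1) of the overview; indices start at 0. *)
Definition yq (tau : C) (n : nat) : C :=
  Cdiv (Cpow (e2pi tau) (S n)) (Cmult (Cminus 1 (Cpow (e2pi tau) (S n))) (Cminus 1 (Cpow (e2pi tau) (S n)))).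

Definition psum (k : nat) (tau : C) (N : nat) : C := csum (fun n => Cpow (yq tau n) k) N.

Lemma qpow_neq (tau : C) (n : nat) : 0 < Im tau -> Cminus 1 (Cpow (e2pi tau) (S n)) <> 0.
Proof.
  intros Ht. apply C1_sub_neq_0. assert (H := Cmod_q_lt_1 tau Ht).
  eapply Rle_lt_trans; [apply Cmod_pow_lt_1, H|exact H].
Qed.

(** With Q = q^(N+1) one has 1 + q^(2N+2) - 2 Q = (1 - Q)^2; taking out this square turns Q into
    [yq tau N]. *)
Lemma mom_rec_y (w v : R -> R) (c : R) (tau : C) (N : nat) : 0 < Im tau ->
  exp_bounded w -> exp_bounded v ->
  (forall x, w (x + 1) - 2 * w x + w (x - 1) = c * v x) ->
  mom w tau (S N) = Cmult (Cdiv (Cmult (Cminus 1 (Cpow (e2pi tau) (S N))) (Cminus 1 (Cpow (e2pi tau) (S N))))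
      (Cmult (Cminus 1 (Cpow (e2pi tau) (S (2 * N + 1)))) (Cminus 1 (Cpow (e2pi tau) (S (2 * N + 2))))))
    (Cminus (mom w tau N) (Cmult c (Cmult (yq tau N) (mom v tau N)))).
Proof.
  intros Ht Hw Hv Hr. assert (H := mom_rec w v c tau N Ht Hw Hv Hr). cbv zeta in H.
  assert (N1 := qpow_neq tau N Ht). assert (N2 := qpow_neq tau (2 * N + 1) Ht). assert (N3 :=
    qpow_neq tau (2 * N + 2) Ht).
  replace (2 * N + 2)%nat with (S (2 * N + 1)) in H by lia. replace (2 * N + 3)%nat
    with (S (S (2 * N + 1))) in H by lia.
  replace (2 * N + 2)%nat with (S (2 * N + 1)) in * by lia.
  set (q2 := Cpow (e2pi tau) (S (2 * N + 1))) in *. set (q3 := Cpow (e2pi tau) (S (S (2 * N + 1)))) in *.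
  assert (E2 : q2 = Cmult (Cpow (e2pi tau) (S N)) (Cpow (e2pi tau) (S N))).
  { unfold q2. replace (S (2 * N + 1)) with (S N + S N)%nat by lia. apply Cpow_add_r. }
  unfold yq. set (Q := Cpow (e2pi tau) (S N)) in *.
  replace (mom w tau (S N)) with (Cdiv (Cmult (Cmult (Cminus 1 q2) (Cminus 1 q3)) (mom w tau (S N)))
    (Cmult (Cminus 1 q2) (Cminus 1 q3))).
  - rewrite H. rewrite E2 in *. field. repeat split; assumption.
  - field. split; assumption.
Qed.

(** A new factor turns the elementary symmetric function e_k into e_k + y e_(k-1). With the
    constants 2 k (2 k + 1) = 6, 20, 42 of the second differences, the moments are (-1)^k (2 k + 1)!
    e_k times that of [W0]. Newton's identities rewrite e_k in power sums, so that 60 = 5!/2 and 840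
    = 7!/6. *)
Lemma mom_W (tau : C) (N : nat) : 0 < Im tau ->
  let p1 := psum 1 tau N in let p2 := psum 2 tau N in let p3 := psum 3 tau N in
  let m := mom W0 tau N in
  mom W1 tau N = Cmult (Cmult (-6) p1) m /\
  mom W2 tau N = Cmult (Cmult 60 (Cminus (Cmult p1 p1) p2)) m /\
  mom W3 tau N = Cmult (Cmult (-840) (Cplus (Cminus (Cmult p1 (Cmult p1 p1)) (Cmult 3 (Cmult p1 p2)))
    (Cmult 2 p3))) m.
Proof.
  intros Ht. destruct W_exp_bounded as [B0 [B1 [B2 B3]]].
  assert (Bz := exp_bounded_const 0).
  induction N as [|N IH]; cbv zeta in *.
  - rewrite !mom_0 by exact Ht. unfold psum. simpl csum.
    assert (E : forall a b, a = b -> RtoC (a - b) = 0) by (intros a b ->; f_equal; ring).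
    rewrite <- !RtoC_minus.
    rewrite (E (W1 (/ 2)) (W1 (- / 2))) by (unfold W1; field).
    rewrite (E (W2 (/ 2)) (W2 (- / 2))) by (unfold W2; field).
    rewrite (E (W3 (/ 2)) (W3 (- / 2))) by (unfold W3; field).
    split; [|split]; ring.
  - destruct IH as [I1 [I2 I3]].
    rewrite (mom_rec_y W0 (fun _ => 0) 0 tau N Ht B0 Bz) by (intros; unfold W0; ring).
    rewrite (mom_rec_y W1 W0 6 tau N Ht B1 B0) by (intros; unfold W0, W1; field).
    rewrite (mom_rec_y W2 W1 20 tau N Ht B2 B1) by (intros; unfold W1, W2; field).
    rewrite (mom_rec_y W3 W2 42 tau N Ht B3 B2) by (intros; unfold W2, W3; field).
    rewrite I1, I2, I3. unfold psum. cbn [csum]. fold (psum 1 tau N) (psum 2 tau N) (psum 3 tau N).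
    cbn [Cpow].
    set (rho := Cdiv _ _). set (y := yq tau N).
    split; [|split]; ring.
Qed.

(** In the limit this is Jacobi's theta'(0) = q^(1/8) times the cube of (q; q)_infinity, the source
    of the nonvanishing of [Theta 1 tau 0]. *)
Lemma mom_W0_closed (tau : C) (N : nat) : 0 < Im tau ->
  mom W0 tau N = Cmult (qe (/ 2) tau 0)
    (Cmult (Cmult (qpoch (e2pi tau) N) (qpoch (e2pi tau) N)) (/ qpoch (e2pi tau) (2 * N + 1))).
Proof.
  intros Ht. destruct W_exp_bounded as [B0 _]. assert (H := Cmod_q_lt_1 tau Ht).
  induction N as [|N IH].
  - rewrite mom_0 by exact Ht. unfold W0. rewrite <- RtoC_minus. replace (/ 2 - - / 2) with 1 by field.
    change (qpoch (e2pi tau) 0) with (RtoC 1). change (2 * 0 + 1)%nat with 1%nat. ring.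
  - rewrite (mom_rec_y W0 (fun _ => 0) 0 tau N Ht B0 (exp_bounded_const 0)) by (intros; unfold W0; ring).
    rewrite IH. replace (2 * S N + 1)%nat with (S (S (2 * N + 1))) by lia.
    replace (2 * N + 2)%nat with (S (2 * N + 1)) by lia.
    assert (P1 := qpoch_neq_0 (e2pi tau) (2 * N + 1) H).
    assert (N2 := qpow_neq tau (2 * N + 1) Ht). assert (N3 := qpow_neq tau (S (2 * N + 1)) Ht).
    cbn [qpoch]. set (a := Cpow _ (S (2 * N + 1))) in *. set (b := Cpow _ (S (S (2 * N + 1)))) in *.
    field. repeat split; assumption.
Qed.

(** * Power sums and Lambert series *)

Lemma ex_series_pow_geom (k : nat) (t : R) : 0 < t < 1 -> ex_series (fun m => INR m ^ k * t ^ m).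
Proof.
  intros Ht. set (a := - ln t). assert (Ha : 0 < a). { unfold a. assert (H :=
    ln_increasing t 1 (proj1 Ht) (proj2 Ht)). rewrite ln_1 in H. lra. }
  assert (E : forall m, t ^ m = exp (- a * INR m)).
  { intros m. induction m as [|m IH].
    - simpl. rewrite Rmult_0_r, exp_0. reflexivity.
    - rewrite S_INR, Rmult_plus_distr_l, exp_plus, <- IH, Rmult_1_r. unfold a. rewrite Ropp_involutive,
      exp_ln by lra. simpl. ring. }
  (* With this [eps], k eps <= a / 2, so m^k costs at most half of the exponential decay; k + 1
     keeps the denominator positive. *)
  set (eps := a / (2 * (INR k + 1))). assert (Pk := pos_INR k).
  assert (Heps : 0 < eps) by (apply Rdiv_lt_0_compat; lra).
  apply (ex_series_le (V := R_CompleteNormedModule) _ (fun m => (/ eps) ^ k * exp (- a / 2) ^ m)).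
  - intros m. change (Rabs (INR m ^ k * t ^ m) <= (/ eps) ^ k * exp (- a / 2) ^ m).
    assert (Pm := pos_INR m).
    rewrite Rabs_pos_eq by (apply Rmult_le_pos; apply pow_le; lra).
    assert (H1 : (eps * INR m) ^ k <= exp (a / 2 * INR m)).
    { apply Rle_trans with (exp (INR k * (eps * INR m))).
      - assert (Py : 0 <= eps * INR m) by (apply Rmult_le_pos; lra). generalize (eps * INR m) Py. clear.
        intros y Py. induction k as [|k IH].
        + simpl. rewrite Rmult_0_l, exp_0. lra.
        + rewrite S_INR. simpl. replace ((INR k + 1) * y) with (y + INR k * y) by ring.
          rewrite exp_plus. assert (H := exp_ineq1_le y).
          apply Rmult_le_compat; [exact Py|apply pow_le, Py|lra|exact IH].
      - apply exp_le. rewrite <- Rmult_assoc. apply Rmult_le_compat_r; [exact Pm|].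
        unfold eps. apply Rmult_le_reg_r with (2 * (INR k + 1)); [lra|].
        replace (INR k * (a / (2 * (INR k + 1))) * (2 * (INR k + 1))) with (INR k * a) by (field; lra).
        nra. }
    replace (INR m ^ k) with ((/ eps) ^ k * (eps * INR m) ^ k).
    + rewrite Rmult_assoc. apply Rmult_le_compat_l; [apply pow_le; left; apply Rinv_0_lt_compat, Heps|].
      rewrite E.
      replace (exp (- a / 2) ^ m) with (exp (a / 2 * INR m) * exp (- a * INR m)).
      * apply Rmult_le_compat_r; [left; apply exp_pos|exact H1].
      * rewrite <- exp_plus. clear. induction m as [|m IH].
        -- simpl. rewrite !Rmult_0_r, Rplus_0_r. apply exp_0.
        -- rewrite S_INR. simpl. rewrite <- IH, <- exp_plus. f_equal. field.
    + rewrite <- Rpow_mult_distr. f_equal. field. lra.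
  - apply (ex_series_scal_l (V := R_NormedModule)). apply ex_series_geom.
    rewrite Rabs_pos_eq by (left; apply exp_pos). rewrite <- exp_0. apply exp_increasing. lra.
Qed.

Lemma Cmod_q_gt_0 (tau : C) : 0 < Cmod (e2pi tau).
Proof. rewrite Cmod_e2pi. apply exp_pos. Qed.

(** For k = 1, 2, 3, the coefficient of t^m in (t / (1 - t)^2)^k: the binomial coefficient m + k - 1
    over 2 k - 1 as a polynomial in m. *)
Definition psum_weight (k : nat) (m : nat) : R :=
  let x := INR m in
  match k with
  | 1%nat => x
  | 2%nat => (x ^ 3 - x) / 6
  | 3%nat => (x ^ 5 - 5 * x ^ 3 + 4 * x) / 120
  | _ => 0
  end.

Lemma asum_pow (k : nat) (x : C) : 0 < Cmod x < 1 -> asum (fun m => Cmult (INR m ^ k)%R (Cpow x m)).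
Proof.
  intros H. eapply asum_le; [|apply (ex_series_pow_geom k (Cmod x) H)]. intros m.
  rewrite Cmod_mult, Cmod_R, Cmod_pow, Rabs_pos_eq by (apply pow_le, pos_INR). apply Rle_refl.
Qed.

Lemma asum_psum_weight (k : nat) (u : nat -> C) :
  (forall j, (1 <= j)%nat -> asum (fun m => Cmult (INR m ^ j)%R (u m))) ->
  asum (fun m => Cmult (psum_weight k m) (u m)).
Proof.
  intros H.
  assert (A : forall a b c, asum (fun m => Cplus (Cmult a (Cmult (INR m ^ 5)%R (u m)))
     (Cplus (Cmult b (Cmult (INR m ^ 3)%R (u m))) (Cmult c (Cmult (INR m ^ 1)%R (u m)))))).
  { intros a b c. apply asum_plus; [|apply asum_plus]; apply asum_scal, H; lia. }
  assert (B : forall a b c : R, (forall m, psum_weight k m =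
    a * INR m ^ 5 + (b * INR m ^ 3 + c * INR m ^ 1)) ->
    asum (fun m => Cmult (psum_weight k m) (u m))).
  { intros a b c E. eapply asum_ext; [|apply (A a b c)]. intros m. rewrite E, !RtoC_plus, !RtoC_mult. ring. }
  destruct k as [|[|[|[|k]]]].
  - apply (B 0 0 0). intros; unfold psum_weight; ring.
  - apply (B 0 0 1). intros; unfold psum_weight; ring.
  - apply (B 0 (/ 6) (- / 6)). intros; unfold psum_weight; field.
  - apply (B (/ 120) (- 5 / 120) (4 / 120)). intros; unfold psum_weight; field.
  - apply (B 0 0 0). intros; unfold psum_weight; ring.
Qed.

Lemma CSeries_psum_weight (u : nat -> C) :
  (forall j, (1 <= j)%nat -> asum (fun m => Cmult (INR m ^ j)%R (u m))) ->
  let S j := CSeries (fun m => Cmult (INR m ^ j)%R (u m)) in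
  CSeries (fun m => Cmult (psum_weight 1 m) (u m)) = S 1%nat /\
  CSeries (fun m => Cmult (psum_weight 2 m) (u m)) = Cmult (/ 6) (Cminus (S 3%nat) (S 1%nat)) /\
  CSeries (fun m => Cmult (psum_weight 3 m) (u m)) =
    Cmult (/ 120) (Cplus (Cminus (S 5%nat) (Cmult 5 (S 3%nat))) (Cmult 4 (S 1%nat))).
Proof.
  intros H S. split; [|split].
  - apply CSeries_ext. intros m. simpl. rewrite Rmult_1_r. reflexivity.
  - replace (Cmult (/ 6) (Cminus (S 3%nat) (S 1%nat))) with (Cplus (Cmult (/ 6) (S 3%nat))
    (Cmult (- / 6) (S 1%nat))) by field.
    unfold S. rewrite <- !CSeries_scal by (apply H; lia). rewrite <- CSeries_plus by (apply asum_scal, H;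
      lia).
    apply CSeries_ext. intros m. unfold psum_weight. rewrite RtoC_div, RtoC_minus by lra. simpl pow.
    rewrite !Rmult_1_r. field.
  - replace (Cmult (/ 120) (Cplus (Cminus (S 5%nat) (Cmult 5 (S 3%nat))) (Cmult 4 (S 1%nat))))
      with (Cplus (Cmult (/ 120) (S 5%nat)) (Cplus (Cmult (- 5 / 120) (S 3%nat))
        (Cmult (4 / 120) (S 1%nat)))) by field.
    unfold S. rewrite <- !CSeries_scal by (apply H; lia).
    rewrite <- (CSeries_plus (fun n => Cmult (- 5 / 120) _)) by (apply asum_scal, H; lia).
    rewrite <- CSeries_plus; [|apply asum_scal, H; lia|apply asum_plus; apply asum_scal, H; lia].
    apply CSeries_ext. intros m. unfold psum_weight.
    simpl pow. rewrite RtoC_div, RtoC_plus, RtoC_minus, !RtoC_mult by lra. field.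
Qed.

Lemma CSeries_shift_weight (f : nat -> R) (x : C) : f 0%nat = 0 ->
  asum (fun m => Cmult (f m) (Cpow x m)) -> asum (fun m => Cmult (f (S m)) (Cpow x m)) ->
  CSeries (fun m => Cmult (f m) (Cpow x m)) = Cmult x (CSeries (fun m => Cmult (f (S m)) (Cpow x m))).
Proof.
  intros f0 H H'. rewrite (CSeries_split _ 1 H). simpl. rewrite f0.
  rewrite <- CSeries_scal by exact H'.
  rewrite Cmult_0_l, !Cplus_0_l. apply CSeries_ext. intros m. ring.
Qed.

Lemma asum_shift (f : nat -> R) (x : C) : x <> 0 ->
  asum (fun m => Cmult (f m) (Cpow x m)) -> asum (fun m => Cmult (f (S m)) (Cpow x m)).
Proof.
  intros Hx H.
  assert (H1 : asum (fun m => Cmult (f (S m)) (Cpow x (S m)))).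
  { apply (ex_series_incr_1 (V := R_NormedModule) (fun m => Cmod (Cmult (f m) (Cpow x m)))). exact H. }
  apply (asum_scal (/ x)) in H1. eapply asum_ext; [|exact H1]. intros m. simpl. field. exact Hx.
Qed.

(** Multiplying a power series by (1 - x)^2 takes second differences of its coefficients; f(1) is
    the boundary term. *)
Lemma CSeries_second_difference (f h : nat -> R) (x : C) : x <> 0 ->
  asum (fun m => Cmult (f m) (Cpow x m)) -> asum (fun m => Cmult (h m) (Cpow x m)) ->
  f 0%nat = 0 -> h 0%nat = 0 ->
  (forall m, f (S (S m)) - 2 * f (S m) + f m = h (S m)) ->
  Cmult (Cmult (Cminus 1 x) (Cminus 1 x)) (CSeries (fun m => Cmult (f m) (Cpow x m))) =
  Cmult x (Cplus (f 1%nat) (CSeries (fun m => Cmult (h m) (Cpow x m)))).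
Proof.
  intros Hx Af Ah f0 h0 E.
  assert (Af1 := asum_shift f x Hx Af). assert (Ah1 := asum_shift h x Hx Ah).
  assert (Af2 := asum_shift (fun m => f (S m)) x Hx Af1). simpl in Af2.
  assert (F1 := CSeries_shift_weight f x f0 Af Af1). assert (H1 := CSeries_shift_weight h x h0 Ah Ah1).
  set (F := CSeries (fun m => Cmult (f m) (Cpow x m))) in *.
  set (G := CSeries (fun m => Cmult (h m) (Cpow x m))) in *.
  assert (F2 : CSeries (fun m => Cmult (f (S m)) (Cpow x m)) =
     Cplus (f 1%nat) (Cmult x (CSeries (fun m => Cmult (f (S (S m))) (Cpow x m))))).
  { rewrite (CSeries_split _ 1 Af1). simpl. rewrite <- CSeries_scal by exact Af2. f_equal; [ring|].
    apply CSeries_ext. intros m. ring. }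
  assert (F3 : CSeries (fun m => Cmult (f (S (S m))) (Cpow x m)) =
    Cplus (Cmult 2 (CSeries (fun m => Cmult (f (S m)) (Cpow x m)))) (Cplus (Cmult (-1) F) (CSeries
      (fun m => Cmult (h (S m)) (Cpow x m))))).
  { unfold F. rewrite <- (CSeries_scal (-1)), <- (CSeries_scal 2) by assumption.
    rewrite <- CSeries_plus; [|apply asum_scal, Af|exact Ah1].
    rewrite <- CSeries_plus; [|apply asum_scal, Af1|apply asum_plus; [apply asum_scal, Af|exact Ah1]].
    apply CSeries_ext. intros m. rewrite <- (E m), RtoC_plus, RtoC_minus, RtoC_mult. ring. }
  set (F' := CSeries (fun m => Cmult (f (S m)) (Cpow x m))) in *.
  set (F'' := CSeries (fun m => Cmult (f (S (S m))) (Cpow x m))) in *.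
  set (G' := CSeries (fun m => Cmult (h (S m)) (Cpow x m))) in *.
  assert (T : F' = Cplus (f 1%nat) (Cmult x (Cplus (Cmult 2 F') (Cplus (Cmult (-1) F) G')))).
  { rewrite <- F3. exact F2. }
  transitivity (Cminus (Cmult (Cminus 1 (Cmult 2 x)) F) (Cmult (Copp (Cmult x x)) F)); [ring|].
  rewrite F1 at 1. rewrite H1.
  replace (Cmult (Cminus 1 (Cmult 2 x)) (Cmult x F')) with (Cmult x (Cminus F' (Cmult x (Cmult 2 F'))))
    by ring.
  rewrite T at 1. ring.
Qed.

Lemma y_pow_series (x : C) (k : nat) : 0 < Cmod x < 1 -> (1 <= k <= 3)%nat ->
  Cpow (Cdiv x (Cmult (Cminus 1 x) (Cminus 1 x))) k = CSeries (fun m => Cmult (psum_weight k m) (Cpow x m)).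
Proof.
  intros Hx Hk.
  assert (X0 : x <> 0). { intros E. rewrite E, Cmod_0 in Hx. lra. }
  assert (X1 : Cminus 1 x <> 0) by (apply C1_sub_neq_0; lra).
  assert (A : forall j, asum (fun m => Cmult (psum_weight j m) (Cpow x m))).
  { intros j. apply asum_psum_weight. intros i _. apply asum_pow, Hx. }
  set (Q := Cmult (Cminus 1 x) (Cminus 1 x)).
  assert (HQ : Q <> 0) by (apply Cmult_neq_0; exact X1).
  assert (K : forall a b, Cmult Q a = Cmult x b -> a = Cmult (Cdiv x Q) b).
  { intros a b E. replace a with (Cdiv (Cmult Q a) Q) by (field; exact HQ). rewrite E. field. exact HQ. }
  assert (Z : CSeries (fun m => Cmult (psum_weight 0 m) (Cpow x m)) = 0).
  { rewrite (CSeries_ext _ (fun m => Cmult 0 (Cmult (psum_weight 0 m) (Cpow x m)))).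
    - rewrite CSeries_scal by apply A. ring.
    - intros m. simpl. ring. }
  assert (S1 := K _ _ (CSeries_second_difference (psum_weight 1) (psum_weight 0) x X0 (A _) (A _) eq_refl eq_refl
    ltac:(intros m; unfold psum_weight; rewrite !S_INR; ring))).
  assert (S2 := K _ _ (CSeries_second_difference (psum_weight 2) (psum_weight 1) x X0 (A _) (A _)
    ltac:(unfold psum_weight; simpl; field) eq_refl
    ltac:(intros m; unfold psum_weight; rewrite !S_INR; field))).
  assert (S3 := K _ _ (CSeries_second_difference (psum_weight 3) (psum_weight 2) x X0 (A _) (A _)
    ltac:(unfold psum_weight; simpl; field) ltac:(unfold psum_weight; simpl; field)
    ltac:(intros m; unfold psum_weight; rewrite !S_INR; field))).
  (* The boundary term is 1 for k = 1, where the recursion starts from the zero series, and 0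
     afterwards; each later step thus multiplies by x / (1 - x)^2. *)
  replace (psum_weight 1 1) with 1 in S1 by (unfold psum_weight; simpl; ring).
  replace (psum_weight 2 1) with 0 in S2 by (unfold psum_weight; simpl; field).
  replace (psum_weight 3 1) with 0 in S3 by (unfold psum_weight; simpl; field).
  rewrite Z in S1. rewrite S1 in S2. rewrite S2 in S3.
  destruct k as [|[|[|[|k]]]]; try lia.
  - rewrite S1. simpl. ring.
  - rewrite S2. simpl. ring.
  - rewrite S3. simpl. ring.
Qed.

(** * Truncated geometric series and their Lambert limits *)

Definition geo (q : C) (m N : nat) : C := csum (fun n => Cpow q (S n * m)) N.

Lemma geo_closed (q : C) (m N : nat) : Cmod q < 1 -> (1 <= m)%nat ->
  geo q m N = Cdiv (Cmult (Cpow q m) (Cminus 1 (Cpow q (N * m)))) (Cminus 1 (Cpow q m)).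
Proof.
  intros H Hm. assert (Hn : Cminus 1 (Cpow q m) <> 0).
  { apply C1_sub_neq_0. destruct m as [|m]; [lia|]. eapply Rle_lt_trans; [apply Cmod_pow_lt_1, H|exact H]. }
  unfold geo. induction N as [|N IH]; cbn [csum].
  - simpl. field. exact Hn.
  - rewrite IH. replace (S N * m)%nat with (N * m + m)%nat by lia. rewrite Cpow_add_r. field. exact Hn.
Qed.

(** The bound is independent of N, so truncations that vary with m stay dominated. *)
Lemma Cmod_geo_le (q : C) (m N : nat) : Cmod q < 1 -> (1 <= m)%nat ->
  Cmod (geo q m N) <= 2 / (1 - Cmod q) * Cmod q ^ m.
Proof.
  intros H Hm. rewrite geo_closed by assumption.
  destruct m as [|m]; [lia|]. assert (P := Cmod_ge_0 q).
  assert (L := Cmod_1_sub_ge (Cpow q (S m))). assert (M := Cmod_pow_lt_1 q m H).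
  assert (Hn : Cminus 1 (Cpow q (S m)) <> 0) by (apply C1_sub_neq_0; lra).
  rewrite Cmod_div by exact Hn. rewrite Cmod_mult, Cmod_pow.
  assert (U : Cmod (Cminus 1 (Cpow q (N * S m))) <= 2).
  { unfold Cminus. eapply Rle_trans; [apply Cmod_triangle|]. rewrite Cmod_opp, Cmod_1, Cmod_pow.
    assert (Cmod q ^ (N * S m) <= 1); [|lra]. rewrite <- (pow1 (N * S m)). apply pow_incr. lra. }
  assert (T : 0 <= Cmod q ^ S m) by (apply pow_le, P).
  apply Rle_trans with (Cmod q ^ S m * 2 / (1 - Cmod q)).
  - apply Rmult_le_compat.
    + apply Rmult_le_pos; [exact T|apply Cmod_ge_0].
    + left. apply Rinv_0_lt_compat. lra.
    + apply Rmult_le_compat_l; assumption.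
    + apply Rinv_le_contravar; lra.
  - right. field. lra.
Qed.

Definition lam (q : C) (m : nat) : C := Cdiv (Cpow q m) (Cminus 1 (Cpow q m)).

Lemma climit_pow_0 (q : C) : Cmod q < 1 -> climit (Cpow q) 0.
Proof.
  intros H. apply (climit_squeeze _ _ (fun n => Cmod q ^ n)).
  - intros n. replace (Cminus (Cpow q n) 0) with (Cpow q n) by ring. rewrite Cmod_pow. apply Rle_refl.
  - apply is_lim_seq_geom. rewrite Rabs_pos_eq by apply Cmod_ge_0. exact H.
Qed.

Lemma climit_geo (q : C) (m : nat) : Cmod q < 1 -> (1 <= m)%nat -> climit (geo q m) (lam q m).
Proof.
  intros H Hm.
  eapply climit_ext; [intros N; symmetry; apply geo_closed; assumption|].
  unfold lam. replace (Cdiv (Cpow q m) (Cminus 1 (Cpow q m)))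
    with (Cmult (Cdiv (Cpow q m) (Cminus 1 (Cpow q m))) (Cplus 1 (Cmult (-1) 0))) by ring.
  apply climit_ext with (u := fun N => Cmult (Cdiv (Cpow q m) (Cminus 1 (Cpow q m))) (Cplus 1 (Cmult (-1)
    (Cpow q (N * m))))).
  - intros N. unfold Cdiv. ring.
  - apply climit_scal, climit_plus; [apply climit_const|]. apply climit_scal.
    apply (climit_subseq (fun N => N * m)%nat (Cpow q)); [intros; nia|apply climit_pow_0, H].
Qed.

(** The truncation [p] is left free for two uses: [p N m = N] keeps n <= N, as in the power sums,
    while [p N m = N / m] keeps the pairs with n m <= N, as in the divisor sums. *)
Lemma tannery_geo (f : nat -> R) (p : nat -> nat -> nat) (q : C) : 0 < Cmod q < 1 ->
  f 0%nat = 0 -> asum (fun m => Cmult (f m) (Cpow q m)) ->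
  (forall m, (1 <= m)%nat -> forall B, exists N0, forall N, (N0 <= N)%nat -> (B <= p N m)%nat) ->
  asum (fun m => Cmult (f m) (lam q m)) /\
  climit (fun N => CSeries (fun m => Cmult (f m) (geo q m (p N m)))) (CSeries
    (fun m => Cmult (f m) (lam q m))).
Proof.
  intros Hq f0 Af Hp.
  apply (tannery (fun N m => Cmult (f m) (geo q m (p N m))) _
    (fun m => 2 / (1 - Cmod q) * Cmod (Cmult (f m) (Cpow q m)))).
  - apply (ex_series_scal_l (V := R_NormedModule)). exact Af.
  - intros N m. destruct m as [|m].
    + rewrite f0, !Cmult_0_l, Cmod_0. lra.
    + rewrite !Cmod_mult, Cmod_pow. assert (G := Cmod_geo_le q (S m) (p N (S m)) (proj2 Hq) ltac:(lia)).
      assert (P := Cmod_ge_0 (f (S m))).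
      replace (2 / (1 - Cmod q) * (Cmod (f (S m)) * Cmod q ^ S m)) with
        (Cmod (f (S m)) * (2 / (1 - Cmod q) * Cmod q ^ S m)) by ring.
      apply Rmult_le_compat_l; assumption.
  - intros m. destruct m as [|m].
    + rewrite f0. apply climit_ext with (u := fun _ => Cmult 0 (lam q 0)); [intros; ring|apply climit_const].
    + apply climit_scal. intros eps He. destruct (climit_geo q (S m) (proj2 Hq) ltac:(lia) eps He) as [B HB].
      destruct (Hp (S m) ltac:(lia) B) as [N0 HN0]. exists N0. intros N HN. apply HB, HN0, HN.
Qed.

Lemma csum_CSeries (f : nat -> nat -> C) (M : nat) : (forall n, asum (f n)) ->
  asum (fun m => csum (fun n => f n m) M) /\
  csum (fun n => CSeries (f n)) M = CSeries (fun m => csum (fun n => f n m) M).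
Proof.
  intros H. induction M as [|M [IH1 IH2]]; simpl.
  - assert (A : asum (fun _ : nat => RtoC 0)).
    { eapply asum_ext; [|apply (asum_scal 0 _ (H 0%nat))]. intros; simpl; ring. }
    split; [exact A|].
    rewrite (CSeries_ext _ (fun n => Cmult 0 (f 0%nat n))) by (intros; ring).
    rewrite CSeries_scal by apply H. ring.
  - split; [apply asum_plus; [exact IH1|apply H]|].
    rewrite IH2, CSeries_plus; [reflexivity|exact IH1|apply H].
Qed.

Lemma psum_limit (k : nat) (tau : C) : 0 < Im tau -> (1 <= k <= 3)%nat ->
  climit (psum k tau) (CSeries (fun m => Cmult (psum_weight k m) (lam (e2pi tau) m))).
Proof.
  intros Ht Hk. assert (Hq : 0 < Cmod (e2pi tau) < 1) by (split; [apply Cmod_q_gt_0|apply Cmod_q_lt_1, Ht]).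
  set (q := e2pi tau) in *.
  assert (Hqn : forall n, 0 < Cmod (Cpow q (S n)) < 1).
  { intros n. split; [rewrite Cmod_pow; apply pow_lt, Hq|]. eapply Rle_lt_trans; [apply Cmod_pow_lt_1|];
    apply Hq. }
  assert (A : forall n, asum (fun m => Cmult (psum_weight k m) (Cpow (Cpow q (S n)) m))).
  { intros n. apply asum_psum_weight. intros j _. apply asum_pow, Hqn. }
  eapply climit_ext with (u := fun N => CSeries (fun m => Cmult (psum_weight k m) (geo q m N))).
  - intros N. unfold psum, geo.
    rewrite (csum_ext (fun n => Cpow (yq tau n) k) (fun n => CSeries (fun m => Cmult (psum_weight k m)
      (Cpow (Cpow q (S n)) m)))).
    + rewrite (proj2 (csum_CSeries _ N A)). apply CSeries_ext. intros m.
      rewrite <- csum_scal. apply csum_ext. intros n _. rewrite Cpow_mult_r. reflexivity.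
    + intros n _. apply y_pow_series; [apply Hqn|exact Hk].
  - apply (tannery_geo (psum_weight k) (fun N _ => N) q Hq).
    + destruct k as [|[|[|[|k]]]]; unfold psum_weight; simpl; try reflexivity; field.
    + eapply asum_ext; [|apply (A 0%nat)]. intros m. rewrite Cpow_1_r. reflexivity.
    + intros m _ B. exists B. intros; assumption.
Qed.

(** * Rearrangement into divisor sums *)

Lemma div_succ (n m : nat) : (1 <= m)%nat ->
  (S n / m = n / m + (if Nat.eqb (S n mod m) 0 then 1 else 0))%nat.
Proof.
  intros Hm. assert (E1 := Nat.div_mod_eq n m). assert (E2 := Nat.div_mod_eq (S n) m).
  assert (L1 := Nat.mod_upper_bound n m ltac:(lia)). assert (L2 := Nat.mod_upper_bound (S n) m ltac:(lia)).
  destruct (Nat.eqb_spec (S n mod m) 0) as [E|E]; nia.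
Qed.

Definition divterm (k j m : nat) : C :=
  if Nat.eqb m 0 then 0 else if Nat.eqb (j mod m) 0 then RtoC (INR m ^ k) else 0.

Lemma csum_divterm (k j M : nat) : (1 <= j <= M)%nat -> csum (divterm k j) (S M) =
  RtoC (INR (Defs.sigma k j)).
Proof.
  intros [Hj HM].
  assert (F : forall l a n, fold_right Nat.add 0%nat (map (fun d => if Nat.eqb (j mod d) 0 then (d ^ k)%nat else 0%nat) (seq a n)) = l ->
    (1 <= a)%nat -> RtoC (INR l) = csum (fun i => divterm k j (a + i)) n).
  { intros l a n. revert l a. induction n as [|n IH]; intros l a Hl Ha; simpl in Hl.
    - subst l. reflexivity.
    - rewrite <- Hl, plus_INR, RtoC_plus, (IH _ (S a) eq_refl ltac:(lia)).
      replace (S n) with (1 + n)%nat by lia. rewrite csum_add. f_equal.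
      + simpl. rewrite Nat.add_0_r, Cplus_0_l. unfold divterm. destruct (Nat.eqb_spec a 0); [lia|].
        destruct (Nat.eqb (j mod a) 0); [rewrite pow_INR|]; reflexivity.
      + apply csum_ext. intros i _. f_equal. lia. }
  assert (S0 := F _ 1%nat j eq_refl ltac:(lia)). fold (Defs.sigma k j) in S0. rewrite S0.
  (* Indices m from j + 1 to M contribute nothing, since there j mod m = j is nonzero. *)
  replace (S M) with (1 + (j + (M - j)))%nat by lia. rewrite csum_add, csum_add.
  replace (csum (divterm k j) 1) with (RtoC 0) by (simpl; unfold divterm; simpl; ring).
  rewrite (csum_ext (fun n => divterm k j (1 + (j + n))) (fun _ => Cmult 0 0)).
  - rewrite csum_scal. ring.
  - intros n _. unfold divterm. destruct (Nat.eqb_spec (1 + (j + n)) 0); [lia|].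
    rewrite Nat.mod_small by lia. destruct (Nat.eqb_spec j 0); [lia|ring].
Qed.

Lemma CSeries_finite (f : nat -> C) (M : nat) : (forall m, (M <= m)%nat -> f m = 0) ->
  asum f /\ CSeries f = csum f M.
Proof.
  intros H. assert (A : asum f).
  { apply (ex_series_incr_n (V := R_NormedModule) (fun m => Cmod (f m)) M).
    apply (ex_series_ext (fun n => 0 * exp (- INR n))).
    - intros n. rewrite H by lia. rewrite Cmod_0. apply Rmult_0_l.
    - apply ex_series_exp_neg. }
  split; [exact A|]. apply CSeries_unique; [exact A|].
  apply climit_ext_from with (N0 := M) (u := fun _ => csum f M); [|apply climit_const].
  intros n Hn. replace n with (M + (n - M))%nat by lia. rewrite csum_add.
  rewrite (csum_ext (fun i => f (M + i)%nat) (fun _ => Cmult 0 0)).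
  - rewrite csum_scal. ring.
  - intros i _. rewrite H by lia. ring.
Qed.

(* Lambert series: both sides sum [m^k q^(n m)] over pairs [n, m >= 1]. *)
Lemma lambert_sigma (k : nat) (q : C) : 0 < Cmod q < 1 -> (1 <= k)%nat ->
  asum (fun m => Cmult (INR m ^ k)%R (lam q m)) /\
  climit (csum (fun n => Cmult (INR (Defs.sigma k (S n))) (Cpow q (S n)))) (CSeries
    (fun m => Cmult (INR m ^ k)%R (lam q m))).
Proof.
  intros Hq Hk.
  assert (P0 : INR 0 ^ k = 0) by (destruct k; [lia|simpl; ring]).
  destruct (tannery_geo (fun m => INR m ^ k) (fun N m => N / m)%nat q Hq P0 (asum_pow k q Hq)) as [A L].
  - intros m Hm B. exists (B * m)%nat. intros N HN. apply Nat.div_le_lower_bound; nia.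
  - split; [exact A|]. eapply climit_ext; [|exact L]. intros N. cbv beta.
    (* Passing from N to N + 1 adds the pairs with n m = N + 1, one for each divisor m of N + 1. The
       outer range M is separated from N so that it stays fixed in the induction. *)
    assert (G : forall M, (N <= M)%nat ->
      csum (fun m => Cmult (INR m ^ k)%R (geo q m (N / m))) (S M) =
      csum (fun n => Cmult (INR (Defs.sigma k (S n))) (Cpow q (S n))) N).
    { clear L. induction N as [|N IH]; intros M HM.
      - rewrite (csum_ext _ (fun _ => Cmult 0 0)); [rewrite csum_scal; simpl; ring|].
        intros m _. destruct m as [|m]; [rewrite P0; ring|]. rewrite Nat.div_small by lia. unfold geo.
        simpl. ring.
      - cbn [csum]. rewrite <- (IH M ltac:(lia)). rewrite <- (csum_divterm k (S N) M) by lia.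
        rewrite (Cmult_comm (csum (divterm k (S N)) (S M))), <- csum_scal.
        change (Cplus (csum (fun m => Cmult (RtoC (INR m ^ k)) (geo q m (S N / m))) M)
          (Cmult (RtoC (INR M ^ k)) (geo q M (S N / M))))
          with (csum (fun m => Cmult (RtoC (INR m ^ k)) (geo q m (S N / m))) (S M)).
        rewrite <- csum_plus. apply csum_ext. intros m _. unfold divterm.
        destruct (Nat.eqb_spec m 0) as [->|Hm].
        + rewrite P0. ring.
        + rewrite div_succ by lia. destruct (Nat.eqb_spec (S N mod m) 0) as [E|E].
          * unfold geo. rewrite Nat.add_1_r. cbn [csum].
            replace (S (N / m) * m)%nat with (S N); [ring|].
            assert (D := div_succ N m ltac:(lia)). rewrite E in D. simpl in D.
            assert (E2 := Nat.div_mod_eq (S N) m). rewrite E in E2. nia.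
          * rewrite Nat.add_0_r. ring. }
    rewrite <- (G N (le_n N)). apply CSeries_finite. intros m Hm.
    rewrite Nat.div_small by lia. unfold geo. simpl. ring.
Qed.

Lemma sigma_le (k n : nat) : INR (Defs.sigma k n) <= INR n ^ S k.
Proof.
  assert (F : forall l a, (forall d, In d l -> (d <= a)%nat) ->
    INR (fold_right Nat.add 0%nat (map (fun d => if Nat.eqb (n mod d) 0 then (d ^ k)%nat else 0%nat) l)) <= INR (length l) * INR a ^ k).
  { intros l a. induction l as [|d l IH]; intros H.
    - simpl. lra.
    - cbn [map fold_right length]. rewrite plus_INR, S_INR.
      specialize (IH (fun d' H' => H d' (or_intror H'))). specialize (H d (or_introl eq_refl)).
      assert (T : INR (if Nat.eqb (n mod d) 0 then (d ^ k)%nat else 0%nat) <= INR a ^ k).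
      { destruct (Nat.eqb (n mod d) 0).
        - rewrite pow_INR. apply pow_incr. split; [apply pos_INR|apply le_INR, H].
        - simpl. apply pow_le, pos_INR. }
      lra. }
  specialize (F (seq 1 n) n). rewrite length_seq in F. simpl. apply F.
  intros d Hd. apply in_seq in Hd. lia.
Qed.

Lemma eis_lambert (c : R) (k : nat) (tau : C) : 0 < Im tau -> (1 <= k)%nat ->
  eis c k tau = Cplus 1 (Cmult c (CSeries (fun m => Cmult (INR m ^ k)%R (lam (e2pi tau) m)))).
Proof.
  intros Ht Hk. assert (Hq : 0 < Cmod (e2pi tau) < 1) by (split; [apply Cmod_q_gt_0|apply Cmod_q_lt_1, Ht]).
  unfold eis. f_equal. f_equal.
  rewrite (CSeries_ext _ (fun n => Cmult (INR (Defs.sigma k (S n))) (Cpow (e2pi tau) (S n)))).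
  - apply CSeries_unique.
    + assert (A : asum (fun n => Cmult (INR (S n) ^ S k)%R (Cpow (e2pi tau) (S n)))).
      { apply (ex_series_incr_1 (V := R_NormedModule) (fun m => Cmod (Cmult (INR m ^ S k)%R
        (Cpow (e2pi tau) m)))).
        apply asum_pow, Hq. }
      eapply asum_le; [|exact A]. intros n. cbv beta. rewrite !Cmod_mult, !Cmod_R.
      apply Rmult_le_compat_r; [apply Cmod_ge_0|].
      rewrite !Rabs_pos_eq by (apply pos_INR || apply pow_le, pos_INR). apply sigma_le.
    + apply lambert_sigma; assumption.
  - intros n. f_equal. rewrite <- qz_of_nat. unfold qz. rewrite <- INR_IZR_INZ. reflexivity.
Qed.

(** * Eisenstein series and the differential equation *)

Lemma wtheta_W (tau : C) : 0 < Im tau ->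
  let T k := Theta k tau 0 in
  wtheta W0 tau = T 1%nat /\
  wtheta W1 tau = Cminus (T 3%nat) (Cmult (1 / 4) (T 1%nat)) /\
  wtheta W2 tau = Cplus (Cminus (T 5%nat) (Cmult (5 / 2) (T 3%nat))) (Cmult (9 / 16) (T 1%nat)) /\
  wtheta W3 tau = Cminus (Cplus (Cminus (T 7%nat) (Cmult (35 / 4) (T 5%nat))) (Cmult (259 / 16) (T 3%nat)))
    (Cmult (225 / 64) (T 1%nat)).
Proof.
  intros Ht T.
  assert (P : forall (w : R -> R) (a b c d : R), (forall x, w x =
    a * x ^ 7 + (b * x ^ 5 + (c * x ^ 3 + d * x ^ 1))) ->
    wtheta w tau = Cplus (Cmult a (T 7%nat)) (Cplus (Cmult b (T 5%nat)) (Cplus (Cmult c (T 3%nat))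
      (Cmult d (T 1%nat))))).
  { intros w a b c d H. unfold wtheta, T, Theta.
    assert (D : forall k (x : R), decZ (fun n => Cmult x (trm k tau 0 n))) by (intros; apply decZ_scal,
      trm_dec, Ht).
    rewrite <- !CSeriesZ_scal by apply trm_dec, Ht.
    rewrite <- (CSeriesZ_plus (fun n => Cmult c (trm 3 tau 0 n))) by apply D.
    rewrite <- (CSeriesZ_plus (fun n => Cmult b (trm 5 tau 0 n))); [|apply D|apply decZ_plus; apply D].
    rewrite <- CSeriesZ_plus; [|apply D|apply decZ_plus; [apply D|apply decZ_plus; apply D]].
    apply CSeriesZ_ext. intros n. rewrite H. unfold trm. rewrite !RtoC_plus, !RtoC_mult, !RtoC_pow. ring. }
  split; [|split; [|split]].
  - rewrite (P W0 0 0 0 1) by (intros; unfold W0; ring). ring.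
  - rewrite (P W1 0 0 1 (- 1 / 4)) by (intros; unfold W1; field). rewrite RtoC_div by lra. field.
  - rewrite (P W2 0 1 (- 5 / 2) (9 / 16)) by (intros; unfold W2; field). rewrite !RtoC_div by lra. field.
  - rewrite (P W3 1 (- 35 / 4) (259 / 16) (- 225 / 64)) by (intros; unfold W3; field). rewrite !RtoC_div
    by lra. field.
Qed.

(** Each relation equates two forms of the limit of a [W_k] moment: r^2 times a combination of odd
    derivatives at 0, and a polynomial in power sums times r^2 [T 1]. The factor r^2 cancels and the
    system is triangular, so [T 3], [T 5], [T 7] follow in turn. *)
Lemma theta_taylor_eisenstein (tau : C) : 0 < Im tau ->
  let T k := Theta k tau 0 in
  T 1%nat <> 0 /\
  T 3%nat = Cmult (Cmult (1 / 4) (E2 tau)) (T 1%nat) /\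
  T 5%nat = Cmult (Cminus (Cmult (5 / 48) (Cmult (E2 tau) (E2 tau))) (Cmult (1 / 24) (E4 tau))) (T 1%nat) /\
  T 7%nat = Cmult (Cplus (Cminus (Cmult (35 / 576) (Cmult (E2 tau) (Cmult (E2 tau) (E2 tau))))
    (Cmult (7 / 96) (Cmult (E2 tau) (E4 tau)))) (Cmult (1 / 36) (E6 tau))) (T 1%nat).
Proof.
  intros Ht T.
  assert (Hq := Cmod_q_lt_1 tau Ht). assert (Hq' : 0 < Cmod (e2pi tau) < 1) by (split;
    [apply Cmod_q_gt_0|exact Hq]).
  destruct (qpoch_limit _ Hq) as [P [r [HP [Hr [LP Lr]]]]].
  destruct W_exp_bounded as [B0 [B1 [B2 B3]]].
  assert (M0 := mom_limit W0 tau r Ht B0 Lr). assert (M1 := mom_limit W1 tau r Ht B1 Lr).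
  assert (M2 := mom_limit W2 tau r Ht B2 Lr). assert (M3 := mom_limit W3 tau r Ht B3 Lr).
  destruct (wtheta_W tau Ht) as [V0 [V1 [V2 V3]]]. fold T in V0, V1, V2, V3.
  rewrite V0 in M0. rewrite V1 in M1. rewrite V2 in M2. rewrite V3 in M3.
  assert (HT : T 1%nat <> 0).
  { assert (E : Cmult (Cmult r r) (T 1%nat) = Cmult (qe (/ 2) tau 0) (Cmult (Cmult P P) r)).
    { eapply climit_unique; [exact M0|]. eapply climit_ext; [intros N; symmetry; apply mom_W0_closed, Ht|].
      apply climit_scal, climit_mult; [apply climit_mult; exact LP|].
      apply (climit_subseq (fun N => 2 * N + 1)%nat (fun n => / qpoch (e2pi tau) n)%C); [intros;
        lia|exact Lr]. }
    intros E'. rewrite E', Cmult_0_r in E. symmetry in E. revert E.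
    apply Cmult_neq_0; [apply e2pi_neq_0|]. apply Cmult_neq_0; [apply Cmult_neq_0; exact HP|exact Hr]. }
  split; [exact HT|].
  assert (A : forall j, (1 <= j)%nat -> asum (fun m => Cmult (INR m ^ j)%R (lam (e2pi tau) m))).
  { intros j Hj. apply lambert_sigma; assumption. }
  assert (L1 := psum_limit 1 tau Ht ltac:(lia)). assert (L2 := psum_limit 2 tau Ht ltac:(lia)).
  assert (L3 := psum_limit 3 tau Ht ltac:(lia)).
  destruct (CSeries_psum_weight _ A) as [Q1 [Q2 Q3]]. rewrite Q1 in L1. rewrite Q2 in L2. rewrite Q3 in L3.
  assert (X2 := eis_lambert (-24) 1 tau Ht ltac:(lia)). assert (X4 := eis_lambert 240 3 tau Ht ltac:(lia)).
  assert (X6 := eis_lambert (-504) 5 tau Ht ltac:(lia)).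
  fold (E2 tau) in X2. fold (E4 tau) in X4. fold (E6 tau) in X6.
  set (S1 := CSeries (fun m => Cmult (INR m ^ 1)%R (lam (e2pi tau) m))) in *.
  set (S3 := CSeries (fun m => Cmult (INR m ^ 3)%R (lam (e2pi tau) m))) in *.
  set (S5 := CSeries (fun m => Cmult (INR m ^ 5)%R (lam (e2pi tau) m))) in *.
  set (p2 := Cmult (/ 6) (Cminus S3 S1)) in *.
  set (p3 := Cmult (/ 120) (Cplus (Cminus S5 (Cmult 5 S3)) (Cmult 4 S1))) in *.
  assert (Cancel : forall a b, Cmult (Cmult r r) a = Cmult b (Cmult (Cmult r r) (T 1%nat)) -> a =
    Cmult b (T 1%nat)).
  { intros a b E. replace a with (Cdiv (Cmult (Cmult r r) a) (Cmult r r)) by (field; exact Hr).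
    rewrite E. field. exact Hr. }
  assert (Y1 : Cminus (T 3%nat) (Cmult (1 / 4) (T 1%nat)) = Cmult (Cmult (-6) S1) (T 1%nat)).
  { apply Cancel. eapply climit_unique; [exact M1|].
    eapply climit_ext; [intros N; symmetry; apply (mom_W tau N Ht)|].
    apply climit_mult; [|exact M0]. apply climit_scal, L1. }
  assert (Lm : forall u l, climit u l -> climit (fun n => Copp (u n)) (Copp l)).
  { intros u l H. replace (Copp l) with (Cmult (-1) l) by ring.
    eapply climit_ext; [|apply (climit_scal (-1) u l H)]. intros n; simpl; ring. }
  assert (Y2 : Cplus (Cminus (T 5%nat) (Cmult (5 / 2) (T 3%nat))) (Cmult (9 / 16) (T 1%nat)) =
    Cmult (Cmult 60 (Cminus (Cmult S1 S1) p2)) (T 1%nat)).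
  { apply Cancel. eapply climit_unique; [exact M2|].
    eapply climit_ext; [intros N; symmetry; apply (mom_W tau N Ht)|].
    apply climit_mult; [|exact M0]. apply climit_scal.
    apply climit_plus; [apply climit_mult; exact L1|apply Lm, L2]. }
  assert (Y3 : Cminus (Cplus (Cminus (T 7%nat) (Cmult (35 / 4) (T 5%nat))) (Cmult (259 / 16) (T 3%nat)))
    (Cmult (225 / 64) (T 1%nat)) =
    Cmult (Cmult (-840) (Cplus (Cminus (Cmult S1 (Cmult S1 S1)) (Cmult 3 (Cmult S1 p2)))
      (Cmult 2 p3))) (T 1%nat)).
  { apply Cancel. eapply climit_unique; [exact M3|].
    eapply climit_ext; [intros N; symmetry; apply (mom_W tau N Ht)|].
    apply climit_mult; [|exact M0]. apply climit_scal.
    apply climit_plus; [|apply climit_scal, L3].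
    apply climit_plus; [apply climit_mult; [exact L1|apply climit_mult; exact L1]|].
    apply Lm, climit_scal, climit_mult; [exact L1|exact L2]. }
  assert (Z1 : T 3%nat = Cmult (Cmult (1 / 4) (E2 tau)) (T 1%nat)).
  { replace (T 3%nat) with (Cplus (Cminus (T 3%nat) (Cmult (1 / 4) (T 1%nat))) (Cmult (1 / 4) (T 1%nat)))
    by ring.
    rewrite Y1, X2. field. }
  assert (Z2 : T 5%nat = Cmult (Cminus (Cmult (5 / 48) (Cmult (E2 tau) (E2 tau)))
    (Cmult (1 / 24) (E4 tau))) (T 1%nat)).
  { replace (T 5%nat) with (Cplus (Cplus (Cminus (T 5%nat) (Cmult (5 / 2) (T 3%nat)))
    (Cmult (9 / 16) (T 1%nat)))
      (Cminus (Cmult (5 / 2) (T 3%nat)) (Cmult (9 / 16) (T 1%nat)))) by ring.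
    rewrite Y2, Z1, X2, X4. unfold p2. field. }
  split; [exact Z1|split; [exact Z2|]].
  replace (T 7%nat) with (Cplus (Cminus (Cplus (Cminus (T 7%nat) (Cmult (35 / 4) (T 5%nat)))
    (Cmult (259 / 16) (T 3%nat))) (Cmult (225 / 64) (T 1%nat)))
      (Cplus (Cminus (Cmult (35 / 4) (T 5%nat)) (Cmult (259 / 16) (T 3%nat)))
        (Cmult (225 / 64) (T 1%nat)))) by ring.
  rewrite Y3, Z2, Z1, X2, X4, X6. unfold p2, p3. field.
Qed.

Lemma twopii_neq_0 : twopii <> 0.
Proof.
  unfold twopii. apply Cmult_neq_0.
  - intros E. apply RtoC_inj in E. assert (H := PI_RGT_0). lra.
  - intros E. apply (f_equal Cmod) in E. rewrite Cmod_Ci, Cmod_0 in E. lra.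
Qed.

(* Derivatives normalised by [1 / (2 pi i)], as in [qDq] and [zDz]. *)
Definition nder (f : C -> C) (z l : C) : Prop := cder f z (Cmult twopii l).

Lemma nder_eq (f : C -> C) (z l m : C) : nder f z l -> l = m -> nder f z m.
Proof. intros H <-. exact H. Qed.

Lemma nder_const (c z : C) : nder (fun _ => c) z 0.
Proof. unfold nder. rewrite Cmult_0_r. apply cder_const. Qed.

Lemma nder_plus (f g : C -> C) (z l m : C) :
  nder f z l -> nder g z m -> nder (fun y => Cplus (f y) (g y)) z (Cplus l m).
Proof. unfold nder. rewrite Cmult_plus_distr_l. apply cder_plus. Qed.

Lemma nder_mult (f g : C -> C) (z l m : C) : nder f z l -> nder g z m ->
  nder (fun y => Cmult (f y) (g y)) z (Cplus (Cmult l (g z)) (Cmult (f z) m)).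
Proof.
  unfold nder. intros H1 H2.
  replace (Cmult twopii (Cplus (Cmult l (g z)) (Cmult (f z) m)))
    with (Cplus (Cmult (Cmult twopii l) (g z)) (Cmult (f z) (Cmult twopii m))) by ring.
  apply cder_mult; assumption.
Qed.

Lemma cder_inv (z : C) : z <> 0 -> cder Cinv z (Copp (Cinv (Cmult z z))).
Proof.
  intros Hz. assert (Pz := proj1 (Cmod_gt_0 z) Hz). apply cder_intro. intros eps He.
  set (m := Cmod z) in *.
  (* The remainder is h^2 / (z^2 (z + h)). The first bound keeps |z + h| above m / 2, and the second
     makes the quotient at most eps |h|. *)
  exists (Rmin (m / 2) (eps * (m * m * m) / 2)). split.
  { apply Rmin_glb_lt; [lra|]. apply Rmult_lt_0_compat; [|lra]. apply Rmult_lt_0_compat; [exact He|].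
    repeat apply Rmult_lt_0_compat; exact Pz. }
  intros h Hh.
  assert (H1 : Cmod h < m / 2) by (eapply Rlt_le_trans; [exact Hh|apply Rmin_l]).
  assert (H2 : Cmod h < eps * (m * m * m) / 2) by (eapply Rlt_le_trans; [exact Hh|apply Rmin_r]).
  assert (L : m / 2 <= Cmod (Cplus z h)).
  { assert (T := Cmod_triangle (Cplus z h) (Copp h)). rewrite Cmod_opp in T.
    replace (Cplus (Cplus z h) (Copp h)) with z in T by ring. fold m in T. lra. }
  assert (Hzh : Cplus z h <> 0). { apply Cmod_gt_0. lra. }
  replace (Cminus (Cminus (Cinv (Cplus z h)) (Cinv z)) (Cmult (Copp (Cinv (Cmult z z))) h))
    with (Cdiv (Cmult h h) (Cmult (Cmult z z) (Cplus z h))) by (field; split; assumption).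
  rewrite Cmod_div by (apply Cmult_neq_0; [apply Cmult_neq_0; exact Hz|exact Hzh]).
  rewrite !Cmod_mult. fold m. assert (Ph := Cmod_ge_0 h).
  assert (D : 0 < m * m * Cmod (Cplus z h)) by (repeat apply Rmult_lt_0_compat; lra).
  apply Rmult_le_reg_r with (m * m * Cmod (Cplus z h)); [exact D|].
  replace (Cmod h * Cmod h / (m * m * Cmod (Cplus z h)) * (m * m * Cmod (Cplus z h))) with
    (Cmod h * Cmod h) by (field; split; lra).
  replace (eps * Cmod h * (m * m * Cmod (Cplus z h))) with (Cmod h * (eps * (m * m) * Cmod (Cplus z h)))
    by ring.
  apply Rmult_le_compat_l; [exact Ph|].
  apply Rle_trans with (eps * (m * m) * (m / 2)); [lra|].
  apply Rmult_le_compat_l; [|exact L]. apply Rmult_le_pos; [lra|nra].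
Qed.

Lemma nder_inv (f : C -> C) (z l : C) : nder f z l -> f z <> 0 ->
  nder (fun y => Cinv (f y)) z (Copp (Cdiv l (Cmult (f z) (f z)))).
Proof.
  intros H Hf. unfold nder.
  replace (Cmult twopii (Copp (Cdiv l (Cmult (f z) (f z))))) with (Cmult (Cmult twopii l) (Copp (Cinv
    (Cmult (f z) (f z))))) by (unfold Cdiv; ring).
  exact (@is_derive_comp C_AbsRing (AbsRing_NormedModule C_AbsRing) Cinv f z _ _ (cder_inv (f z) Hf) H).
Qed.

Lemma Im_near (tau t : C) : Cmod (Cminus t tau) < Im tau -> 0 < Im t.
Proof.
  intros H. assert (A := im_le_Cmod (Cminus t tau)).
  replace (Im (Cminus t tau)) with (Im t - Im tau) in A by reflexivity.
  apply Rabs_le_between in A. lra.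
Qed.

(** Differentiation is local, so identities known on the upper half-plane may be differentiated
    there. *)
Lemma nder_ext_upper (f g : C -> C) (tau l : C) : 0 < Im tau ->
  (forall t, 0 < Im t -> f t = g t) -> nder f tau l -> nder g tau l.
Proof.
  intros Ht H. apply (cder_ext_loc f g tau _ (Im tau) Ht).
  intros y Hy. apply H, (Im_near tau y Hy).
Qed.

Lemma nder_Theta_z (k : nat) (tau z : C) : 0 < Im tau -> nder (fun w => Theta k tau w) z (Theta (S k) tau z).
Proof. apply cder_Theta_z. Qed.

Lemma nder_Theta_tau (k : nat) (tau z : C) : 0 < Im tau ->
  nder (fun t => Theta k t z) tau (Cmult (/ 2) (Theta (S (S k)) tau z)).
Proof. apply cder_Theta_tau. Qed.

Lemma nder_E2 (tau : C) : 0 < Im tau ->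
  nder E2 tau (Cmult (/ 12) (Cminus (Cmult (E2 tau) (E2 tau)) (E4 tau))).
Proof.
  intros Ht. destruct (theta_taylor_eisenstein tau Ht) as [N [H3 [H5 H7]]]. cbv zeta in *.
  apply (nder_ext_upper (fun t => Cmult 4 (Cmult (Theta 3 t 0) (Cinv (Theta 1 t 0))))); [exact Ht| |].
  - intros t Ht'. destruct (theta_taylor_eisenstein t Ht') as [N' [H3' _]]. cbv zeta in *. rewrite H3'.
  field. exact N'.
  - eapply nder_eq.
    + apply nder_mult; [apply nder_const|]. apply nder_mult; [apply nder_Theta_tau, Ht|].
      apply (nder_inv (fun t => Theta 1 t 0)); [apply nder_Theta_tau, Ht|exact N].
    + cbv beta. rewrite H3, H5. field. exact N.
Qed.

(** The formula for the fifth derivative at 0 is solved for E_4; differentiating it brings in the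
    seventh, and with it E_6. *)
Lemma nder_E4 (tau : C) : 0 < Im tau ->
  nder E4 tau (Cmult (/ 3) (Cminus (Cmult (E2 tau) (E4 tau)) (E6 tau))).
Proof.
  intros Ht. destruct (theta_taylor_eisenstein tau Ht) as [N [H3 [H5 H7]]]. cbv zeta in *.
  apply (nder_ext_upper (fun t => Cplus (Cmult (5 / 2) (Cmult (E2 t) (E2 t))) (Cmult (-24)
    (Cmult (Theta 5 t 0) (Cinv (Theta 1 t 0)))))); [exact Ht| |].
  - intros t Ht'. destruct (theta_taylor_eisenstein t Ht') as [N' [_ [H5' _]]]. cbv zeta in *.
  rewrite H5'. field. exact N'.
  - eapply nder_eq.
    + apply nder_plus.
      * apply nder_mult; [apply nder_const|]. apply nder_mult; apply (nder_E2 tau Ht).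
      * apply nder_mult; [apply nder_const|]. apply nder_mult; [apply nder_Theta_tau, Ht|].
        apply (nder_inv (fun t => Theta 1 t 0)); [apply nder_Theta_tau, Ht|exact N].
    + cbv beta. rewrite H3, H5, H7. field. exact N.
Qed.

(** The derivative may be an existential variable that the rules fill in, so that long derivative
    expressions are never written down. *)
Ltac nder_tac :=
  lazymatch goal with
  | |- nder (fun _ => ?c) _ _ => apply nder_const
  | |- nder (fun _ => Cplus _ _) _ _ => apply nder_plus; nder_tac
  | |- nder (fun _ => Cmult _ _) _ _ => apply nder_mult; nder_tac
  | |- nder (Theta ?k ?tau) _ _ => apply (nder_Theta_z k tau); assumption
  | |- nder (fun t => Theta ?k t ?z) _ _ => apply (nder_Theta_tau k _ z); assumption
  | |- nder E2 _ _ => apply nder_E2; assumption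
  | |- nder E4 _ _ => apply nder_E4; assumption
  end.

(* Weierstrass's [p'' = 6 p^2 - E_4 / 24] with denominators cleared. *)
Definition quartic (tau z : C) : C :=
  Cplus (Cplus (Cmult (Theta 0 tau z) (Theta 4 tau z))
    (Cplus (Cmult (-4) (Cmult (Theta 1 tau z) (Theta 3 tau z))) (Cmult 3
      (Cmult (Theta 2 tau z) (Theta 2 tau z)))))
  (Cplus (Cmult (-1) (Cmult (E2 tau) (Cplus (Cmult (Theta 0 tau z) (Theta 2 tau z)) (Cmult (-1)
    (Cmult (Theta 1 tau z) (Theta 1 tau z))))))
    (Cmult (1 / 24) (Cmult (Cplus (Cmult (E2 tau) (E2 tau)) (Cmult (-1) (E4 tau)))
      (Cmult (Theta 0 tau z) (Theta 0 tau z))))).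

(** This is [theta_quartic_relation] divided by theta'(0)^2; its last coefficient becomes (5/48 -
    1/16) E_2^2 - E_4 / 24. *)
Lemma quartic_0 (tau z : C) : 0 < Im tau -> quartic tau z = 0.
Proof.
  intros Ht. assert (H := theta_quartic_relation tau z Ht). cbv zeta in H.
  destruct (theta_taylor_eisenstein tau Ht) as [N [H3 [H5 _]]]. cbv zeta in *.
  rewrite H3, H5 in H.
  match type of H with ?L = _ =>
    assert (E : quartic tau z = Cdiv L (Cmult (Theta 1 tau 0) (Theta 1 tau 0)))
      by (unfold quartic; field; exact N)
  end.
  rewrite E, H. field. exact N.
Qed.

(** * Evaluation of the operators H_k *)

Lemma nder_unique (f : C -> C) (z l m : C) : nder f z l -> nder f z m -> l = m.
Proof.
  intros H1 H2. apply cder_unique in H1, H2. rewrite H1 in H2.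
  assert (N := twopii_neq_0).
  replace l with (Cdiv (Cmult twopii l) twopii) by (field; exact N). rewrite H2. field. exact N.
Qed.

Lemma qDq_eq (phi : C -> C -> C) (tau z l : C) : nder (fun t => phi t z) tau l -> qDq phi tau z = l.
Proof. intros H. unfold qDq. rewrite (cder_unique _ _ _ H). field. exact twopii_neq_0. Qed.

Lemma zDz_eq (phi : C -> C -> C) (tau z l : C) : nder (fun w => phi tau w) z l -> zDz phi tau z = l.
Proof. intros H. unfold zDz. rewrite (cder_unique _ _ _ H). field. exact twopii_neq_0. Qed.

(** Agreement of [psi] with [phi] for t in the upper half-plane suffices for the derivative in tau;
    the first derivative in z is asked for at every w because it is differentiated again. *)
Lemma Hk_eq (k : nat) (phi psi : C -> C -> C) (psi1 : C -> C) (d psi2 v tau z : C) : 0 < Im tau ->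
  (forall t w, 0 < Im t -> psi t w = phi t w) ->
  nder (fun t => psi t z) tau d ->
  (forall w, nder (fun w => psi tau w) w (psi1 w)) ->
  nder psi1 z psi2 ->
  Cminus (Cminus (Cmult 12 d) (Cmult (3 / 2) psi2))
    (Cmult (RtoC ((2 * INR k - 1) / 2)) (Cmult (E2 tau) (psi tau z))) = v ->
  Hk k phi tau z = v.
Proof.
  intros Ht Hpsi H1 H2 H3 <-. unfold Hk, Hop2.
  rewrite (qDq_eq phi tau z d).
  2: { apply (nder_ext_upper (fun t => psi t z)); [exact Ht|intros; apply Hpsi; assumption|exact H1]. }
  rewrite (zDz_eq (zDz phi) tau z psi2).
  - rewrite Hpsi by exact Ht. rewrite (RtoC_div 3 2) by lra. reflexivity.
  - apply (cder_ext psi1); [|exact H3]. intros w. symmetry. apply zDz_eq.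
    apply (cder_ext (fun w => psi tau w)); [intros; apply Hpsi, Ht|apply H2].
Qed.

(** Expanded form of 18 theta^2 [wpnum], that is, -18 p theta^4. *)
Definition h2theta4 (tau z : C) : C :=
  Cplus (Cmult 18 (Cmult (Cmult (Theta 0 tau z) (Theta 0 tau z))
     (Cplus (Cmult (Theta 0 tau z) (Theta 2 tau z)) (Cmult (-1) (Cmult (Theta 1 tau z) (Theta 1 tau z))))))
   (Cmult (- 3 / 2) (Cmult (E2 tau) (Cmult (Cmult (Theta 0 tau z) (Theta 0 tau z))
     (Cmult (Theta 0 tau z) (Theta 0 tau z))))).

(* [- theta^2 p], with [p] the Weierstrass function. *)
Definition wpnum (tau z : C) : C :=
  Cplus (Cplus (Cmult (Theta 0 tau z) (Theta 2 tau z)) (Cmult (-1) (Cmult (Theta 1 tau z) (Theta 1 tau z))))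
    (Cmult (- 1 / 12) (Cmult (E2 tau) (Cmult (Theta 0 tau z) (Theta 0 tau z)))).

Definition h4theta4 (tau z : C) : C :=
  Cplus (Cmult 54 (Cmult (wpnum tau z) (wpnum tau z)))
    (Cmult (39 / 8) (Cmult (E4 tau) (Cmult (Cmult (Theta 0 tau z) (Theta 0 tau z))
      (Cmult (Theta 0 tau z) (Theta 0 tau z))))).

Lemma Hk_2_theta4 (tau z : C) : 0 < Im tau -> Hk 2 theta4 tau z = h2theta4 tau z.
Proof.
  intros Ht.
  eapply (Hk_eq 2 theta4 (fun t w => Cmult (Cmult (Theta 0 t w) (Theta 0 t w))
    (Cmult (Theta 0 t w) (Theta 0 t w)))).
  - exact Ht.
  - intros t w Ht'. unfold theta4. rewrite jtheta_Theta by exact Ht'. simpl. ring.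
  - nder_tac.
  - intros w. nder_tac.
  - nder_tac.
  - cbv beta. unfold h2theta4. replace ((2 * INR 2 - 1) / 2) with (3 / 2) by (simpl; field).
    rewrite RtoC_div by lra. field.
Qed.

Lemma Hk_4_theta4 (tau z : C) : 0 < Im tau -> Hk 4 (Hk 2 theta4) tau z = h4theta4 tau z.
Proof.
  intros Ht.
  eapply (Hk_eq 4 (Hk 2 theta4) h2theta4).
  - exact Ht.
  - intros t w Ht'. symmetry. apply Hk_2_theta4, Ht'.
  - unfold h2theta4. nder_tac.
  - intros w. unfold h2theta4. nder_tac.
  - nder_tac.
  (* 81 is the coefficient of theta^3 theta'''' in the raw expression: 12 * 18 / 2 from the
     derivative in tau minus (3/2) * 18 from the second derivative in z. No fourth derivative occurs
     in [h4theta4], so this multiple of [quartic] must account for it. *)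
  - transitivity (Cplus (h4theta4 tau z) (Cmult 81 (Cmult (Cmult (Theta 0 tau z) (Theta 0 tau z)) (quartic tau z)))).
    + cbv beta. unfold h2theta4, h4theta4, wpnum, quartic.
      replace ((2 * INR 4 - 1) / 2) with (7 / 2) by (simpl; field). rewrite RtoC_div by lra. field.
    + rewrite quartic_0 by exact Ht. ring.
Qed.

Theorem theorem3p1 : forall tau z : C, 0 < Im tau ->
  Cplus (Cminus (Hk 6 (Hk 4 (Hk 2 theta4)) tau z)
                (Cmult (RtoC (23/4)) (Cmult (E4 tau) (Hk 2 theta4 tau z))))
        (Cmult (RtoC (81/4)) (Cmult (E6 tau) (theta4 tau z))) = 0.
Proof.
  intros tau z Ht.
  set (T k := Theta k tau z).
  (* [quartic] vanishes identically, hence so do its derivatives; these variables receive their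
     expanded forms, first and second in z and first in tau. *)
  evar (X1 : C -> C). evar (X2 : C). evar (XD : C).
  assert (HX1 : forall w, nder (fun w => quartic tau w) w (X1 w)).
  { intros w. unfold quartic, X1. nder_tac. }
  assert (HX2 : nder X1 z X2). { unfold X1, X2. nder_tac. }
  assert (HXD : nder (fun t => quartic t z) tau XD). { unfold quartic, XD. nder_tac. }
  assert (ZX1 : forall w, X1 w = 0).
  { intros w. apply (nder_unique (fun w => quartic tau w) w); [apply HX1|].
    apply (cder_ext (fun _ => 0)); [intros; symmetry; apply quartic_0, Ht|apply nder_const]. }
  assert (ZX2 : X2 = 0).
  { apply (nder_unique X1 z); [exact HX2|].
    apply (cder_ext (fun _ => 0)); [intros; symmetry; apply ZX1|apply nder_const]. }
  assert (ZXD : XD = 0).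
  { apply (nder_unique (fun t => quartic t z) tau); [exact HXD|].
    apply (nder_ext_upper (fun _ => 0)); [exact Ht|intros; symmetry; apply quartic_0;
      assumption|apply nder_const]. }
  evar (V : C).
  assert (HV : Hk 6 (Hk 4 (Hk 2 theta4)) tau z = V).
  { eapply (Hk_eq 6 (Hk 4 (Hk 2 theta4)) h4theta4).
    - exact Ht.
    - intros t w Ht'. symmetry. apply Hk_4_theta4, Ht'.
    - unfold h4theta4, wpnum. nder_tac.
    - intros w. unfold h4theta4, wpnum. nder_tac.
    - nder_tac.
    - unfold V. reflexivity. }
  rewrite HV, Hk_2_theta4 by exact Ht. unfold theta4. rewrite jtheta_Theta by exact Ht.
  (* 486 = 12 * 54 - (3/2) * 108 is the coefficient of [wpnum] theta theta'''' in [V]. In the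
     bracket after 54, sixth derivatives of theta cancel in [XD - X2 / 2], the term in [X1] removes
     the fifth and the multiple of [quartic] the fourth. The factor 54 is fixed by E_6: through D
     E_4, [XD] contains theta^2 E_6 / 72, and 81/4 - 39/2 = 54/72, where 39/2 = 12 * (39/8) / 3
     comes from the E_4 term of [h4theta4]. *)
  transitivity (Cplus (Cmult 486 (Cmult (wpnum tau z) (quartic tau z)))
    (Cmult 54 (Cplus (Cmult (Cmult (T 0%nat) (T 0%nat)) (Cminus XD (Cmult (/ 2) X2)))
      (Cplus (Cmult (Cmult (T 0%nat) (T 1%nat)) (X1 z))
             (Cmult (Cminus (Cmult 3 (Cmult (T 1%nat) (T 1%nat))) (Cmult 4
               (Cmult (T 0%nat) (T 2%nat)))) (quartic tau z)))))).
  - unfold V, T, X1, X2, XD, h4theta4, h2theta4, wpnum, quartic. cbv beta. cbn [Cpow].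
    replace ((2 * INR 6 - 1) / 2) with (11 / 2) by (simpl; field). rewrite !RtoC_div by lra. field.
  - rewrite (ZX1 z), ZX2, ZXD, (quartic_0 tau z Ht). ring.
Qed.
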